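(* Let $d\ge 2$ and let $\Omega\subseteq\mathbb{R}^{d+1}$ be a domain with $0\in\partial\Omega$. There exist constants $A=A(d)$, $L=L(d)$, $\epsilon=\epsilon(d)>0$ such that if $\partial\Omega$ is $(\epsilon,d)$-Reifenberg flat, then there exists a collection $\{\Omega_j\}_{j\ge1}$ of $L$-Lipschitz graph domains such that (i) $\Omega_j\subseteq\Omega$ for all $j$; (ii) $\Omega\cap B(0,1)\subseteq\bigcup_{j}\Omega_j$; (iii) there is $C=C(d)>0$ such that every $x\in\Omega$ belongs to $\Omega_j$ for at most $C$ values of $j$; (iv) for every $y\in\partial\Omega\cap B(0,1)$ and $0<r\le1$, $$\sum_{j}\mathcal{H}^d(\partial\Omega_j\cap B(y,r))\le C'\,\mathcal{H}^d(\partial\Omega\cap B(y,Ar)),$$ where $C'$ depends only on $\epsilon,d,L$.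
   Context: For closed sets $E,F$ and a ball $B$, $d_B(E,F)=\frac{2}{\operatorname{diam}B}\max\{\sup_{y\in E\cap B}\operatorname{dist}(y,F),\sup_{y\in F\cap B}\operatorname{dist}(y,E)\}$; $b\beta^d_E(B)=\inf_P d_B(E,P)$ over affine $d$-planes $P$. A set $E$ is $(\epsilon,d)$-Reifenberg flat if $b\beta^d_E(B(x,r))\le\epsilon$ for all $x\in E$, $r>0$. $\mathcal{H}^d$ is $d$-dimensional Hausdorff measure. An open connected set $\Omega'\subseteq\mathbb{R}^{d+1}$ is an $M$-Lipschitz graph domain if there is a composition $A$ of a translation, a dilation and a rotation and a function $r:\mathbb{S}^d\to(0,\infty)$ such that $\partial A(\Omega')=\{r(\theta)\theta:\theta\in\mathbb{S}^d\}$, $|r(\theta)-r(\psi)|\le M|\theta-\psi|$ for all $\theta,\psi$, and $\frac{1}{1+M}\le r(\theta)\le1$. *)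

(* Defs.v *)
From HB Require Import structures.
From mathcomp Require Import all_boot all_order all_algebra.
From mathcomp Require Import all_classical all_reals all_analysis.
Set Implicit Arguments. Unset Strict Implicit. Unset Printing Implicit Defensive.
Import Order.TTheory GRing.Theory Num.Theory.
Import numFieldNormedType.Exports.
Local Open Scope classical_set_scope.
Local Open Scope ring_scope.

Section Defs.
Variables (R : realType) (n : nat).
Local Notation V := 'rV[R]_n.

Definition enorm (x : V) : R := Num.sqrt (\sum_(i < n) x ord0 i ^+ 2).
Definition eball (x : V) (r : R) : set V := [set y | enorm (y - x) < r].

Definition bdry (A : set V) : set V := closure A `\` interior A.

Definition domain (A : set V) : Prop := open A /\ connected A.

(* diameter (0 for the empty set, +oo for unbounded sets) *)
Definition ediam (U : set V) : \bar R :=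
  ereal_sup ([set (enorm (x - y))%:E | x in U & y in U] `|` [set 0%E]).

(* Unnormalized d-dimensional Hausdorff measure: sup over delta>0 of the
   delta-contents inf { sum_k diam(U_k)^d : E c U_k U_k, diam U_k <= delta } *)
Definition hausdorff_content (d : nat) (delta : R) (E : set V) : \bar R :=
  ereal_inf [set (\sum_(0 <= k <oo) (ediam (U k) ^+ d)%E)%E
            | U in [set U : nat -> set V |
                     E `<=` \bigcup_k U k /\ forall k, (ediam (U k) <= delta%:E)%E]].
Definition hausdorff (d : nat) (E : set V) : \bar R :=
  ereal_sup [set hausdorff_content d delta E | delta in [set delta : R | 0 < delta]].

Definition edist (y : V) (F : set V) : \bar R :=
  ereal_inf [set (enorm (y - z))%:E | z in F].

(* d_B(E,F) for the ball B = B(x,r) (diam B = 2r); sup over an empty set is 0 *)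
Definition dB (x : V) (r : R) (E F : set V) : \bar R :=
  ((2 / (2 * r))%:E *
   maxe (ereal_sup ([set edist y F | y in E `&` eball x r] `|` [set 0%E]))
        (ereal_sup ([set edist y E | y in F `&` eball x r] `|` [set 0%E])))%E.

Definition affine_plane (d : nat) (P : set V) : Prop :=
  exists (p : V) (M : 'M[R]_(d, n)),
    \rank M = d /\ P = [set p + u *m M | u in [set: 'rV[R]_d]].

Definition bbeta (d : nat) (E : set V) (x : V) (r : R) : \bar R :=
  ereal_inf [set dB x r E P | P in [set P | affine_plane d P]].

Definition reifenberg_flat (eps : R) (d : nat) (E : set V) : Prop :=
  forall x r, E x -> 0 < r -> (bbeta d E x r <= eps%:E)%E.

Definition sphere : set V := [set theta | enorm theta = 1].

Definition lipschitz_graph_domain (M : R) (O : set V) : Prop :=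
  domain O /\
  exists (lam : R) (Q : 'M[R]_n) (b : V) (rad : V -> R),
    [/\ 0 < lam /\ Q *m Q^T = 1%:M /\ \det Q = 1,
        bdry ((fun x => lam *: (x *m Q) + b) @` O) = [set rad th *: th | th in sphere],
        (forall th, sphere th -> 0 < rad th),
        (forall th ps, sphere th -> sphere ps ->
            `|rad th - rad ps| <= M * enorm (th - ps)) &
        (forall th, sphere th -> 1 / (1 + M) <= rad th <= 1)].
End Defs.

(* Main.v *)
Require Import Defs.
From HB Require Import structures.
From mathcomp Require Import all_boot all_order all_algebra.
From mathcomp Require Import all_classical all_reals all_analysis.
From mathcomp Require Import zify ring lra.
Set Implicit Arguments. Unset Strict Implicit. Unset Printing Implicit Defensive.
Import Order.TTheory GRing.Theory Num.Theory.
Import numFieldNormedType.Exports.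
Local Open Scope classical_set_scope.
Local Open Scope ring_scope.

(** Fix separated nets of [E = bdry Omega] at the scales [b^-k], arranged in a tree, and at each
    node the normal of a plane close to [E].  Cut the tree into stopping-time regions: a new
    region starts at a node whose normal has inner product less than [alpha] with the normal
    at the root of the current region, i.e. when the planes are nearly orthogonal.

    Each region gives two domains, one on each side of the plane at its root: the union of the
    drops joining the Whitney points of its nodes to a fixed ball above the root.  Such a union
    is starlike with respect to a ball, hence a Lipschitz graph domain, and it avoids [E]; being
    connected, it lies in [Omega] or misses it.  Keeping those which meet [Omega], one never
    needs to know on which side of [E] the domain lies.

    For the packing estimate, let [rho_i] be the radii of a cover of [E] by small balls.  A disc
    of radius comparable to the scale [r_t] in the plane at the root of a region [t] is covered
    by the projections of some of these balls and of the parts of [E] near the child regions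
    [a].  The latter lie in slabs of width [alpha r_a], since the plane at [a] is almost
    orthogonal to that at [t], so that [c r_t^d <= C sum_i rho_i^d + C alpha sum_a r_a^d].
    Summing over [t], the last sum is absorbed when [alpha] is small, whence
    [sum_t r_t^d <= C H^d(E)].  No lower regularity of [E] is presupposed: it comes out of the
    same inequality. *)

(** * Euclidean geometry of row vectors *)

(** Two demands pull the stopping angle in opposite directions: absorption wants [alpha] small in
    terms of the dimension, starlikeness wants the normals of a region not to turn too far. One
    parameter [H] reconciles them. The centre of a domain sits at height [H] times the scale of the
    root and [alpha = 12 / H], so the climb to the centre still rises 12 root scales along every
    normal of the region; the price is only the Lipschitz constant [2 * H]. Then [b] is of order
    [H], [eta] of order [1 / (b * H)], and the flatness is smaller by a further factor of order [H].
    An absorbed sum must be finite, which nothing guarantees a priori for the sum over all regions.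
    The estimates are therefore relative to a finite cover by balls: a node is dead once a covering
    ball of at least its size lies nearby, and only finitely many live roots remain. The bounds do
    not depend on the cover and pass to the Hausdorff measure by compactness. Volumes of discs and
    slabs are replaced by numbers of points of a fine grid in a hyperplane. *)

Section Euclid.
Variables (R : realType) (n : nat).
Local Notation V := 'rV[R]_n.
Implicit Types (x y z u v : V) (a b e : R).

Definition dot x y : R := \sum_(i < n) x ord0 i * y ord0 i.

Lemma dotC x y : dot x y = dot y x.
Proof. by apply: eq_bigr => i _; rewrite mulrC. Qed.

Lemma dotDl x y z : dot (x + y) z = dot x z + dot y z.
Proof. by rewrite -big_split; apply: eq_bigr => i _; rewrite mxE mulrDl. Qed.

Lemma dotZl a x y : dot (a *: x) y = a * dot x y.
Proof. by rewrite mulr_sumr; apply: eq_bigr => i _; rewrite mxE mulrA. Qed.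

Lemma dotNl x y : dot (- x) y = - dot x y.
Proof. by rewrite -scaleN1r dotZl mulN1r. Qed.

Lemma dotBl x y z : dot (x - y) z = dot x z - dot y z.
Proof. by rewrite dotDl dotNl. Qed.

Lemma dotDr x y z : dot x (y + z) = dot x y + dot x z.
Proof. by rewrite dotC dotDl !(dotC x). Qed.

Lemma dotZr a x y : dot x (a *: y) = a * dot x y.
Proof. by rewrite dotC dotZl (dotC x). Qed.

Lemma dotNr x y : dot x (- y) = - dot x y.
Proof. by rewrite dotC dotNl (dotC x). Qed.

Lemma dotBr x y z : dot x (y - z) = dot x y - dot x z.
Proof. by rewrite dotDr dotNr. Qed.

Lemma dot0l x : dot 0 x = 0.
Proof. by rewrite -(scale0r 0) dotZl mul0r. Qed.

Lemma dot_ge0 x : 0 <= dot x x.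
Proof. by apply: sumr_ge0 => i _; rewrite -expr2 sqr_ge0. Qed.

Lemma enormE x : enorm x = Num.sqrt (dot x x).
Proof. by rewrite /enorm; congr Num.sqrt; apply: eq_bigr => i _; rewrite expr2. Qed.

Lemma enorm_sqr x : enorm x ^+ 2 = dot x x.
Proof. by rewrite enormE sqr_sqrtr // dot_ge0. Qed.

Lemma enorm_ge0 x : 0 <= enorm x.
Proof. exact: sqrtr_ge0. Qed.

Lemma enorm0 : enorm (0 : V) = 0.
Proof. by rewrite enormE dot0l sqrtr0. Qed.

Lemma enormZ a x : enorm (a *: x) = `|a| * enorm x.
Proof.
by rewrite !enormE dotZl dotZr mulrA -expr2 sqrtrM ?sqr_ge0 // sqrtr_sqr.
Qed.

Lemma enormN x : enorm (- x) = enorm x.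
Proof. by rewrite -scaleN1r enormZ normrN1 mul1r. Qed.

Lemma enormBC x y : enorm (x - y) = enorm (y - x).
Proof. by rewrite -enormN opprB. Qed.

Lemma coord_le_enorm x i : `|x ord0 i| <= enorm x.
Proof.
rewrite -sqrtr_sqr ler_wsqrtr // (bigD1 i) //= lerDl.
by apply: sumr_ge0 => j _; rewrite sqr_ge0.
Qed.

Lemma enorm0_eq0 x : enorm x = 0 -> x = 0.
Proof.
move=> x0; apply/rowP => i; rewrite mxE; apply/eqP; rewrite -normr_le0 -x0.
exact: coord_le_enorm.
Qed.

Lemma dot_le x y : `|dot x y| <= enorm x * enorm y.
Proof.
have [->|y0] := eqVneq y 0; first by rewrite dotC dot0l normr0 enorm0 mulr0.
have yy : 0 < dot y y.
  rewrite -enorm_sqr exprn_gt0 // lt_neqAle enorm_ge0 andbT eq_sym.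
  by apply: contra_neq y0; exact: enorm0_eq0.
have := dot_ge0 (dot y y *: x - dot x y *: y).
rewrite !dotBl !dotBr !dotZl !dotZr (dotC y x).
set s := dot x y; set p := dot x x; set q := dot y y in yy *.
have -> : q * (q * p) - q * (s * s) - (s * (q * s) - s * (s * q)) = q * (p * q - s ^+ 2) by ring.
rewrite pmulr_rge0 // subr_ge0 => h.
rewrite -(@ler_pXn2r _ 2) ?nnegrE ?normr_ge0 ?mulr_ge0 ?enorm_ge0 //.
by rewrite real_normK ?num_real // exprMn !enorm_sqr.
Qed.

Lemma enormD x y : enorm (x + y) <= enorm x + enorm y.
Proof.
rewrite -(@ler_pXn2r _ 2) ?nnegrE ?addr_ge0 ?enorm_ge0 //.
rewrite enorm_sqr sqrrD !enorm_sqr dotDl !dotDr (dotC y x).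
have := dot_le x y; have := ler_norm (dot x y); lra.
Qed.

Lemma enormB x y : enorm (x - y) <= enorm x + enorm y.
Proof. by rewrite -(enormN y) enormD. Qed.

Lemma enorm_triangle y x z : enorm (x - z) <= enorm (x - y) + enorm (y - z).
Proof. by rewrite -[x - z](subrKA y) enormD. Qed.

Lemma enorm_le_sum x : enorm x <= \sum_i `|x ord0 i|.
Proof.
have s0 : 0 <= \sum_i `|x ord0 i| by apply: sumr_ge0.
rewrite -(@ler_pXn2r _ 2) ?nnegrE ?enorm_ge0 // enorm_sqr expr2 mulr_suml.
apply: ler_sum => i _; rewrite -[_ * _]ger0_norm -?expr2 ?sqr_ge0 // expr2 normrM.
by rewrite ler_wpM2l // (bigD1 i) //= lerDl sumr_ge0.
Qed.

Lemma enorm_le_coord x a : (forall i, `|x ord0 i| <= a) -> enorm x <= n%:R * a.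
Proof.
move=> h; apply: (le_trans (enorm_le_sum x)).
apply: (le_trans (ler_sum _ (fun i _ => h i))).
by rewrite sumr_const card_ord mulr_natl.
Qed.

Lemma mx_norm_le_enorm x : `|x| <= enorm x.
Proof.
have [/eqP ->|x0] := boolP (`|x| == 0); first exact: enorm_ge0.
have [[i j] e] := mx_norm_neq0 x0.
have -> : `|x| = mx_norm x by [].
by rewrite e /= ord1 coord_le_enorm.
Qed.

Lemma coord_le_mx_norm x i : `|x ord0 i| <= `|x|.
Proof.
have -> : `|x| = mx_norm x by [].
rewrite mx_normrE.
by apply/bigmax_geP; right; exists (ord0, i).
Qed.

Lemma enorm_le_mx_norm x : enorm x <= n%:R * `|x|.
Proof. by apply: enorm_le_coord; exact: coord_le_mx_norm. Qed.

Lemma nbhs_eball x (A : set V) : nbhs x A <-> exists2 e, 0 < e & eball x e `<=` A.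
Proof.
split => [/nbhs_ballP [e /= e0 h]|[e e0 h]].
  exists e => // y; rewrite /eball /= => yx; apply: h.
  by rewrite -ball_normE /ball_ /= distrC; apply: le_lt_trans yx; apply: mx_norm_le_enorm.
have c0 : 0 < (n.+1)%:R :> R by rewrite ltr0n.
apply/nbhs_ballP; exists (e / n.+1%:R); first by rewrite /= divr_gt0.
move=> y; rewrite -ball_normE /ball_ /= distrC ltr_pdivlMr // => yx; apply: h.
apply: le_lt_trans yx; apply: (le_trans (enorm_le_mx_norm _)).
by rewrite mulrC ler_wpM2l // ler_nat.
Qed.

Lemma eball_center x e : 0 < e -> eball x e x.
Proof. by rewrite /eball /= subrr enorm0. Qed.

Lemma open_eballP (A : set V) :
  open A <-> forall x, A x -> exists2 e, 0 < e & eball x e `<=` A.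
Proof.
rewrite openE; split => h x /h; first by move=> /nbhs_eball.
by move=> ?; apply/nbhs_eball.
Qed.

Lemma open_eball x e : open (eball x e).
Proof.
apply/open_eballP => y; rewrite /eball /= => yx.
exists (e - enorm (y - x)); first by rewrite subr_gt0.
move=> z /=; rewrite ltrBrDr; apply: le_lt_trans; exact: enorm_triangle.
Qed.

Lemma closure_eballP (A : set V) x :
  closure A x <-> forall e, 0 < e -> exists2 y, A y & enorm (y - x) < e.
Proof.
split => [h e e0|h B /nbhs_eball [e e0 eB]].
  have /h [y [Ay yx]] : nbhs x (eball x e) by apply/nbhs_eball; exists e.
  by exists y.
by have [y Ay yx] := h _ e0; exists y; split => //; apply: eB.
Qed.

Lemma closed_eballP (A : set V) x : closed A ->
  (forall e, 0 < e -> exists2 y, A y & enorm (y - x) < e) -> A x.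
Proof. by move=> /closure_id Ac h; rewrite Ac; apply/closure_eballP. Qed.

End Euclid.

(** * Counting lattice points and separated points *)

Section Counting.

Lemma inord_mod_inj (N a b : nat) : (a < N.+1)%N -> (b < N.+1)%N ->
  (inord a : 'I_N.+1) = inord b -> a = b.
Proof. by move=> aN bN /(congr1 val); rewrite /= !inordK. Qed.

Lemma eqmod_close (a b L : nat) : (a <= b + L)%N -> (b <= a + L)%N ->
  (a %% L.+1 = b %% L.+1)%N -> a = b.
Proof.
wlog ba : a b / (b <= a)%N.
  move=> h ab ba e; case/orP: (leq_total b a) => [l|l]; first exact: h.
  by symmetry; apply: h.
move=> ab _ /eqP; rewrite eqn_mod_dvd // => /dvdnP [q e].
case: q e => [|q] e; first by lia.
have : (L.+1 <= q.+1 * L.+1)%N by rewrite leq_pmull.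
lia.
Qed.

(* Reducing one coordinate mod [L'.+1] and the others mod [L.+1] is injective on [G]. *)
Lemma card_thin_box (d m L L' : nat) (j0 : 'I_d) (G : {set {ffun 'I_d -> 'I_m}}) :
  (forall u v j, u \in G -> v \in G -> (u j <= v j + L)%N) ->
  (forall u v, u \in G -> v \in G -> (forall j, j != j0 -> u j = v j) ->
     (u j0 <= v j0 + L')%N) ->
  (#|G| <= L.+1 ^ d.-1 * L'.+1)%N.
Proof.
move=> hL hL'.
pose M := maxn L L'.
pose B (j : 'I_d) := if j == j0 then L' else L.
have BM j a : (a %% (B j).+1 < M.+1)%N.
  apply: (leq_trans (ltn_pmod _ (ltn0Sn _))).
  by rewrite /B ltnS; case: ifP => _; rewrite ?leq_maxl ?leq_maxr.
pose f (u : {ffun 'I_d -> 'I_m}) : {ffun 'I_d -> 'I_M.+1} :=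
  [ffun j => inord (u j %% (B j).+1)].
have finj : {in G &, injective f}.
  move=> u v uG vG /ffunP e.
  have {}e j : (u j %% (B j).+1 = v j %% (B j).+1)%N.
    by have := e j; rewrite !ffunE => /inord_mod_inj; apply.
  have e1 j : j != j0 -> u j = v j.
    move=> jj0; apply: val_inj; apply: (@eqmod_close _ _ L) => /=; [exact: hL|exact: hL|].
    by have := e j; rewrite /B (negbTE jj0).
  apply/ffunP => j; have [->|] := eqVneq j j0; last exact: e1.
  apply: val_inj; apply: (@eqmod_close _ _ L') => /=.
  - exact: hL'.
  - by apply: hL' => // i /e1.
  - by have := e j0; rewrite /B eqxx.
rewrite -(card_in_imset finj).
pose F (j : 'I_d) : pred 'I_M.+1 := fun x => (x < (B j).+1)%N.
apply: (@leq_trans #|(family F : pred {ffun 'I_d -> 'I_M.+1})|).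
  apply/subset_leq_card/fintype.subsetP => _ /imsetP [u uG ->].
  by apply/familyP => j; rewrite ffunE unfold_in /= inordK ?ltn_pmod.
have cF j : #|F j| = (B j).+1.
  have BjM : ((B j).+1 <= M.+1)%N.
    by rewrite ltnS /B; case: ifP => _; rewrite ?leq_maxl ?leq_maxr.
  have inj : injective (widen_ord BjM) by move=> x y /(congr1 val) /= ?; apply: val_inj.
  rewrite -[RHS](card_ord (B j).+1) -(fintype.card_image inj).
  apply: eq_card => x; rewrite unfold_in /F; apply/idP/mapP => /= [h|[y _ ->]].
    by exists (Ordinal h); rewrite ?mem_enum //; apply: val_inj.
  by rewrite /= ltn_ord.
rewrite card_family foldrE big_map big_enum /= (bigD1 j0) //= cF {1}/B eqxx mulnC.
rewrite leq_mul2r; apply/orP; right.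
rewrite (eq_bigr (fun=> L.+1)); last by move=> j jj0; rewrite cF /B (negbTE jj0).
by rewrite prod_nat_const cardC1 card_ord.
Qed.

Lemma card_box (d m L : nat) (G : {set {ffun 'I_d -> 'I_m}}) :
  (forall u v j, u \in G -> v \in G -> (u j <= v j + L)%N) -> (#|G| <= L.+1 ^ d)%N.
Proof.
case: d G => [|d] G h.
  by rewrite (leq_trans (max_card _)) // card_ffun !card_ord !expn0.
have h' u v : u \in G -> v \in G -> (forall j, j != ord0 -> u j = v j) ->
    (u ord0 <= v ord0 + L)%N by move=> uG vG _; exact: h.
by apply: leq_trans (card_thin_box h h') _; rewrite -expnSr.
Qed.

Variables (R : realType) (n : nat).
Local Notation V := 'rV[R]_n.

(** Number of cubes of side [e / n.+1] in a grid covering a box of half-side [A * e]: two points of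
    one cube are closer than [e], because [n < n.+1]. *)
Definition packing_number (A : R) : nat := (Num.truncn (2 * A * n.+1%:R)).+1 ^ n.

Lemma card_separated (A e : R) (y : V) (s : seq V) : 0 < e -> uniq s ->
  (forall x, x \in s -> enorm (x - y) <= A * e) ->
  (forall x x', x \in s -> x' \in s -> enorm (x - x') < e -> x = x') ->
  (size s <= packing_number A)%N.
Proof.
move=> e0 us sA sep.
pose N := Num.truncn (2 * A * n.+1%:R).
pose c (x : V) i := (x ord0 i - y ord0 i + A * e) * (n.+1%:R / e).
have n0 : 0 < n.+1%:R :> R by rewrite ltr0n.
have ne0 : 0 < n.+1%:R / e by rewrite divr_gt0.
have c0 x i : x \in s -> 0 <= c x i.
  move=> xs; apply: mulr_ge0; last exact: ltW.
  have := le_trans (coord_le_enorm (x - y) i) (sA x xs).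
  by rewrite !mxE ler_norml => /andP [h _]; lra.
have cN x i : x \in s -> (Num.truncn (c x i) < N.+1)%N.
  move=> xs; rewrite ltnS; apply: le_truncn.
  have -> : 2 * A * n.+1%:R = (2 * (A * e)) * (n.+1%:R / e) by field; rewrite gt_eqF.
  rewrite /c ler_pM2r //.
  have := le_trans (coord_le_enorm (x - y) i) (sA x xs).
  by rewrite !mxE ler_norml => /andP [_ h]; lra.
pose f (x : V) : {ffun 'I_n -> 'I_N.+1} := [ffun i => inord (Num.truncn (c x i))].
have finj : {in s &, injective f}.
  move=> x x' xs x's /ffunP ee; apply: sep => //.
  have {}ee i : Num.truncn (c x i) = Num.truncn (c x' i).
    by have := ee i; rewrite !ffunE => /inord_mod_inj; apply; exact: cN.
  have h i : `|(x - x') ord0 i| <= e / n.+1%:R.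
    have /andP [a1 a2] := truncn_itv (c0 x i xs).
    have /andP [b1 b2] := truncn_itv (c0 x' i x's).
    rewrite !mxE; move: a1 a2 b1 b2; rewrite -ee; set t := Num.truncn _.
    rewrite -natr1 => a1 a2 b1 b2.
    have cc : c x i - c x' i = (x ord0 i - x' ord0 i) * (n.+1%:R / e) by rewrite /c; ring.
    rewrite -(ler_pM2r ne0) -{1}(gtr0_norm ne0) -normrM -cc.
    have -> : e / n.+1%:R * (n.+1%:R / e) = 1 by field; rewrite !gt_eqF.
    by rewrite ler_norml; apply/andP; split; lra.
  apply: (le_lt_trans (enorm_le_coord h)).
  by rewrite mulrCA -[ltRHS]mulr1 ltr_pM2l // ltr_pdivrMr // mul1r ltr_nat.
have um : uniq (map f s) by rewrite map_inj_in_uniq.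
rewrite -(size_map f) -(card_uniqP um); apply: (leq_trans (max_card _)).
by rewrite card_ffun !card_ord.
Qed.

End Counting.

(** * Domains starlike with respect to a ball *)

Section StarBody.
Variables (R : realType) (n : nat).
Local Notation V := 'rV[R]_n.
Implicit Types (x y z u c a th ps : V) (A O Om : set V).

(** Off its boundary [Om] agrees with its closure, so it meets [O] in a relatively clopen set. *)
Lemma connected_avoiding_bdry O Om : open Om -> connected O ->
  O `&` bdry Om = set0 -> O `&` Om !=set0 -> O `<=` Om.
Proof.
move=> oOm cO Ob0 ne.
suff e : O `&` Om = O by rewrite -e => x [].
apply: cO => //; first by exists Om.
exists (closure Om); first exact: closed_closure.
apply/seteqP; split => x [Ox Omx]; split => //; first exact: subset_closure.
apply: contrapT => nOm.
suff : (O `&` bdry Om) x by rewrite Ob0.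
by split => //; split => // /interior_subset.
Qed.

Lemma starlike_connected O c : O c ->
  (forall x s, O x -> 0 <= s <= 1 -> O ((1 - s) *: x + s *: c)) -> connected O.
Proof.
move=> Oc star.
pose seg x := (fun s : R => (1 - s) *: x + s *: c) @` `[0, 1].
have -> : O = \bigcup_(x in O) seg x.
  apply/seteqP; split => [x Ox|x [y Oy] [s /= s01 <-]].
    exists x => //; exists 0; first by rewrite /= in_itv /= lexx ler01.
    by rewrite subr0 scale1r scale0r addr0.
  by apply: star => //; move: s01; rewrite in_itv.
apply: bigcup_connected.
  exists c => x _; exists 1; first by rewrite /= in_itv /= lexx ler01.
  by rewrite subrr scale1r scale0r add0r.
move=> x _; apply: connected_continuous_connected; first exact: segment_connected.
apply: continuous_subspaceT => s; apply: cvgD; apply: cvgZr_tmp.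
  by apply: cvgB; [exact: cvg_cst|exact: cvg_id].
exact: cvg_id.
Qed.

(* The union of the open drops spanned by the points of [A] and the ball [B(c, rho)]:
   it is starlike with respect to every point of that ball. *)
Definition star_body c (rho : R) A : set V :=
  [set z | exists a s, [/\ A a, 0 < s <= 1 &
                           enorm (z - ((1 - s) *: a + s *: c)) < s * rho]].

Variables (c : V) (rho : R) (A : set V).
Hypothesis rho0 : 0 < rho.
Local Notation O := (star_body c rho A).

Lemma star_body_open : open O.
Proof.
apply/open_eballP => z [a [s [Aa s01 zs]]].
exists (s * rho - enorm (z - ((1 - s) *: a + s *: c))); first by rewrite subr_gt0.
move=> y; rewrite /eball /= => yz; exists a, s; split=> //.
by apply: (le_lt_trans (enorm_triangle z _ _)); rewrite -ltrBrDr.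
Qed.

Lemma star_body_ball a : A a -> eball c rho `<=` O.
Proof.
move=> Aa z zc; exists a, 1; rewrite ltr01 lexx subrr scale0r add0r scale1r mul1r.
by split.
Qed.

Lemma star_body_star z u (s : R) : O z -> 0 < s <= 1 -> enorm u < rho ->
  O ((1 - s) *: z + s *: (c + u)).
Proof.
(* [s + t - s * t] is [1 - (1 - s) * (1 - t)]: the two contractions towards [c] compose. *)
move=> [a [t [Aa t01 zt]]] s01 ur; exists a, (s + t - s * t); split=> //.
  by have /andP[s0 s1] := s01; have /andP[t0 t1] := t01; apply/andP; split; nra.
have -> : (1 - s) *: z + s *: (c + u) - ((1 - (s + t - s * t)) *: a + (s + t - s * t) *: c)
   = (1 - s) *: (z - ((1 - t) *: a + t *: c)) + s *: u.
  by apply/rowP => i; rewrite !mxE; ring.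
have /andP[s0 s1] := s01.
apply: (le_lt_trans (enormD _ _)).
rewrite !enormZ (ger0_norm (ltW s0)) ger0_norm ?subr_ge0 //.
have -> : (s + t - s * t) * rho = (1 - s) * (t * rho) + s * rho by ring.
by rewrite ler_ltD ?ler_wpM2l ?ltr_pM2l ?subr_ge0 // ltW.
Qed.

(** The slack [rho - enorm u] absorbs the error made in replacing [z] by a point of the body. Both
    the Lipschitz constant and the measure of the boundary come from this form of starlikeness. *)
Lemma star_body_closure z u (s : R) : closure O z -> 0 < s <= 1 -> enorm u < rho ->
  O ((1 - s) *: z + s *: (c + u)).
Proof.
move=> /closure_eballP cz s01 ur; have /andP[s0 s1] := s01.
have [|z' Oz' zz'] := cz (s * (rho - enorm u)); first by rewrite mulr_gt0 ?subr_gt0.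
have -> : (1 - s) *: z + s *: (c + u) =
  (1 - s) *: z' + s *: (c + (u + ((1 - s) / s) *: (z - z'))).
  apply/rowP => i; rewrite !mxE; field; by rewrite gt_eqF.
apply: star_body_star => //.
apply: (le_lt_trans (enormD _ _)); rewrite -ltrBrDl enormZ ger0_norm; last first.
  by rewrite divr_ge0 ?subr_ge0 // ltW.
rewrite enormBC mulrAC ltr_pdivrMr // mulrC [ltRHS]mulrC.
have ez := enorm_ge0 (z' - z).
by apply: le_lt_trans zz'; nra.
Qed.

Lemma star_body_connected : O !=set0 -> connected O.
Proof.
move=> [z [a [s [Aa _ _]]]].
have Oc : O c by apply: (star_body_ball Aa); exact: eball_center.
apply: (starlike_connected Oc) => x t Ox /andP[t0 t1].
have [->|t0'] := eqVneq t 0; first by rewrite subr0 scale1r scale0r addr0.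
have := @star_body_star x 0 t Ox; rewrite addr0 enorm0; apply => //.
by rewrite lt_neqAle eq_sym t0' t0.
Qed.

Lemma star_body_bounded (r : R) z : rho <= r -> (forall a, A a -> enorm (a - c) <= r) ->
  O z -> enorm (z - c) < r.
Proof.
move=> rr Ar [a [s [Aa /andP[s0 s1] zs]]].
have -> : z - c = (1 - s) *: (a - c) + (z - ((1 - s) *: a + s *: c)).
  by apply/rowP => i; rewrite !mxE; ring.
apply: (le_lt_trans (enormD _ _)).
rewrite enormZ ger0_norm ?subr_ge0 //.
have -> : r = (1 - s) * r + s * r by ring.
rewrite ler_ltD //; first by rewrite ler_wpM2l ?subr_ge0 ?Ar.
by apply: (lt_le_trans zs); rewrite ler_wpM2l // ltW.
Qed.

End StarBody.

(** * Radial functions of star bodies *)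

Section RadialFunction.
Variables (R : realType) (n : nat).
Local Notation V := 'rV[R]_n.
Implicit Types (x y z u c a th ps : V) (A : set V).

Section Normalized.
Variables (rho : R) (A : set V).
Hypotheses (rho0 : 0 < rho) (rho1 : rho <= 1) (A0 : A !=set0).
Hypothesis A1 : forall a, A a -> enorm a <= 1.
Local Notation O := (star_body 0 rho A).

Definition radial th : R := sup [set t : R | 0 <= t /\ O (t *: th)].

Let O_lt1 z : O z -> enorm z < 1.
Proof.
move=> Oz; rewrite -[z]subr0; apply: star_body_bounded Oz => // a Aa.
by rewrite subr0 A1.
Qed.

Let O_ball z : enorm z < rho -> O z.
Proof.
by have [a Aa] := A0 => zr; apply: (star_body_ball Aa); rewrite /eball /= subr0.
Qed.

Let ub th : sphere th -> has_ubound [set t : R | 0 <= t /\ O (t *: th)].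
Proof.
move=> th1; exists 1 => t /= [t0 /O_lt1].
by rewrite enormZ th1 mulr1 ger0_norm // => /ltW.
Qed.

Lemma radial_ge th t : sphere th -> 0 <= t -> O (t *: th) -> t <= radial th.
Proof. by move=> th1 t0 Ot; apply: ub_le_sup; [exact: ub|split]. Qed.

Let ray_star th t s : O (t *: th) -> 0 <= s < t -> O (s *: th).
Proof.
move=> Ot /andP[s0 st]; have t0 := le_lt_trans s0 st.
have -> : s *: th = (1 - (1 - s / t)) *: (t *: th) + (1 - s / t) *: (0 + 0).
  by rewrite addr0 scaler0 addr0 scalerA subKr divfK // gt_eqF.
apply: star_body_star => //; last by rewrite enorm0.
by rewrite subr_gt0 ltr_pdivrMr // mul1r st /= gerBl divr_ge0 // ltW.
Qed.

Lemma lt_radial th t : sphere th -> 0 <= t < radial th -> O (t *: th).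
Proof.
move=> th1 /andP[t0 tr].
have hs : has_sup [set t : R | 0 <= t /\ O (t *: th)].
  by split; [exists 0; split => //; rewrite scale0r; apply: O_ball; rewrite enorm0|exact: ub].
have tr' : 0 < radial th - t by rewrite subr_gt0.
have [s [s0 Os] /= st] := sup_adherent tr' hs.
apply: (ray_star Os); rewrite t0 /=; move: st; rewrite -/(radial th); lra.
Qed.

(** A slight contraction towards 0 moves a closure point into the body; if the closure point lay
    beyond the supremum, so would its image. *)
Lemma radial_closure th t : sphere th -> 0 <= t -> closure O (t *: th) -> t <= radial th.
Proof.
move=> th1 t0 cl; rewrite leNgt; apply/negP => rt.
have r0 : 0 <= radial th.
  by apply: radial_ge => //; rewrite scale0r; apply: O_ball; rewrite enorm0.
pose s := (t - radial th) / (2 * t).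
have tt : 0 < t by lra.
have ts : t * s = (t - radial th) / 2 by rewrite /s; field; rewrite gt_eqF.
have s0 : 0 < s by rewrite divr_gt0 ?subr_gt0 // mulr_gt0.
have s1 : s <= 1 by rewrite ler_pdivrMr ?mulr_gt0 //; lra.
have /(star_body_closure cl) : 0 < s <= 1 by rewrite s0 s1.
move=> /(_ 0); rewrite enorm0 addr0 scaler0 addr0 scalerA => /(_ rho0) Os.
have := radial_ge th1 _ Os; rewrite mulr_ge0 ?subr_ge0 // => /(_ isT).
have -> : (1 - s) * t = t - t * s by ring.
rewrite ts; lra.
Qed.

Lemma radial_ge_rho th : sphere th -> rho <= radial th.
Proof.
move=> th1; rewrite leNgt; apply/negP => rr.
have r0 : 0 <= radial th.
  by apply: radial_ge => //; rewrite scale0r; apply: O_ball; rewrite enorm0.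
pose t := (radial th + rho) / 2.
have t0 : 0 <= t by rewrite /t; lra.
have /(radial_ge th1 t0) : O (t *: th).
  by apply: O_ball; rewrite enormZ th1 mulr1 ger0_norm // /t; lra.
by rewrite /t; lra.
Qed.

Lemma radial_le1 th : sphere th -> radial th <= 1.
Proof.
move=> th1; rewrite leNgt; apply/negP => r1.
have /O_lt1 : O (1 *: th) by apply: lt_radial; rewrite // ler01.
by rewrite scale1r th1 ltxx.
Qed.

Lemma closure_radial th : sphere th -> closure O (radial th *: th).
Proof.
move=> th1; apply/closure_eballP => e e0.
have r0 := lt_le_trans rho0 (radial_ge_rho th1).
pose t := Num.max 0 (radial th - e / 2).
exists (t *: th).
  apply: lt_radial => //; rewrite /t le_max lexx /= gt_max r0 /=; lra.
rewrite -scalerBl enormZ th1 mulr1 /t distrC ger0_norm.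
  by case: (leP 0 (radial th - e / 2)) => h; lra.
by case: (leP 0 (radial th - e / 2)) => h; lra.
Qed.

Lemma bdry_star_body : bdry O = [set radial th *: th | th in @sphere R n].
Proof.
have oO : open O by exact: star_body_open.
apply/seteqP; split => [z [cz nz]|_ [th th1 <-]].
  have Oz : ~ O z by move=> Oz; apply: nz; move: oO; rewrite openE => /(_ _ Oz).
  have zr : 0 < enorm z.
    rewrite lt_neqAle enorm_ge0 andbT eq_sym; apply/eqP => z0.
    by apply/Oz/O_ball; rewrite z0.
  pose th := (enorm z)^-1 *: z.
  have th1 : sphere th.
    by rewrite /sphere /= enormZ ger0_norm ?invr_ge0 ?enorm_ge0 // mulVf // gt_eqF.
  have ze : z = enorm z *: th by rewrite scalerA mulfV ?scale1r // gt_eqF.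
  exists th => //; suff -> : radial th = enorm z by [].
  apply/eqP; rewrite eq_le; apply/andP; split.
    rewrite leNgt; apply/negP => h; apply: Oz; rewrite ze; apply: lt_radial => //.
    by rewrite enorm_ge0.
  by apply: radial_closure => //; [exact: enorm_ge0|rewrite -ze].
split; first exact: closure_radial.
move=> /interior_subset Or.
have r0 := lt_le_trans rho0 (radial_ge_rho th1).
have [e e0 he] := (open_eballP O).1 oO _ Or.
have /(radial_ge th1) : O ((radial th + e / 2) *: th).
  apply: he; rewrite /eball /= -scalerBl enormZ th1 mulr1 ger0_norm; lra.
by lra.
Qed.

Lemma radial_lipschitz (L : R) th ps : 1 <= L * rho -> sphere th -> sphere ps ->
  `|radial th - radial ps| <= L * enorm (th - ps).
Proof.
move=> Lr.
wlog rr : th ps / radial ps <= radial th.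
  move=> h th1 ps1; case/orP: (le_total (radial ps) (radial th)) => hh; first exact: h.
  by rewrite distrC enormBC; apply: h.
move=> th1 ps1; rewrite ger0_norm ?subr_ge0 //.
have L0 : 0 < L by rewrite -(pmulr_lgt0 _ rho0); apply: lt_le_trans Lr.
have D0 := enorm_ge0 (th - ps); set D := enorm (th - ps) in D0 *.
have rt1 := radial_le1 th1; have rt0 := radial_ge_rho th1; have rp0 := radial_ge_rho ps1.
have rp : 0 < radial ps := lt_le_trans rho0 rp0.
move: (radial th) (radial ps) rt1 rt0 rp0 rp rr (closure_radial th1) (@radial_ge ps) =>
  a b rt1 rt0 rp0 rp rr cla bge.
have [L1|L1] := leP 1 (L * D); first by lra.
rewrite leNgt; apply/negP => h.
(* [s] lies strictly between [L * D] and [a - b]. The lower bound makes the correction [u] shorter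
   than [rho]; the upper one puts [(1 - s) * a] beyond [b] on the ray of [ps]. *)
pose s := (a - b + L * D) / 2.
have LD0 : 0 <= L * D by rewrite mulr_ge0 // ltW.
have s01 : 0 < s <= 1 by apply/andP; split; rewrite /s; lra.
have /andP[s0 s1] := s01.
pose u := ((1 - s) * a / s) *: (ps - th).
have ur : enorm u < rho.
  rewrite /u enormZ enormBC -/D ger0_norm; last first.
    by rewrite divr_ge0 ?mulr_ge0 ?subr_ge0 // ltW //; lra.
  rewrite mulrAC ltr_pdivrMr //.
  have LDs : L * D < s by rewrite /s; lra.
  have : D < rho * s.
    have : L * D < L * (rho * s).
      by apply: (lt_le_trans LDs); rewrite mulrA ler_peMl // ltW.
    by rewrite ltr_pM2l.
  have q1 : (1 - s) * a <= 1 by rewrite mulr_ile1 // ?subr_ge0 // ?gerBl ltW //; lra.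
  by move=> Ds; apply: le_lt_trans Ds; rewrite ler_piMl.
have := star_body_closure cla s01 ur.
have -> : (1 - s) *: (a *: th) + s *: (0 + u) = ((1 - s) * a) *: ps.
  by rewrite add0r; apply/rowP => i; rewrite !mxE; field; rewrite gt_eqF.
move=> /(bge _ ps1); rewrite mulr_ge0 ?subr_ge0 //; last lra.
move=> /(_ isT).
have : s * a <= s by rewrite ler_piMr // ltW.
by rewrite /s; lra.
Qed.

End Normalized.

(** Translating [c] to 0 and dilating by [r^-1] makes the inner radius [rho / r]; then
    [1 <= L * (rho / r)] yields both the Lipschitz bound and [1 / (1 + L) <= rho / r]. *)
Lemma star_body_lipschitz (L : R) c (rho r : R) A : 0 < rho -> rho <= r -> r <= L * rho ->
  A !=set0 -> (forall a, A a -> enorm (a - c) <= r) ->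
  lipschitz_graph_domain L (star_body c rho A).
Proof.
move=> rho0 rr rL [a0 Aa0] Ar.
have r0 := lt_le_trans rho0 rr.
split.
  split; first exact: star_body_open.
  apply: star_body_connected => //; exists c.
  by apply: (star_body_ball Aa0); exact: eball_center.
pose B : set V := [set r^-1 *: (a - c) | a in A].
have rV0 : 0 < r^-1 by rewrite invr_gt0.
have rhor0 : 0 < rho / r by rewrite divr_gt0.
have rhor1 : rho / r <= 1 by rewrite ler_pdivrMr // mul1r.
have B0 : B !=set0 by exists (r^-1 *: (a0 - c)); exists a0.
have B1 b : B b -> enorm b <= 1.
  move=> [a Aa <-]; rewrite enormZ (ger0_norm (ltW rV0)) ler_pdivrMl // mulr1.
  exact: Ar.
have LL : 1 <= L * (rho / r) by rewrite mulrA ler_pdivlMr // mul1r.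
exists r^-1, 1%:M, (- (r^-1 *: c)), (radial (rho / r) B).
split.
- by split => //; rewrite trmx1 mulmx1 det1.
- rewrite -bdry_star_body //; congr bdry; apply/seteqP; split.
    move=> _ [z [a [s [Aa s01 zs]]] <-].
    exists (r^-1 *: (a - c)), s; split => //; first by exists a.
    have -> : r^-1 *: (z *m 1%:M) - r^-1 *: c - ((1 - s) *: (r^-1 *: (a - c)) + s *: 0)
            = r^-1 *: (z - ((1 - s) *: a + s *: c)).
      by rewrite mulmx1; apply/rowP => i; rewrite !mxE; ring.
    rewrite enormZ (ger0_norm (ltW rV0)) mulrA (mulrC _ (r^-1)) ltr_pM2l //.
  move=> y [_ [s [[a Aa <-] s01 ys]]].
  exists (c + r *: y); last first.
    by rewrite mulmx1 scalerDr scalerA mulVf ?gt_eqF // scale1r addrC addKr.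
  exists a, s; split => //.
  have -> : c + r *: y - ((1 - s) *: a + s *: c)
    = r *: (y - ((1 - s) *: (r^-1 *: (a - c)) + s *: 0)).
    by apply/rowP => i; rewrite !mxE; field; rewrite gt_eqF.
  rewrite enormZ (ger0_norm (ltW r0)) mulrC -ltr_pdivlMr //.
  by apply: (lt_le_trans ys); rewrite mulrA.
- by move=> th th1; apply: lt_le_trans (radial_ge_rho _ _ _ _ th1).
- by move=> th ps th1 ps1; apply: radial_lipschitz.
- move=> th th1; rewrite radial_le1 // andbT.
  apply: le_trans (radial_ge_rho _ _ _ _ th1) => //.
  have L0 : 0 < L by rewrite -(pmulr_lgt0 _ rhor0); lra.
  rewrite ler_pdivrMr; nra.
Qed.

End RadialFunction.

(** * Hausdorff measure *)

Section HausdorffBounds.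
Variables (R : realType) (n : nat).
Local Notation V := 'rV[R]_n.
Implicit Types (x y z : V) (E F U : set V).
Local Open Scope ereal_scope.

Lemma ediam_ge0 U : 0 <= ediam U.
Proof. by apply: ereal_sup_ubound; right. Qed.

Lemma ediam_ge U x y : U x -> U y -> (enorm (x - y))%:E <= ediam U.
Proof. by move=> Ux Uy; apply: ereal_sup_ubound; left; exists x => //; exists y. Qed.

Lemma ediam_le U (e : R) : (0 <= e)%R ->
  (forall x y, U x -> U y -> (enorm (x - y) <= e)%R) -> ediam U <= e%:E.
Proof.
move=> e0 h; apply: ge_ereal_sup => _ [[x Ux [y Uy <-]]|->]; rewrite lee_fin //.
exact: h.
Qed.

Lemma ediam0 : ediam (@set0 V) = 0.
Proof. by apply/eqP; rewrite eq_le ediam_ge0 andbT; apply: ediam_le. Qed.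

Lemma lee_expe (a b : \bar R) (k : nat) : 0 <= a -> a <= b -> a ^+ k <= b ^+ k.
Proof.
move=> a0 ab; elim: k => [|k IH]; first by rewrite !expe0.
by rewrite !expeS lee_pmul // expe_ge0.
Qed.

Lemma le_hausdorff (d : nat) E F : E `<=` F -> hausdorff d E <= hausdorff d F.
Proof.
move=> EF; apply: ge_ereal_sup => _ [delta /= d0 <-].
apply: le_ereal_sup_tmp; exists (hausdorff_content d delta F); first by exists delta.
apply: ereal_inf_le_tmp => _ [U [FU dU] <-]; exists U => //; split => //.
exact: subset_trans FU.
Qed.

Lemma hausdorff_le (d : nat) (C : R) E : (0 < d)%N ->
  (forall delta, (0 < delta)%R -> exists (T : finType) (U : T -> set V) (e : R),
     [/\ (0 <= e <= delta)%R, E `<=` \bigcup_t U t,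
         (forall t x y, U t x -> U t y -> (enorm (x - y) <= e)%R) &
         (#|T|%:R * e ^+ d <= C)%R]) ->
  hausdorff d E <= C%:E.
Proof.
move=> d0 h; apply: ge_ereal_sup => _ [delta /= delta0 <-].
have [T [U [e [/andP[e0 ed] EU Ue TC]]]] := h _ delta0.
(* The finite family is completed by empty sets, which contribute nothing since [0 < d]. *)
pose W k := if insub k is Some i then U (enum_val (i : 'I_#|T|)) else set0.
have We k : ediam (W k) <= e%:E.
  rewrite /W; case: insubP => [i _ _|_]; last by rewrite ediam0 lee_fin.
  by apply: ediam_le => // x y; exact: Ue.
apply: ge_ereal_inf; exists (\sum_(0 <= k <oo) ediam (W k) ^+ d).
  exists W => //; split.
    move=> x /EU [t _ Utx]; exists (enum_rank t) => //.
    by rewrite /W insubT ?ltn_ord // => i; rewrite /= (_ : Sub _ _ = enum_rank t) ?enum_rankK //; apply: val_inj.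
  by move=> k; apply: (le_trans (We k)); rewrite lee_fin.
have W0 k : 0 <= ediam (W k) ^+ d by rewrite expe_ge0 // ediam_ge0.
rewrite (nneseries_split 0 #|T|) //.
rewrite add0n [X in _ + X]eseries0 ?adde0; last first.
  move=> k kT _; rewrite /W; case: insubP => [i|_]; first by rewrite ltnNge kT.
  by apply/eqP; rewrite ediam0 expe_eq0 d0 eqxx.
apply: (@le_trans _ _ (\sum_(0 <= k < #|T|) (e ^+ d)%:E)).
  by apply: lee_sum => k _; rewrite EFin_expe lee_expe ?ediam_ge0.
by rewrite big_mkord sumEFin sumr_const card_ord lee_fin -mulr_natl.
Qed.

End HausdorffBounds.

(** * Lower bounds for the Hausdorff measure *)

Section HausdorffLowerBound.
Variables (R : realType) (n : nat).
Local Notation V := 'rV[R]_n.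
Implicit Types (x y z : V) (E F : set V).

Lemma exprD_le (a b : R) (d : nat) : 0 <= a -> 0 <= b ->
  (a + b) ^+ d <= 2 ^+ d * (a ^+ d + b ^+ d).
Proof.
wlog ab : a b / a <= b.
  move=> h a0 b0; case/orP: (le_total a b) => ab; first exact: h.
  by rewrite addrC [in leRHS]addrC; apply: h.
move=> a0 b0; apply: (@le_trans _ _ ((2 * b) ^+ d)).
  by rewrite lerXn2r ?nnegrE //; lra.
by rewrite exprMn ler_wpM2l ?exprn_ge0 // lerDr exprn_ge0.
Qed.

Lemma sum_geometric_half_le (N : nat) : \sum_(k < N) (2^-1 : R) ^+ k <= 2.
Proof.
suff -> : \sum_(k < N) (2^-1 : R) ^+ k = 2 - 2 * 2^-1 ^+ N.
  by rewrite gerBl mulr_ge0 // exprn_ge0.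
elim: N => [|N IH]; first by rewrite big_ord0 expr0 mulr1 subrr.
rewrite big_ord_recr /= IH exprS; lra.
Qed.

(* It suffices to bound from below the d-content of finite covers by small balls:
   each covering set is enlarged to an open ball, and compactness applies. *)
Lemma hausdorff_ge (d : nat) E F (c delta0 : R) :
  (0 < d)%N -> compact E -> E `<=` F -> 0 < delta0 ->
  (forall (N : nat) (x : nat -> V) (rho : nat -> R),
     (forall k, 0 < rho k < delta0) ->
     (forall z, E z -> exists2 k, (k < N)%N & enorm (z - x k) < rho k) ->
     c <= \sum_(k < N) rho k ^+ d) ->
  ((c / 2 ^+ d)%:E <= hausdorff d F)%E.
Proof.
move=> d0 cE EF delta00 H; apply: (@le_trans _ _ (hausdorff d E)); last exact: le_hausdorff.
pose delta := delta0 / 2.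
have delta1 : 0 < delta by rewrite divr_gt0.
apply: le_ereal_sup_tmp; exists (hausdorff_content d delta E); first by exists delta.
apply: le_ereal_inf_tmp => _ [U [EU dU] <-].
have W0 k : (0 <= ediam (U k) ^+ d)%E by rewrite expe_ge0 // ediam_ge0.
have [->|fin] := eqVneq (\sum_(0 <= k <oo) ediam (U k) ^+ d)%E +oo%E; first by rewrite leey.
pose e k : R := fine (ediam (U k)).
have eE k : ediam (U k) = (e k)%:E.
  by rewrite fineK // ge0_fin_numE ?ediam_ge0 // (le_lt_trans (dU k)) ?ltry.
have e0 k : 0 <= e k by rewrite -lee_fin -eE ediam_ge0.
have ed k : e k <= delta by rewrite -lee_fin -eE.
set S := (\sum_(0 <= k <oo) _)%E in fin *.
have S0 : (0 <= S)%E by apply: nneseries_ge0.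
have SE : S = (fine S)%:E by rewrite fineK // ge0_fin_numE // ltey.
have SN N : \sum_(k < N) e k ^+ d <= fine S.
  rewrite -lee_fin -SE -sumEFin.
  apply: le_trans (nneseries_lim_ge N (m := 0%N) (P := xpredT) _) => //.
  by rewrite big_mkord; apply: lee_sum => k _; rewrite EFin_expe eE.
rewrite SE lee_fin ler_pdivrMr ?exprn_gt0 // mulrC.
apply/ler_addgt0Pr => t t0.
(* The [k]-th radius grows by [ze * 2^-1 ^+ k]; the total extra cost is at most
   [2 ^+ d * ze * 2 <= t], and the radii stay below [delta0]. *)
pose ze := Num.min (Num.min 1 (delta / 2)) (t / 2 / 2 ^+ d).
have ze0 : 0 < ze by rewrite !lt_min ltr01 !divr_gt0 ?exprn_gt0.
have ze1 : ze <= 1 by rewrite !ge_min lexx.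
have zed : ze <= delta / 2 by rewrite !ge_min lexx orbT.
have zet : ze <= t / 2 / 2 ^+ d by rewrite !ge_min lexx orbT.
pose eta k := ze * 2^-1 ^+ k.
have half k : 0 < (2^-1 : R) ^+ k <= 1.
  by rewrite exprn_gt0 ?invr_gt0 // exprn_ile1 // ?invr_ge0 // invf_le1 // ler1n.
have eta0 k : 0 < eta k by have /andP[h _] := half k; rewrite mulr_gt0.
have etaz k : eta k <= ze.
  by have /andP[_ h] := half k; rewrite /eta ler_piMr // ltW.
pose x k := if pselect (U k !=set0) is left h then sval (cid h) else 0.
pose rho k := e k + eta k.
have rho0 k : 0 < rho k < delta0.
  by rewrite ltr_wpDl //=; have := ed k; have := etaz k; rewrite /rho /delta in zed *; lra.
have cov : E `<=` \bigcup_k eball (x k) (rho k).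
  move=> z /EU [k _ Ukz]; exists k => //; rewrite /eball /= /x.
  case: pselect => [h|h]; last by exfalso; apply: h; exists z.
  case: (cid h) => w Ukw /=; apply: (@le_lt_trans _ _ (e k)).
    by rewrite -lee_fin -eE; apply: ediam_ge.
  by rewrite ltrDl.
have : cover_compact E by rewrite -compact_cover.
move=> /(_ nat setT (fun k => eball (x k) (rho k))) [].
- by move=> k _; exact: open_eball.
- exact: cov.
move=> D _ covD; pose N := (\max_(k <- finmap.enum_fset D) k).+1.
have DN k : k \in finmap.enum_fset D -> (k < N)%N by move=> kD; rewrite ltnS; exact: (@leq_bigmax_seq _ _ xpredT id k kD).
apply: (le_trans (H N x rho rho0 _)).
  by move=> z /covD [k kD zk]; exists k => //; exact: DN.
apply: (@le_trans _ _ (\sum_(k < N) (2 ^+ d * e k ^+ d + 2 ^+ d * ze * 2^-1 ^+ k))).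
  apply: ler_sum => k _; apply: (le_trans (exprD_le _ (e0 k) (ltW (eta0 k)))).
  rewrite mulrDr lerD2l -mulrA ler_wpM2l ?exprn_ge0 //.
  rewrite -[leRHS]expr1; apply: ler_wiXn2l => //; first exact: ltW.
  by rewrite (le_trans (etaz k)).
rewrite big_split /= -!mulr_sumr; apply: lerD.
  by apply: ler_wpM2l; rewrite ?exprn_ge0 ?SN.
apply: (@le_trans _ _ (2 ^+ d * ze * 2)).
  by rewrite ler_wpM2l ?sum_geometric_half_le // mulr_ge0 ?exprn_ge0 // ltW.
move: zet; rewrite ler_pdivlMr ?exprn_gt0 // => zet; lra.
Qed.

End HausdorffLowerBound.

(** * Size of the boundary of a star body *)

Section StarBodyBoundaryMeasure.
Variables (R : realType) (d : nat).
Local Notation V := 'rV[R]_(d.+1).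
Local Notation N := (d.+1%:R : R).

Section TwoPoints.
Variables (c : V) (rho r : R) (A : set V).
Hypotheses (rho0 : 0 < rho) (rhor : rho <= r) (A0 : A !=set0).
Hypothesis Ar : forall a, A a -> enorm (a - c) <= r.
Local Notation O := (star_body c rho A).
Local Notation F := (bdry O).

Lemma bdry_star_body_norm z : F z -> rho <= enorm (z - c) <= r.
Proof.
move=> [cz nz]; apply/andP; split.
  rewrite leNgt; apply/negP => h; apply: nz.
  have [a Aa] := A0.
  by have := @star_body_open R d.+1 c rho A; rewrite openE; apply; apply: (star_body_ball Aa).
apply/ler_addgt0Pr => e e0.
have [z' Oz' zz'] := (closure_eballP _ _).1 cz e e0.
have := star_body_bounded rhor Ar Oz'.
have := enorm_triangle z' z c; rewrite (enormBC z z'); lra.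
Qed.

(** Otherwise [z'] would lie in the drop spanned by [z] and the open ball about [c], hence inside
    the body. *)
Lemma bdry_star_body_sep z z' (s : R) : F z -> F z' -> 0 < s <= 1 ->
  s * rho <= enorm ((z' - c) - (1 - s) *: (z - c)).
Proof.
move=> [cz _] [_ nz'] s01; rewrite leNgt; apply/negP => h; apply: nz'.
have := @star_body_open R d.+1 c rho A; rewrite openE; apply.
have /andP[s0 _] := s01.
have -> : z' = (1 - s) *: z + s *: (c + s^-1 *: ((z' - c) - (1 - s) *: (z - c))).
  by apply/rowP => i; rewrite !mxE; field; rewrite gt_eqF.
apply: star_body_closure => //.
by rewrite enormZ gtr0_norm ?invr_gt0 // mulrC ltr_pdivrMr // mulrC.
Qed.

(* The boundary is parametrized over the faces of a cube: [facet i] projects radially to the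
   face on which the [i]-th coordinate is extremal, and is bi-Lipschitz on the boundary. *)
Definition dominant (i : 'I_d.+1) (w : V) := forall j, `|w ord0 j| <= `|w ord0 i|.
Definition facet (i : 'I_d.+1) (w : V) : V := `|w ord0 i|^-1 *: w.

Lemma dominant_bounds i z : F z -> dominant i (z - c) ->
  rho / N <= `|(z - c) ord0 i| <= r.
Proof.
move=> Fz dz; have /andP[h1 h2] := bdry_star_body_norm Fz.
rewrite ler_pdivrMr ?ltr0n // (le_trans (coord_le_enorm _ _) h2) andbT.
by rewrite mulrC; apply: (le_trans h1); apply: enorm_le_coord.
Qed.

Lemma facet_norm i (w : V) : dominant i w -> enorm (facet i w) <= N.
Proof.
move=> dw; rewrite -[leRHS]mulr1; apply: enorm_le_coord => j.
rewrite /facet mxE normrM normfV normr_id.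
have [->|w0] := eqVneq (w ord0 i) 0; first by rewrite normr0 invr0 mul0r.
by rewrite ler_pdivrMl ?normr_gt0 // mulr1.
Qed.

Lemma facetK i (w : V) : w ord0 i != 0 -> w = `|w ord0 i| *: facet i w.
Proof. by move=> w0; rewrite /facet scalerA mulfV ?scale1r // normr_eq0. Qed.

Let dominant_gt0 i z : F z -> dominant i (z - c) -> 0 < `|(z - c) ord0 i|.
Proof.
move=> Fz dz; have /andP[h _] := dominant_bounds Fz dz.
by apply: lt_le_trans h; rewrite divr_gt0 // ltr0n.
Qed.

Lemma dist_le_facet i z z' : F z -> F z' -> dominant i (z - c) -> dominant i (z' - c) ->
  enorm (z - z') <= (N * (r ^+ 2 / rho) + r) * enorm (facet i (z - c) - facet i (z' - c)).
Proof.
wlog mm : z z' / `|(z' - c) ord0 i| <= `|(z - c) ord0 i|.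
  move=> h Fz Fz' dz dz'.
  case/orP: (le_total `|(z' - c) ord0 i| `|(z - c) ord0 i|) => mm; first exact: h.
  by rewrite enormBC (enormBC (facet _ _)); apply: h.
move=> Fz Fz' dz dz'.
have m0 := dominant_gt0 Fz dz; have m'0 := dominant_gt0 Fz' dz'.
have /andP[_ mr] := dominant_bounds Fz dz; have /andP[_ m'r] := dominant_bounds Fz' dz'.
have wE := facetK (_ : (z - c) ord0 i != 0); rewrite -normr_gt0 in wE.
have wE' := facetK (_ : (z' - c) ord0 i != 0); rewrite -normr_gt0 in wE'.
move: (facet_norm dz) (wE m0) (wE' m'0).
set m := `|(z - c) ord0 i| in m0 mr mm *; set m' := `|(z' - c) ord0 i| in m'0 m'r mm *.
set x := facet i (z - c); set x' := facet i (z' - c) => xN zE zE'.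
clearbody x x' m m'.
have r0 : 0 < r := lt_le_trans rho0 rhor.
set D := enorm (x - x'); have D0 : 0 <= D by exact: enorm_ge0.
have mD : (m - m') * rho <= r ^+ 2 * D.
  have [->|neq] := eqVneq m' m; first by rewrite subrr mul0r mulr_ge0 ?exprn_ge0 // ltW.
  (* For [s = 1 - m' / m] the point [(1 - s) *: (z - c)] is [m' *: x], to be compared with
     [z' - c = m' *: x']: the radial gap [m - m'] is controlled by the distance of the facet
     points. *)
  have s0 : 0 < 1 - m' / m by rewrite subr_gt0 ltr_pdivrMr // mul1r lt_neqAle neq.
  have s01 : 0 < 1 - m' / m <= 1 by rewrite s0 /= gerBl divr_ge0 // ltW.
  have := bdry_star_body_sep Fz Fz' s01.
  rewrite zE zE' subKr scalerA divfK ?gt_eqF // -scalerBr enormZ gtr0_norm // enormBC -/D => h.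
  have -> : (m - m') * rho = m * ((1 - m' / m) * rho) by field; rewrite gt_eqF.
  apply: (le_trans (ler_wpM2l (ltW m0) h)).
  by rewrite mulrA expr2 ler_wpM2r // ler_pM // ltW.
have -> : z - z' = (m - m') *: x + m' *: (x - x').
  have -> : z - z' = (z - c) - (z' - c) by apply/rowP => j; rewrite !mxE; ring.
  by rewrite zE zE'; apply/rowP => j; rewrite !mxE; ring.
apply: (le_trans (enormD _ _)); rewrite !enormZ -/D (gtr0_norm m'0) ger0_norm ?subr_ge0 //.
rewrite [leRHS]mulrDl lerD //; last by rewrite ler_wpM2r.
apply: (@le_trans _ _ ((m - m') * N)); first by rewrite ler_wpM2l // subr_ge0.
rewrite mulrC -mulrA ler_wpM2l // mulrAC ler_pdivlMr //.
Qed.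

Lemma facet_le_dist i z z' : F z -> F z' -> dominant i (z - c) -> dominant i (z' - c) ->
  enorm (facet i (z - c) - facet i (z' - c)) <= (1 + N) * N / rho * enorm (z - z').
Proof.
move=> Fz Fz' dz dz'.
have m0 := dominant_gt0 Fz dz; have m'0 := dominant_gt0 Fz' dz'.
have /andP[mr _] := dominant_bounds Fz dz.
have xN := facet_norm dz'.
have wE' := facetK (_ : (z' - c) ord0 i != 0); rewrite -normr_gt0 in wE'.
move: xN (wE' m'0).
set x' := facet i (z' - c) => xN zE'.
clearbody x'.
have mm : `| `|(z' - c) ord0 i| - `|(z - c) ord0 i| | <= enorm (z - z').
  apply: (le_trans (ler_dist_dist _ _)); apply: le_trans (coord_le_enorm (z - z') i).
  have -> : (z - z') ord0 i = (z - c) ord0 i - (z' - c) ord0 i by rewrite !mxE; ring.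
  by rewrite distrC.
set m := `|(z - c) ord0 i| in m0 mr mm *; set m' := `|(z' - c) ord0 i| in m'0 mm zE' *.
set D := enorm (z - z') in mm *; have D0 : 0 <= D by exact: enorm_ge0.
have -> : facet i (z - c) - x' = m^-1 *: ((z - z') + (m' - m) *: x').
  have -> : z - z' = (z - c) - (z' - c) by apply/rowP => j; rewrite !mxE; ring.
  have -> : facet i (z - c) = m^-1 *: (z - c) by [].
  rewrite zE'; move: (z - c) => w; clearbody m m'.
  by apply/rowP => j; rewrite !mxE; field; rewrite gt_eqF.
rewrite enormZ gtr0_norm ?invr_gt0 // ler_pdivrMl //.
apply: (le_trans (enormD _ _)); rewrite enormZ -/D.
apply: (@le_trans _ _ ((1 + N) * D)).
  by rewrite mulrDl mul1r lerD2l mulrC ler_pM ?enorm_ge0.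
have -> : m * ((1 + N) * N / rho * D) = (1 + N) * D * (m / (rho / N)).
  have : N != 0 by rewrite pnatr_eq0.
  by move: (d.+1%:R) => K K0; field; rewrite K0 gt_eqF.
by rewrite ler_peMr ?mulr_ge0 ?addr_ge0 // ler_pdivlMr ?mul1r // divr_gt0 // ltr0n.
Qed.

End TwoPoints.
End StarBodyBoundaryMeasure.

Section StarBodyBoundaryHausdorff.
Variables (R : realType) (d : nat).
Local Notation V := 'rV[R]_(d.+1).
Local Notation N := (d.+1%:R : R).

Lemma rowBE (a b : V) i : (a - b) ord0 i = a ord0 i - b ord0 i.
Proof. by rewrite !mxE. Qed.

Lemma exists_dominant (w : V) : exists i, dominant i w.
Proof.
have [i _ h] := @Order.TotalTheory.arg_maxP _ R _ ord0 xpredT (fun j => `|w ord0 j|) isT.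
by exists i => j; apply: h.
Qed.

(** There are [2 * N] classes, by dominant coordinate and its sign. The power contains the product
    of the two bi-Lipschitz constants, with [La] for [r / rho]; [8 * N] collects [M.+1 <= 2 * M],
    the diameter [2 * s], the window [2 * ell] and the passage from coordinates to the norm. *)
Definition star_bdry_const (La : R) : R :=
  2 * N * (8 * N * ((1 + N) * N * (N * La ^+ 2 + La))) ^+ d.

Lemma star_bdry_const_ge0 La : 0 <= La -> 0 <= star_bdry_const La.
Proof.
by move=> La0; rewrite /star_bdry_const !(mulr_ge0, exprn_ge0, addr_ge0).
Qed.

Lemma hausdorff_bdry_star_ball (La rho r s : R) (c y : V) (A : set V) :
  (0 < d)%N -> 0 < rho -> rho <= r -> r <= La * rho -> A !=set0 ->
  (forall a, A a -> enorm (a - c) <= r) -> 0 < s ->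
  (hausdorff d (bdry (star_body c rho A) `&` eball y s)
     <= (star_bdry_const La * s ^+ d)%:E)%E.
Proof.
move=> d0 rho0 rr rLa A0 Ar s0.
set F := bdry _.
have N0 : 0 < N by rewrite ltr0n.
pose k1 := (1 + N) * N / rho; pose k2 := N * (r ^+ 2 / rho) + r.
have r0 := lt_le_trans rho0 rr.
have k10 : 0 < k1 by rewrite divr_gt0 // mulr_gt0 // addr_gt0.
have k20 : 0 < k2 by rewrite addr_gt0 // mulr_gt0 // divr_gt0 // exprn_gt0.
apply: hausdorff_le => // delta delta0.
pose ell := k1 * (2 * s).
have ell0 : 0 < ell by rewrite mulr_gt0 // mulr_gt0.
pose M := (Num.truncn (k2 * (N * (2 * ell)) / delta)).+1.
have M0 : 0 < M%:R :> R by rewrite ltr0n.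
pose Cl (q : bool * 'I_d.+1) : set V := [set z | [/\ (F `&` eball y s) z,
   dominant q.2 (z - c) & (0 <= (z - c) ord0 q.2) = q.1]].
pose z0 (q : bool * 'I_d.+1) : V := if pselect (Cl q !=set0) is left h then sval (cid h) else 0.
have Clz0 q z : Cl q z -> Cl q (z0 q).
  rewrite /z0 => h; case: pselect => [h'|[]]; last by exists z.
  by case: (cid h').
pose x (q : bool * 'I_d.+1) (z : V) : V := facet q.2 (z - c).
(* Facet coordinates rescaled to [[0, M]] around the base point [z0 q]. Only [d] of them are taken:
   the remaining one is constantly [1] or [-1] on the class. *)
pose co (q : bool * 'I_d.+1) (z : V) (j : 'I_d) : R := (x q z ord0 (lift q.2 j) - x q (z0 q) ord0 (lift q.2 j) + ell) * (M%:R / (2 * ell)).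
have xx q z z' : Cl q z -> Cl q z' -> enorm (x q z - x q z') <= ell.
  move=> [[Fz yz] dz _] [[Fz' yz'] dz' _].
  apply: (le_trans (facet_le_dist rho0 rr A0 Ar Fz Fz' dz dz')).
  rewrite -/k1 /ell ler_pM2l //.
  apply: (le_trans (enorm_triangle y _ _)); rewrite (enormBC y).
  by move: yz yz'; rewrite /eball /=; lra.
have Ml : 0 < M%:R / (2 * ell) by rewrite divr_gt0 // mulr_gt0.
have co_itv q z j : Cl q z -> 0 <= co q z j <= M%:R.
  move=> Cz; have Cz0 := Clz0 _ _ Cz.
  have := le_trans (coord_le_enorm (x q z - x q (z0 q)) (lift q.2 j)) (xx _ _ _ Cz Cz0).
  rewrite rowBE ler_norml => /andP[h1 h2].
  apply/andP; split; first by rewrite mulr_ge0 ?(ltW Ml) //; lra.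
  apply: (@le_trans _ _ ((2 * ell) * (M%:R / (2 * ell)))).
    by rewrite ler_pM2r //; lra.
  by rewrite mulrC divfK // gt_eqF // mulr_gt0.
pose T : finType := (bool * 'I_d.+1 * {ffun 'I_d -> 'I_M.+1})%type.
pose U (t : T) := [set z | Cl t.1 z /\ forall j, Num.truncn (co t.1 z j) = t.2 j].
pose e := k2 * (N * (2 * ell / M%:R)).
have e0 : 0 < e by rewrite mulr_gt0 // mulr_gt0 // divr_gt0 // mulr_gt0.
exists T, U, e; split.
- rewrite (ltW e0) /= /e.
  have -> : k2 * (N * (2 * ell / M%:R)) = k2 * (N * (2 * ell)) / M%:R by ring.
  rewrite ler_pdivrMr // [leRHS]mulrC -ler_pdivrMr //.
  by apply: ltW; rewrite /M; exact: truncnS_gt.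
- move=> z [Fz yz]; have [i di] := exists_dominant (z - c).
  pose q := (0 <= (z - c) ord0 i, i).
  have Cz : Cl q z by split.
  have tr j : (Num.truncn (co q z j) < M.+1)%N.
    have /andP[h1 h2] := co_itv q z j Cz.
    by rewrite ltnS -(ler_nat R); apply: le_trans h2; rewrite truncn_le.
  exists (q, [ffun j => Ordinal (tr j)]) => //; split => // j.
  by rewrite /= ffunE.
- move=> [q g] z z' [/= Cz zg] [/= Cz' zg'].
  have [[Fz _] dz sz] := Cz; have [[Fz' _] dz' sz'] := Cz'.
  apply: (le_trans (dist_le_facet rho0 rr A0 Ar Fz Fz' dz dz')).
  rewrite -/k2 /e ler_pM2l //; apply: enorm_le_coord => i.
  have [j ->|->] := unliftP q.2 i; last first.
    have fac (w : V) : dominant q.2 w -> w ord0 q.2 != 0 ->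
        facet q.2 w ord0 q.2 = if 0 <= w ord0 q.2 then 1 else -1.
      move=> _ w0; rewrite mxE; case: ger0P => h; first by rewrite mulVf.
      by rewrite invrN mulNr mulVf.
    have nz w : F w -> dominant q.2 (w - c) -> (w - c) ord0 q.2 != 0.
      move=> Fw dw; have /andP[h _] := dominant_bounds rr A0 Ar Fw dw.
      by rewrite -normr_gt0; apply: lt_le_trans h; rewrite divr_gt0.
    rewrite rowBE !fac ?nz // sz sz' subrr normr0.
    by rewrite ltW // divr_gt0 // mulr_gt0.
  have /andP[c0 _] := co_itv _ _ j Cz; have /andP[c'0 _] := co_itv _ _ j Cz'.
  have := truncn_itv c0; have := truncn_itv c'0; rewrite zg zg'.
  move: (g j : nat) => t; rewrite -natr1 => /andP[b1 b2] /andP[a1 a2].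
  have cc : co q z j - co q z' j =
      (x q z - x q z') ord0 (lift q.2 j) * (M%:R / (2 * ell)) by rewrite /co rowBE; ring.
  rewrite -(ler_pM2r Ml) -{1}(gtr0_norm Ml) -normrM -cc.
  have -> : 2 * ell / M%:R * (M%:R / (2 * ell)) = 1.
    by field; rewrite !gt_eqF.
  by rewrite ler_norml; apply/andP; split; lra.
- rewrite !card_prod card_bool card_ffun !card_ord !natrM natrX.
  apply: (@le_trans _ _ (2 * N * (2 * M%:R) ^+ d * e ^+ d)).
    rewrite ler_wpM2r ?exprn_ge0 ?(ltW e0) // ler_wpM2l ?mulr_ge0 //.
    by rewrite lerXn2r ?nnegrE ?mulr_ge0 // -natr1 mulr_natl mulr2n lerD2l ler1n.
  rewrite -mulrA -exprMn /star_bdry_const -[leRHS]mulrA -exprMn.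
  rewrite ler_wpM2l ?mulr_ge0 // lerXn2r ?nnegrE //.
  + by rewrite mulr_ge0 ?(ltW e0) // mulr_ge0.
  + have La0 : 0 <= La by rewrite -(pmulr_lge0 _ rho0); lra.
    have s0' := ltW s0; by rewrite !(mulr_ge0, addr_ge0, exprn_ge0).
  have -> : 2 * M%:R * e = 8 * N * (k1 * k2) * s.
    by rewrite /e /ell; field; rewrite gt_eqF.
  rewrite ler_wpM2r ?(ltW s0) // ler_wpM2l ?mulr_ge0 //.
  have -> : k1 * k2 = (1 + N) * N * (N * (r / rho) ^+ 2 + r / rho).
    by rewrite /k1 /k2; move: (d.+1%:R) => K; field; rewrite gt_eqF.
  have La1 : r / rho <= La by rewrite ler_pdivrMr.
  rewrite ler_wpM2l ?mulr_ge0 ?addr_ge0 // lerD // ler_wpM2l //.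
  by rewrite lerXn2r ?nnegrE ?divr_ge0 ?(ltW r0) ?(ltW rho0) //; apply: le_trans La1; rewrite divr_ge0 ?ltW.
Qed.

(** The boundary lies in the ball of radius [2 * r] about [c], which replaces the ball about [y]
    when [r <= s]. *)
Lemma hausdorff_bdry_star_body (La rho r s : R) (c y : V) (A : set V) :
  (0 < d)%N -> 0 < rho -> rho <= r -> r <= La * rho -> A !=set0 ->
  (forall a, A a -> enorm (a - c) <= r) -> 0 < s ->
  (hausdorff d (bdry (star_body c rho A) `&` eball y s)
     <= (star_bdry_const La * 2 ^+ d * Num.min r s ^+ d)%:E)%E.
Proof.
move=> d0 rho0 rr rLa A0 Ar s0; have r0 := lt_le_trans rho0 rr.
have La0 : 0 <= La by rewrite -(pmulr_lge0 _ rho0); lra.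
have C0 := star_bdry_const_ge0 La0.
case: (leP r s) => rs.
  apply: (@le_trans _ _ (hausdorff d (bdry (star_body c rho A) `&` eball c (2 * r)))).
    apply: le_hausdorff => z [Fz _]; split => //; rewrite /eball /=.
    have /andP[_ h] := bdry_star_body_norm rr A0 Ar Fz; lra.
  have rr0 : 0 < 2 * r by rewrite mulr_gt0.
  apply: (le_trans (hausdorff_bdry_star_ball c d0 rho0 rr rLa A0 Ar rr0)).
  by rewrite lee_fin -mulrA -exprMn.
apply: (le_trans (hausdorff_bdry_star_ball y d0 rho0 rr rLa A0 Ar s0)).
rewrite lee_fin -mulrA ler_wpM2l // ler_peMl ?exprn_ge0 ?(ltW s0) //.
by rewrite exprn_ege1 // ler1n.
Qed.

End StarBodyBoundaryHausdorff.

(** * Flat sets and trees of nets *)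

Section FlatNormal.
Variables (R : realType) (d : nat).
Local Notation V := 'rV[R]_(d.+1).
Implicit Types (x y q nu : V) (E P : set V).

Lemma dot_mulmx (u v : V) : (u *m v^T) ord0 ord0 = dot u v.
Proof. by rewrite mxE; apply: eq_bigr => i _; rewrite mxE. Qed.

Lemma hyperplane_normal (M : 'M[R]_(d, d.+1)) : \rank M = d ->
  exists nu : V, enorm nu = 1 /\ forall w, dot w nu = 0 <-> exists u : 'rV_d, w = u *m M.
Proof.
move=> rM.
have : kermx M^T != 0.
  by rewrite -mxrank_eq0 mxrank_ker mxrank_tr rM subSnn.
move=> /rowV0Pn [v /sub_kermxP vM v0].
have nv0 : 0 < enorm v.
  by rewrite lt_neqAle enorm_ge0 andbT eq_sym; apply: contra_neq v0; exact: enorm0_eq0.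
exists ((enorm v)^-1 *: v); split.
  by rewrite enormZ gtr0_norm ?invr_gt0 // mulVf // gt_eqF.
move=> w; rewrite dotZr; split; last first.
  move=> [u ->]; rewrite -dot_mulmx -mulmxA.
  have -> : M *m v^T = 0 by rewrite -[RHS]trmx0 -vM trmx_mul trmxK.
  by rewrite mulmx0 mxE mulr0.
move=> /eqP; rewrite mulf_eq0 invr_eq0 gt_eqF //= => /eqP wv.
have wk : (w <= kermx v^T)%MS.
  by apply/sub_kermxP/rowP => i; rewrite !ord1 dot_mulmx wv mxE.
have Mk : (M <= kermx v^T)%MS.
  by apply/sub_kermxP; rewrite -[RHS]trmx0 -vM trmx_mul trmxK.
have : (kermx v^T <= M)%MS.
  rewrite -(geq_leqif (mxrank_leqif_sup Mk)) mxrank_ker mxrank_tr rM.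
  have : (0 < \rank v)%N by rewrite lt0n mxrank_eq0.
  by case: (\rank v) => // k _; rewrite subSS leq_subr.
by move=> kM; have /submxP [u ->] := submx_trans wk kM; exists u.
Qed.

Lemma edist_ltP (y : V) P (e : R) : (Defs.edist y P < e%:E)%E -> exists2 p, P p & enorm (y - p) < e.
Proof. by move=> /ereal_inf_lt [_ [p Pp <-]]; rewrite lte_fin; exists p. Qed.

(** The approximating plane is shifted to pass through [x]. Its points are considered only up to
    [K / 2], so that their projections to the original plane stay in the ball where that plane is
    close to [E]. *)
Definition flat_at E (K eta r : R) x nu :=
  [/\ enorm nu = 1,
      forall y, E y -> enorm (y - x) < K * r -> `|dot (y - x) nu| <= eta * r &
      forall q, dot (q - x) nu = 0 -> enorm (q - x) < K / 2 * r ->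
        exists2 y, E y & enorm (y - q) <= eta * r].

Lemma flat_normal E (K eta eps r : R) x : 0 < eps < 4^-1 -> 0 < K -> 4 * eps * K <= eta ->
  0 < r -> E x -> (bbeta d E x (K * r) <= (eps / 2)%:E)%E ->
  exists nu, flat_at E K eta r x nu.
Proof.
move=> /andP[e0 e1] K0 eK r0 Ex h; set s := K * r in h.
have s0 : 0 < s by rewrite mulr_gt0.
(* Strictness extracts an actual plane from the infimum; hence the [eps / 2] of the hypothesis. *)
have : (bbeta d E x s < eps%:E)%E by apply: (le_lt_trans h); rewrite lte_fin; lra.
move=> /ereal_inf_lt [_ [P [p0 [M [rM PE]]] <-]] hB.
have hm : (maxe (ereal_sup ([set Defs.edist y P | y in E `&` eball x s] `|` [set 0%E]))
        (ereal_sup ([set Defs.edist y E | y in P `&` eball x s] `|` [set 0%E]))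
     < (eps * s)%:E)%E.
  have c0 : 0 < 2 / (2 * s) by rewrite divr_gt0 // mulr_gt0.
  rewrite -(@lte_pmul2l _ (2 / (2 * s))%:E) ?lte_fin // -EFinM.
  by have -> : 2 / (2 * s) * (eps * s) = eps by field; rewrite gt_eqF.
move: hm; rewrite gt_max => /andP[h1 h2].
have {}h1 y : E y -> enorm (y - x) < s -> exists2 p, P p & enorm (y - p) < eps * s.
  move=> Ey yx; apply: edist_ltP; apply: le_lt_trans h1.
  by apply: ereal_sup_ubound; left; exists y.
have {}h2 y : P y -> enorm (y - x) < s -> exists2 p, E p & enorm (y - p) < eps * s.
  move=> Ey yx; apply: edist_ltP; apply: le_lt_trans h2.
  by apply: ereal_sup_ubound; left; exists y.
have [nu [nu1 nuP]] := hyperplane_normal rM.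
have PP p : P p <-> dot (p - p0) nu = 0.
  rewrite nuP PE; split => [[u _ <-]|[u pu]]; first by exists u; rewrite addrC addKr.
  by exists u => //; rewrite -pu addrC subrK.
have h0 y : E y -> enorm (y - x) < s -> `|dot (y - p0) nu| <= eps * s.
  move=> Ey yx; have [p /PP Pp yp] := h1 y Ey yx.
  have -> : y - p0 = (y - p) + (p - p0) by apply/rowP => i; rewrite !mxE; ring.
  rewrite dotDl Pp addr0; apply: (le_trans (dot_le _ _)); rewrite nu1 mulr1; exact: ltW.
have hx : `|dot (x - p0) nu| <= eps * s by apply: h0 => //; rewrite subrr enorm0.
have es : 4 * (eps * s) <= eta * r by rewrite /s !mulrA ler_pM2r.
have es0 : 0 < eps * s by rewrite mulr_gt0.
exists nu; split => //.
  move=> y Ey yx.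
  have -> : y - x = (y - p0) - (x - p0) by apply/rowP => i; rewrite !mxE; ring.
  rewrite dotBl; move: hx (h0 y Ey yx); rewrite !ler_norml => /andP[a1 a2] /andP[b1 b2].
  by apply/andP; split; lra.
move=> q qx qs.
have dq : dot (q - p0) nu = dot (x - p0) nu.
  have -> : q - p0 = (q - x) + (x - p0) by apply/rowP => i; rewrite !mxE; ring.
  by rewrite dotDl qx add0r.
(* The projection of [q] to [P]. Its distance from [q] is the height of [x] above [P], since [q - x]
   is parallel to [P]. *)
pose q' := q - dot (q - p0) nu *: nu.
have Pq' : P q'.
  apply/PP; have -> : q' - p0 = (q - p0) - dot (q - p0) nu *: nu.
    by apply/rowP => i; rewrite /q' !mxE; ring.
  by rewrite (dotBl (q - p0)) dotZl -(enorm_sqr nu) nu1 expr1n mulr1 subrr.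
have qq' : enorm (q' - q) <= eps * s.
  have -> : q' - q = - (dot (q - p0) nu *: nu) by apply/rowP => i; rewrite /q' !mxE; ring.
  by rewrite enormN enormZ nu1 mulr1 dq.
have q's : enorm (q' - x) < s.
  apply: (le_lt_trans (enorm_triangle q _ _)).
  have : eps * s < 4^-1 * s by rewrite ltr_pM2r.
  have : K / 2 * r = s / 2 by rewrite /s; ring.
  lra.
have [y Ey yq'] := h2 q' Pq' q's; exists y => //.
by have := enorm_triangle q' y q; rewrite (enormBC y q'); lra.
Qed.

End FlatNormal.

(** * Trees of nets and stopping-time regions *)

Section NetTree.
Variables (R : realType) (d : nat).
Local Notation V := 'rV[R]_(d.+1).
Implicit Types (x y z u v w : V) (E : set V) (X : nat -> set V) (par nu : nat -> V -> V).

Lemma maximal_separated E (e : R) : 0 < e -> exists X : set V,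
  [/\ X `<=` E, (forall x y, X x -> X y -> enorm (x - y) < e -> x = y) &
      forall y, E y -> exists2 x, X x & enorm (y - x) < e].
Proof.
move=> e0.
pose P (X : set V) := X `<=` E /\ forall x y, X x -> X y -> enorm (x - y) < e -> x = y.
have [|X [[XE Xs] Xmax]] := @Zorn_bigcup V P.
  move=> F FP tF; split=> [x [Y FY Yx]|x y [Y FY Yx] [Z FZ Zy]].
    by have [h _] := FP Y FY; apply: h.
  have [YZ|ZY] := tF Y Z FY FZ.
    by have [_ h] := FP Z FZ; apply: h => //; apply: YZ.
  by have [_ h] := FP Y FY; apply: h => //; apply: ZY.
exists X; split => // y Ey; apply: contrapT => nX.
have far x : X x -> e <= enorm (y - x).
  by move=> Xx; rewrite leNgt; apply/negP => h; apply: nX; exists x.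
apply: (Xmax (X `|` [set y])).
  split; first by move=> x Xx; left.
  move=> h; have /far : X y by apply: h; right.
  by rewrite subrr enorm0 leNgt e0.
split=> [x [/XE //|-> //]|x z [Xx|->] [Xz|->]] //; first exact: Xs.
  by rewrite enormBC ltNge far.
by rewrite ltNge far.
Qed.

Definition scale (b : R) (k : nat) : R := (b ^+ k)^-1.

(* [par_near] is what makes every node close to a node [x], at a finer scale, a descendant
   of [x]. *)
Record net_tree E (b K eta : R) X par nu : Prop := NetTree {
  net_sub : forall k x, X k x -> E x;
  net_sep : forall k x y, X k x -> X k y -> enorm (x - y) < scale b k -> x = y;
  net_cover : forall k y, E y -> exists2 x, X k x & enorm (y - x) < scale b k;
  par_net : forall k x, X k.+1 x -> X k (par k x);
  par_dist : forall k x, X k.+1 x -> enorm (x - par k x) <= scale b k;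
  par_near : forall k x y, X k.+1 x -> X k y -> enorm (x - y) < scale b k / 2 -> par k x = y;
  net_flat : forall k x, X k x -> flat_at E K eta (scale b k) x (nu k x) }.

Lemma scale_gt0 b k : 0 < b -> 0 < scale b k.
Proof. by move=> b0; rewrite invr_gt0 exprn_gt0. Qed.

Lemma scaleS b k : 0 < b -> scale b k.+1 = scale b k / b.
Proof. by move=> b0; rewrite /scale exprS invfM mulrC. Qed.

Lemma net_tree_exists E (b K eta eps : R) : 1 <= b -> 0 < eps < 4^-1 -> 0 < K ->
  4 * eps * K <= eta -> reifenberg_flat (eps / 2) d E ->
  exists X par nu, net_tree E b K eta X par nu.
Proof.
move=> b1 e01 K0 eK flat; have b0 : 0 < b := lt_le_trans ltr01 b1.
have [X XP] := choice (fun k => maximal_separated E (scale_gt0 k b0)).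
(* Separation allows at most one net point within half a scale; the parent must be that point when
   it exists, and is any covering point otherwise. *)
pose good k x y := X k y /\ (enorm (x - y) <= scale b k /\
   forall z, X k z -> enorm (x - z) < scale b k / 2 -> y = z).
have goodP k x : E x -> exists y, good k x y.
  move=> Ex; have [_ sep cov] := XP k; have s0 := scale_gt0 k b0.
  have [[y Xy xy]|no] := pselect (exists2 y, X k y & enorm (x - y) < scale b k / 2).
    exists y; split => //; split; first by lra.
    move=> z Xz xz; apply: sep => //.
    by apply: (le_lt_trans (enorm_triangle x _ _)); rewrite (enormBC y); lra.
  have [y Xy xy] := cov x Ex; exists y; split => //; split; first exact: ltW.
  by move=> z Xz xz; exfalso; apply: no; exists z.
pose par k x := xget 0 (good k x).
have parP k x : X k.+1 x -> good k x (par k x).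
  move=> Xx; have [sub _ _] := XP k.+1; have [y gy] := goodP k x (sub _ Xx).
  by apply: (@xgetPex _ 0 (good k x)); exists y.
pose nu k x := xget 0 (flat_at E K eta (scale b k) x).
exists X, par, nu; split.
- by move=> k x; have [sub _ _] := XP k; apply: sub.
- by move=> k; have [_ sep _] := XP k; apply: sep.
- by move=> k; have [_ _ cov] := XP k; apply: cov.
- by move=> k x /parP [].
- by move=> k x /parP [_ []].
- by move=> k x y /parP [_ [_ h]] Xy xy; apply: h.
- move=> k x Xx; apply: (@xgetPex _ 0 (flat_at E K eta (scale b k) x)).
  have Ex : E x by have [sub _ _] := XP k; apply: sub.
  apply: (flat_normal e01 K0 eK (scale_gt0 k b0) Ex); apply: flat => //.
  by rewrite mulr_gt0 // scale_gt0.
Qed.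

Section Tree.
Variables (E : set V) (b K eta alpha : R) (X : nat -> set V) (par nu : nat -> V -> V).
Hypothesis T : net_tree E b K eta X par nu.
Hypothesis b2 : 2 <= b.

Let b0 : 0 < b. Proof. exact: lt_le_trans b2. Qed.

Lemma scale_half k : scale b k.+1 <= scale b k / 2.
Proof.
rewrite scaleS // ler_wpM2l ?(ltW (scale_gt0 k b0)) // lef_pV2 ?posrE //.
Qed.

Lemma scale_le i j : (i <= j)%N -> scale b j <= scale b i.
Proof.
move=> /subnK <-; elim: (j - i)%N => [|k IH]; first by rewrite add0n.
rewrite addSn; apply: le_trans IH; apply: (le_trans (scale_half _)).
by have := scale_gt0 (k + i) b0; lra.
Qed.

Inductive desc (k : nat) z : nat -> V -> Prop :=
| desc_refl : desc k z k z
| desc_step j w : X j.+1 w -> desc k z j (par j w) -> desc k z j.+1 w.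

Lemma desc_le k z j w : desc k z j w -> (k <= j)%N.
Proof. by elim=> // i v _ _; exact: leqW. Qed.

Lemma desc_net k z j w : X k z -> desc k z j w -> X j w.
Proof. by move=> Xz [|i v]. Qed.

Lemma desc_trans k z j w i u : desc k z j w -> desc j w i u -> desc k z i u.
Proof. by move=> h; elim=> // l v Xv _ IH; apply: desc_step. Qed.

(** The bound telescopes, since [scale b i <= 2 * (scale b i - scale b i.+1)]. *)
Lemma desc_dist k z j w : desc k z j w -> enorm (w - z) <= 2 * (scale b k - scale b j).
Proof.
elim=> [|i v Xv _ IH]; first by rewrite !subrr enorm0 mulr0.
apply: (le_trans (enorm_triangle (par i v) _ _)).
by have := par_dist T Xv; have := scale_half i; lra.
Qed.

Lemma desc_dist_le k z j w : desc k z j w -> enorm (w - z) <= 2 * scale b k.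
Proof. by move=> /desc_dist; have := scale_gt0 j b0; lra. Qed.

Lemma ancestor k j w : (k <= j)%N -> X j w -> exists2 u, X k u & desc k u j w.
Proof.
move=> /subnK <-; elim: (j - k)%N w => [|i IH] w.
  by rewrite add0n => Xw; exists w => //; exact: desc_refl.
rewrite addSn => Xw; have [u Xu du] := IH _ (par_net T Xw).
by exists u => //; apply: desc_step.
Qed.

Lemma desc_split k z j i w : (k <= j <= i)%N -> desc k z i w ->
  exists2 u, desc k z j u & desc j u i w.
Proof.
move=> /andP[kj ji] h; elim: h ji => [|l v Xv dv IH] ji.
  have -> : j = k by apply/eqP; rewrite eqn_leq ji.
  by exists z; exact: desc_refl.
move: ji; rewrite leq_eqVlt => /orP[/eqP ->|ji].
  by exists v; [apply: desc_step|exact: desc_refl].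
by have [u h1 h2] := IH ji; exists u => //; apply: desc_step.
Qed.

(* [top k x] is the root of the stopping-time region containing the node [x] of level [k]:
   a new region starts when the normal is nearly orthogonal to that of the current root. *)
Fixpoint top (k : nat) x : nat * V :=
  if k is k'.+1 then
    let t := top k' (par k' x) in
    if alpha <= `|dot (nu k x) (nu t.1 t.2)| then t else (k, x)
  else (0%N, x).

Lemma top_le k x : ((top k x).1 <= k)%N.
Proof. by elim: k x => //= k IH x; case: ifP => _ //=; apply: leqW. Qed.

Lemma top_desc k x : X k x -> desc (top k x).1 (top k x).2 k x.
Proof.
elim: k x => [|k IH] x Xx /=; first exact: desc_refl.
case: ifP => _ /=; last exact: desc_refl.
by apply: desc_step => //; apply: IH; exact: (par_net T Xx).
Qed.

Lemma top_net k x : X k x -> X (top k x).1 (top k x).2.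
Proof.
elim: k x => [|k IH] x Xx //=.
by case: ifP => _ //=; apply: IH; exact: (par_net T Xx).
Qed.

Lemma top_top k x : X k x -> top (top k x).1 (top k x).2 = top k x.
Proof.
elim: k x => [|k IH] x Xx //=.
by case: ifP => h; [apply: IH; exact: (par_net T Xx)|rewrite /= h].
Qed.

(** With the root of [w] at level at most [j], no region starts on this branch after level [j]. *)
Lemma top_between j u k w : desc j u k w -> ((top k w).1 <= j)%N -> top j u = top k w.
Proof.
elim=> // i v Xv dv IH /=; case: ifP => _ //=.
by move=> ij; have := desc_le dv; rewrite leqNgt ij.
Qed.

Lemma net_unit k x : X k x -> enorm (nu k x) = 1.
Proof. by move=> /(net_flat T) []. Qed.

Lemma top_tilt k x : alpha <= 1 -> X k x ->
  alpha <= `|dot (nu k x) (nu (top k x).1 (top k x).2)|.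
Proof.
move=> a1; have self i y : X i y -> alpha <= `|dot (nu i y) (nu i y)|.
  by move=> Xy; rewrite -enorm_sqr net_unit // expr1n normr1.
case: k => [|k] Xx /=; first exact: self.
by case: ifP => // _; exact: self.
Qed.

(** [a] is the first node of the branch from [z] to [w] that leaves the region of [z]. *)
Lemma new_top j z k w : X j z -> desc j z k w -> top k w <> top j z ->
  exists i a, [/\ X i.+1 a, desc i.+1 a k w, desc j z i (par i a),
    top i (par i a) = top j z &
    top i.+1 a = (i.+1, a) /\ `|dot (nu i.+1 a) (nu (top j z).1 (top j z).2)| < alpha].
Proof.
move=> Xz; elim=> // i v Xv dv IH tv.
have [e|ne] := pselect (top i (par i v) = top j z); last first.
  have [l [a [Xa da za ta at_]]] := IH ne.
  by exists l, a; split => //; apply: desc_step.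
exists i, v; split => //; first exact: desc_refl.
move: tv; rewrite /= e; case: ifP => // h _; split => //.
by rewrite ltNge h.
Qed.

End Tree.
End NetTree.

(** * The domains of a stopping-time region *)

Section Regions.
Variables (R : realType) (d : nat).
Local Notation V := 'rV[R]_(d.+1).
Variables (E : set V) (b H eta : R) (X : nat -> set V) (par nu : nat -> V -> V).
Local Notation alpha := (12 / H).
Local Notation K := (10 * H).
Hypothesis T : net_tree E b K eta X par nu.
Hypotheses (b2 : 2 <= b) (H12 : 12 <= H) (eta_le : eta <= (8 * b)^-1).
Local Notation top := (top alpha par nu).
Local Notation scale := (scale b).
Local Notation desc := (desc X par).
Implicit Types (t : nat * V) (m a u v w x y z : V).

Let b0 : 0 < b. Proof. exact: lt_le_trans b2. Qed.
Let H0 : 0 < H. Proof. exact: lt_le_trans H12. Qed.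
Let s0 k : 0 < scale k. Proof. exact: scale_gt0. Qed.
Let alpha1 : alpha <= 1. Proof. by rewrite ler_pdivrMr // mul1r. Qed.
Let eta_scale k : eta * scale k <= scale k / (8 * b).
Proof. by rewrite mulrC ler_wpM2l // ltW. Qed.

Lemma scale_div_le k (x : R) : b <= x -> scale k / x <= scale k.+1.
Proof.
move=> bx; have x0 : 0 < x := lt_le_trans b0 bx.
by rewrite scaleS // ler_wpM2l ?(ltW (s0 k)) // lef_pV2 ?posrE.
Qed.

(** Normals are known only up to sign; within a region their inner products with [m] do not vanish,
    so that the sign of [dot (nu k v) m] selects the side consistently. The threshold is low enough
    to admit, on one of the sides, every point near [v] whose distance from [E] is at least
    [scale k.+1]. *)
Definition apexes t m : set V := [set a | exists k v,
  [/\ X k v, top k v = t, enorm (a - v) < 3 * scale k &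
      scale k / (4 * b) < Num.sg (dot (nu k v) m) * dot (a - v) (nu k v)]].

Definition center t m : V := t.2 + (H * scale t.1) *: m.

Definition region t m : set V := star_body (center t m) (scale t.1) (apexes t m).

Definition axis t m := m = nu t.1 t.2 \/ m = - nu t.1 t.2.

Lemma axis_unit t m : X t.1 t.2 -> axis t m -> enorm m = 1.
Proof. by move=> Xt [->|->]; rewrite ?enormN; exact: (net_unit T). Qed.

Lemma top_descE k v t : X k v -> top k v = t -> X t.1 t.2 /\ desc t.1 t.2 k v.
Proof. by move=> Xv <-; split; [exact: (top_net _ T)|exact: (top_desc _ T)]. Qed.

Lemma apex_center t m a : X t.1 t.2 -> axis t m -> apexes t m a ->
  enorm (a - center t m) <= 2 * H * scale t.1.
Proof.
move=> Xt mt [k [v [Xv tv av _]]].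
have [_ dv] := top_descE Xv tv.
have vt := desc_dist_le T b2 dv.
have kt := scale_le b2 (desc_le dv).
have m1 := axis_unit Xt mt.
have -> : a - center t m = (a - v) + ((v - t.2) - (H * scale t.1) *: m).
  by apply/rowP => i; rewrite /center !mxE; ring.
apply: (le_trans (enormD _ _)); have := enormB (v - t.2) ((H * scale t.1) *: m).
rewrite enormZ m1 mulr1 gtr0_norm ?mulr_gt0 //.
have : 12 * scale t.1 <= H * scale t.1 by rewrite ler_pM2r.
have := s0 t.1; lra.
Qed.

(* The segment from an apex to the centre moves away from [E] at a definite speed, measured
   in the normal direction of any ancestor in the region; one compares with the ancestor
   whose scale is that of the distance travelled. *)
Lemma region_node t m z : axis t m -> region t m z -> exists k w,
  [/\ X k w, top k w = t, enorm (z - w) <= 3 / 4 * K * scale k &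
      scale k / (4 * b) <= `|dot (z - w) (nu k w)|].
Proof.
move=> mt [a [s [[k0 [v [Xv tv av Wa]]] /andP[sp s1] zs]]].
have [Xt dv] := top_descE Xv tv.
have m1 := axis_unit Xt mt.
set c := center t m in zs.
pose u := c + s^-1 *: (z - ((1 - s) *: a + s *: c)).
have uc : enorm (u - c) <= scale t.1.
  rewrite /u addrC addKr enormZ gtr0_norm ?invr_gt0 // ler_pdivrMl //; exact: ltW.
have zE : z = (1 - s) *: a + s *: u.
  by apply/rowP => i; rewrite /u !mxE; field; rewrite gt_eqF.
have vt := desc_dist_le T b2 dv.
have kt := scale_le b2 (desc_le dv).
have Hs : 12 * scale t.1 <= H * scale t.1 by rewrite ler_pM2r.
have ct : enorm (c - t.2) <= H * scale t.1.
  by rewrite /c /center addrC addKr enormZ m1 mulr1 gtr0_norm // mulr_gt0.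
have uv : enorm (u - v) <= (H + 3) * scale t.1.
  have := enorm_triangle c u v; have := enorm_triangle t.2 c v.
  by rewrite (enormBC t.2 v); lra.
have zv : enorm (z - v) <= 3 * scale k0 + s * ((H + 3) * scale t.1).
  have -> : z - v = (1 - s) *: (a - v) + s *: (u - v).
    by rewrite zE; apply/rowP => i; rewrite !mxE; ring.
  apply: (le_trans (enormD _ _)); rewrite !enormZ (gtr0_norm sp) ger0_norm ?subr_ge0 //.
  apply: lerD; last by rewrite ler_wpM2l // ltW.
  apply: le_trans (ltW av); rewrite ler_piMl ?enorm_ge0 //; lra.
have st : s * ((H + 3) * scale t.1) <= (H + 3) * scale t.1.
  by apply: ler_piMl => //; apply: mulr_ge0; [rewrite addr_ge0 // ltW|exact: ltW].
(* [j] will be the last level at which [z] is within half the window [K * scale j] of [v]; the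
   comparison takes place at the ancestor [w] of [v] at that level. *)
pose P j := (t.1 <= j <= k0)%N && (enorm (z - v) <= 5 * H * scale j).
have exP : exists j, P j.
  exists t.1; rewrite /P leqnn (desc_le dv) /=.
  by have := s0 t.1; lra.
have bP j : P j -> (j <= k0)%N by case/andP => /andP[].
case: (ex_maxnP exP bP) => j /andP[/andP[tj jk] zj] jmax.
have [w dw dwv] : exists2 w, desc t.1 t.2 j w & desc j w k0 v.
  by apply: desc_split => //; rewrite tj.
have Xw : X j w := desc_net Xt dw.
have tw : top j w = t by rewrite -tv; apply: (top_between dwv); rewrite tv.
have vw := desc_dist_le T b2 dwv.
have Hj : 12 * scale j <= H * scale j by rewrite ler_pM2r.
exists j, w; split => //.
  have := enorm_triangle v z w; have := s0 j; lra.
pose e := Num.sg (dot (nu j w) m).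
have tilt : alpha <= e * dot m (nu j w).
  rewrite /e dotC -normrEsg dotC.
  have := top_tilt T alpha1 Xw; rewrite tw.
  by case: mt => ->; rewrite ?dotNr ?normrN.
have e1 : `|e| <= 1.
  by rewrite /e normr_sg; case: (_ != 0).
suff : scale j / (4 * b) <= e * dot (z - w) (nu j w).
  move=> h; apply: (le_trans h); apply: (le_trans (ler_norm _)).
  by rewrite normrM ler_piMl.
have nw1 := net_unit T Xw.
have dle (y : V) : - enorm y <= e * dot y (nu j w).
  have : `|e * dot y (nu j w)| <= enorm y.
    rewrite normrM; apply: le_trans (ler_piMl _ e1) _ => //.
    by apply: le_trans (dot_le _ _) _; rewrite nw1 mulr1.
  by rewrite ler_norml => /andP[].
(* Since [H * alpha = 12], the vector from root to centre rises by at least [12 * scale t.1] along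
   the oriented normal at [w]; the displacements [u - c], [t.2 - v] and [v - a] cost at most 1, 2
   and 3 times [scale t.1]. *)
have ua : 6 * scale t.1 <= e * dot (u - a) (nu j w).
  have -> : u - a = (u - c) + ((H * scale t.1) *: m + ((t.2 - v) + (v - a))).
    by apply/rowP => i; rewrite /c /center !mxE; ring.
  rewrite (dotDl (u - c)) (dotDl (_ *: m)) (dotDl (t.2 - v)) (dotZl _ m) !mulrDr.
  have : 12 * scale t.1 <= e * (H * scale t.1 * dot m (nu j w)).
    have -> : e * (H * scale t.1 * dot m (nu j w)) = H * scale t.1 * (e * dot m (nu j w)).
      by ring.
    apply: le_trans (ler_wpM2l _ tilt); last by rewrite mulr_ge0 // ltW.
    by rewrite le_eqVlt; apply/orP; left; apply/eqP; field; rewrite gt_eqF.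
  have := dle (u - c); have := dle (t.2 - v); have := dle (v - a).
  rewrite (enormBC t.2) (enormBC v a). lra.
have zwE : z - w = (v - w) + ((a - v) + s *: (u - a)).
  by rewrite {1}zE; apply/rowP => i; rewrite !mxE; ring.
have sua : s * (6 * scale t.1) <= e * dot (s *: (u - a)) (nu j w).
  by rewrite dotZl [leRHS]mulrCA ler_wpM2l // ltW.
have ss0 : 0 <= s * (6 * scale t.1) by rewrite mulr_ge0 ?mulr_ge0 // ltW.
have [jk0|jk0] := eqVneq j k0.
  have vwE : v = w.
    case: dwv jk0 => // i v' _ /desc_le ji ij; by rewrite ij ltnn in ji.
  rewrite zwE vwE subrr add0r (dotDl (a - w)) mulrDr.
  have : scale j / (4 * b) <= e * dot (a - w) (nu j w).
    by rewrite /e; move: Wa; rewrite vwE jk0 => /ltW.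
  lra.
have jk1 : (j < k0)%N by rewrite ltn_neqAle jk0.
have far : 5 * H * scale j.+1 < enorm (z - v).
  rewrite ltNge; apply/negP => h; have : P j.+1 by rewrite /P jk1 h (leqW tj).
  by move=> /jmax; rewrite ltnn.
have kj := scale_le b2 jk1.
have HH : 12 * scale j.+1 <= H * scale j.+1 by rewrite ler_pM2r.
(* Maximality of [j] puts [z] further than [5 * H * scale j.+1] from [v], so the rise along the
   segment outweighs the losses: [scale j.+1] for [v - w] and three times as much for [a - v]. *)
have sc : 19 * scale j.+1 <= s * (6 * scale t.1).
  have h1 : s * ((H + 3) * scale t.1) <= s * (5 / 4 * H * scale t.1).
    by apply: ler_wpM2l; [exact: ltW|lra].
  have h2 : 19 / 4 * H * scale j.+1 <= 5 / 4 * H * (s * scale t.1) by lra.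
  have h3 : 19 / 4 * scale j.+1 <= 5 / 4 * (s * scale t.1).
    rewrite -(ler_pM2l H0); lra.
  have := s0 j.+1; lra.
rewrite zwE (dotDl (v - w)) (dotDl (a - v)) !mulrDr.
have hv : - scale j.+1 <= e * dot (v - w) (nu j w).
  have Ev : E v := net_sub T Xv.
  have [_ F1 _] := net_flat T Xw.
  have : `|dot (v - w) (nu j w)| <= scale j.+1.
    apply: (le_trans (F1 v Ev _)); first by have := s0 j; lra.
    apply: (le_trans (eta_scale j)).
    by apply: scale_div_le; have := b0; lra.
  move=> h; have : `|e * dot (v - w) (nu j w)| <= scale j.+1.
    by rewrite normrM; apply: le_trans (ler_piMl _ e1) h.
  by rewrite ler_norml => /andP[].
have := dle (a - v).
have : scale j / (4 * b) <= scale j.+1.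
  by apply: scale_div_le; have := b0; lra.
have := s0 j.+1; lra.
Qed.

(** [E] stays in a slab of half-width [scale k / (8 * b)] about the plane at [w], at most half the
    height of [z]. The factor [3 / 4] leaves room for a nearby [y] to be in the window of this
    flatness. *)
Lemma node_dist k w z y : X k w -> enorm (z - w) <= 3 / 4 * K * scale k ->
  scale k / (4 * b) <= `|dot (z - w) (nu k w)| -> E y -> scale k / (8 * b) <= enorm (z - y).
Proof.
move=> Xw zw hd Ey; rewrite leNgt; apply/negP => zy.
have sb : scale k / (8 * b) <= scale k.
  by rewrite ler_piMr ?(ltW (s0 k)) // invf_le1 ?mulr_gt0 //; have := b2; lra.
have Hk : 12 * scale k <= H * scale k by rewrite ler_pM2r.
have [n1 F1 _] := net_flat T Xw.
have yw : enorm (y - w) < K * scale k.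
  by have := enorm_triangle z y w; rewrite (enormBC y z); have := s0 k; lra.
have := F1 y Ey yw; have := eta_scale k.
have := dot_le (z - y) (nu k w); rewrite n1 mulr1.
have := ler_normD (dot (z - y) (nu k w)) (dot (y - w) (nu k w)).
rewrite -dotDl subrKA.
have : scale k / (4 * b) = 2 * (scale k / (8 * b)) by field; rewrite gt_eqF.
lra.
Qed.

Lemma region_avoids t m : axis t m -> region t m `&` E = set0.
Proof.
move=> mt; rewrite -subset0 => z [Oz Ez].
have [k [w [Xw _ zw hd]]] := region_node mt Oz.
have := node_dist Xw zw hd Ez; rewrite subrr enorm0.
by rewrite leNgt divr_gt0 // mulr_gt0.
Qed.

Lemma apexes_open t m : open (apexes t m).
Proof.
apply/open_eballP => a [k [v [Xv tv av Wa]]].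
pose e1 := 3 * scale k - enorm (a - v).
pose e2 := Num.sg (dot (nu k v) m) * dot (a - v) (nu k v) - scale k / (4 * b).
exists (Num.min e1 e2); first by rewrite lt_min !subr_gt0 av Wa.
move=> a'; rewrite /eball /= lt_min => /andP[h1 h2]; exists k, v; split => //.
  by have := enorm_triangle a a' v; rewrite /e1 in h1; lra.
have -> : a' - v = (a - v) + (a' - a) by apply/rowP => i; rewrite !mxE; ring.
rewrite dotDl mulrDr.
suff : `|Num.sg (dot (nu k v) m) * dot (a' - a) (nu k v)| <= enorm (a' - a).
  by rewrite ler_norml => /andP[]; rewrite /e2 in h2; lra.
rewrite normrM; apply: (@le_trans _ _ `|dot (a' - a) (nu k v)|).
  by rewrite ler_piMl // normr_sg; case: (_ != 0).
by apply: (le_trans (dot_le _ _)); rewrite (net_unit T Xv) mulr1.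
Qed.

(** A point of the open set [A] can be pulled slightly away from [c] within [A], and lies in the
    drop of the pulled point. *)
Lemma sub_star_body (c : V) (rho : R) (A : set V) : 0 < rho -> open A ->
  A `<=` star_body c rho A.
Proof.
move=> rho0 /open_eballP oA z Az; have [e e0 he] := oA z Az.
pose D := enorm (c - z) + 1.
have D1 : 1 <= D by rewrite lerDr enorm_ge0.
pose s := Num.min (1 / 2) (e / (4 * D)).
have s0' : 0 < s by rewrite lt_min !divr_gt0 // mulr_gt0 //; lra.
have s12 : s <= 1 / 2 by rewrite ge_min lexx.
have se : s <= e / (4 * D) by rewrite ge_min lexx orbT.
have s1 : 1 - s != 0 by rewrite gt_eqF //; lra.
exists (z - (s / (1 - s)) *: (c - z)), s; split.
- apply: he; rewrite /eball /= addrAC subrr add0r enormN enormZ ger0_norm; last first.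
    by rewrite divr_ge0 //; lra.
  rewrite mulrAC ltr_pdivrMr; last by lra.
  move: se; rewrite ler_pdivlMr; last by rewrite mulr_gt0 //; lra.
  have := enorm_ge0 (c - z); rewrite /D; nra.
- by rewrite s0' /=; lra.
- have -> : z - ((1 - s) *: (z - (s / (1 - s)) *: (c - z)) + s *: c) = 0.
    by apply/rowP => i; rewrite !mxE; field.
  by rewrite enorm0 mulr_gt0.
Qed.

Lemma region_cover k z x : E x -> enorm (z - x) < scale k ->
  (forall y, E y -> scale k.+1 <= enorm (z - y)) ->
  exists t m, [/\ X t.1 t.2, top t.1 t.2 = t, axis t m & region t m z].
Proof.
move=> Ex zx far.
have [v Xv xv] := net_cover T k Ex.
have [n1 _ F2] := net_flat T Xv.
have zv : enorm (z - v) < 2 * scale k by have := enorm_triangle x z v; lra.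
pose n := nu k v; pose q := z - dot (z - v) n *: n.
have nn : dot n n = 1 by rewrite -enorm_sqr n1 expr1n.
have dn : `|dot (z - v) n| <= enorm (z - v).
  by apply: (le_trans (dot_le _ _)); rewrite n1 mulr1.
have Hk : 12 * scale k <= H * scale k by rewrite ler_pM2r.
(* The foot [q] of the perpendicular from [z] to the plane at [v] is close to [E]; as [z] is far
   from [E], it has a definite height above that plane. *)
have [y Ey yq] : exists2 y, E y & enorm (y - q) <= eta * scale k.
  apply: F2.
    have -> : q - v = (z - v) - dot (z - v) n *: n.
      by apply/rowP => i; rewrite /q !mxE; ring.
    by rewrite (dotBl (z - v)) dotZl -/n nn mulr1 subrr.
  have -> : q - v = (z - v) - dot (z - v) n *: n.
    by apply/rowP => i; rewrite /q !mxE; ring.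
  apply: (le_lt_trans (enormB _ _)); rewrite enormZ n1 mulr1.
  have := s0 k; lra.
have hd : scale k / (4 * b) < `|dot (z - v) n|.
  have := far y Ey; have := enorm_triangle q z y; rewrite (enormBC q y).
  have -> : z - q = dot (z - v) n *: n by rewrite /q opprB addrC subrK.
  rewrite enormZ n1 mulr1 scaleS //.
  have : scale k / (4 * b) = 2 * (scale k / (8 * b)) by field; rewrite gt_eqF.
  have : scale k / b = 8 * (scale k / (8 * b)) by field; rewrite gt_eqF.
  have : 0 < scale k / (8 * b) by rewrite divr_gt0 // mulr_gt0.
  have := eta_scale k; lra.
pose t := top k v.
have Xt : X t.1 t.2 by exact: (top_net _ T).
have tt : top t.1 t.2 = t by exact: (top_top _ T).
have tilt : alpha <= `|dot n (nu t.1 t.2)| by exact: (top_tilt T alpha1 Xv).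
have tilt0 : dot n (nu t.1 t.2) != 0.
  by rewrite -normr_gt0; apply: lt_le_trans tilt; rewrite divr_gt0.
suff [m [mt hm]] : exists m, axis t m /\
    scale k / (4 * b) < Num.sg (dot n m) * dot (z - v) n.
  exists t, m; split => //; apply: sub_star_body => //; first exact: apexes_open.
  by exists k, v; split => //; have := s0 k; lra.
set p := dot n (nu t.1 t.2) in tilt0; set q0 := dot (z - v) n in hd.
have [h|h] : scale k / (4 * b) < Num.sg p * q0 \/ scale k / (4 * b) < - Num.sg p * q0.
  case: (ltrgtP p 0) tilt0 => // p0 _.
    rewrite (ltr0_sg p0) opprK mulN1r mul1r.
    by move: hd; case: (ger0P q0) => _ h; [right|left].
  rewrite (gtr0_sg p0) mulN1r mul1r.
  by move: hd; case: (ger0P q0) => _ h; [left|right].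
by exists (nu t.1 t.2); split => //; left.
by exists (- nu t.1 t.2); split; [right|rewrite dotNr sgrN].
Qed.

Lemma region_lipschitz t m : X t.1 t.2 -> axis t m -> apexes t m !=set0 ->
  lipschitz_graph_domain (2 * H) (region t m).
Proof.
move=> Xt mt ne; apply: (@star_body_lipschitz _ _ _ _ _ (2 * H * scale t.1)) => //.
  by apply: ler_peMl; [exact: ltW|have := H12; lra].
by move=> a; apply: apex_center.
Qed.

Lemma region_bdry_measure t m y (s : R) : (0 < d)%N -> X t.1 t.2 -> axis t m ->
  apexes t m !=set0 -> 0 < s ->
  (hausdorff d (bdry (region t m) `&` eball y s)
    <= (star_bdry_const d (2 * H) * 2 ^+ d * Num.min (2 * H * scale t.1) s ^+ d)%:E)%E.
Proof.
move=> dp Xt mt ne sp; apply: hausdorff_bdry_star_body => //.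
  by apply: ler_peMl; [exact: ltW|have := H12; lra].
by move=> a; apply: apex_center.
Qed.

(** Contracting by [r / scale t.1] towards the centre brings along a ball of radius [r]. A large
    domain touching a small ball thus has a point near it at comparable distance from [E], which
    bounds the number of such domains. *)
Lemma region_inner t m z (r : R) : X t.1 t.2 -> axis t m -> closure (region t m) z ->
  0 < r <= scale t.1 ->
  exists z', [/\ region t m z', enorm (z' - z) <= 2 * H * r &
                 forall y, E y -> r <= enorm (z' - y)].
Proof.
move=> Xt mt cz /andP[r0 rt].
pose s := r / scale t.1.
have s01 : 0 < s <= 1 by rewrite divr_gt0 //= ler_pdivrMr // mul1r.
have /andP[sp s1] := s01.
have zc : enorm (z - center t m) <= 2 * H * scale t.1.
  apply/ler_addgt0Pr => e e0.
  have [z1 Oz1 zz1] := (closure_eballP _ _).1 cz e e0.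
  have le1 : scale t.1 <= 2 * H * scale t.1.
    by apply: ler_peMl; [exact: ltW|have := H12; lra].
  have := star_body_bounded le1 (fun a => apex_center Xt mt) Oz1.
  have := enorm_triangle z1 z (center t m); rewrite (enormBC z z1); lra.
pose z' := (1 - s) *: z + s *: center t m.
exists z'; split.
- have := star_body_closure cz s01 (_ : enorm 0 < scale t.1).
  by rewrite addr0 enorm0; apply.
- have -> : z' - z = s *: (center t m - z) by apply/rowP => i; rewrite /z' !mxE; ring.
  rewrite enormZ gtr0_norm // enormBC; apply: le_trans (ler_wpM2l (ltW sp) zc) _.
  by rewrite mulrCA /s divfK // gt_eqF.
move=> y Ey; rewrite leNgt; apply/negP => h.
have : (region t m `&` E) y.
  split => //; have := star_body_closure cz s01 (_ : enorm (s^-1 *: (y - z')) < scale t.1).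
  have -> : (1 - s) *: z + s *: (center t m + s^-1 *: (y - z')) = y.
    by rewrite scalerDr scalerA mulfV ?gt_eqF // scale1r addrA -/z' addrC subrK.
  apply; rewrite enormZ gtr0_norm ?invr_gt0 // ltr_pdivrMl // enormBC.
  by rewrite /s divfK // gt_eqF.
by rewrite region_avoids.
Qed.

End Regions.

(** * Packing of the stopping-time regions *)

Section Descent.
Variables (R : realType) (d : nat).
Local Notation V := 'rV[R]_(d.+1).
Implicit Types (p q u v w x y z n m : V).

Definition hproj n u : V := u - dot u n *: n.

Lemma hprojD n u v : hproj n (u + v) = hproj n u + hproj n v.
Proof. by apply/rowP => i; rewrite /hproj dotDl !mxE; ring. Qed.

Lemma hproj_normal n (s : R) : enorm n = 1 -> hproj n (s *: n) = 0.
Proof. by move=> n1; rewrite /hproj dotZl -enorm_sqr n1 expr1n mulr1 subrr. Qed.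

Lemma hproj_le n u : enorm n = 1 -> enorm (hproj n u) <= enorm u.
Proof.
move=> n1; rewrite -(@ler_pXn2r _ 2) ?nnegrE ?enorm_ge0 //.
rewrite !enorm_sqr /hproj dotBl !dotBr !dotZl !dotZr -(enorm_sqr n) n1 expr1n (dotC n u).
by rewrite mulr1 subrr subr0 gerBl -expr2 sqr_ge0.
Qed.

Lemma hproj_orth n u : dot u n = 0 -> hproj n u = u.
Proof. by rewrite /hproj => ->; rewrite scale0r subr0. Qed.

Lemma hproj_triangle n x y z :
  enorm (hproj n (x - z)) <= enorm (hproj n (x - y)) + enorm (hproj n (y - z)).
Proof. by rewrite -[x - z](subrKA y) (hprojD n (x - y)) enormD. Qed.

(** The component of [p - w] orthogonal to [m] is constant along the line, and the tilt limits the
    remaining component at the intersection to [1 / alpha] times its length. *)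
Lemma line_meets_plane (alpha : R) n m p w : 0 < alpha <= 1 -> enorm n = 1 -> enorm m = 1 ->
  alpha <= `|dot n m| -> exists s, dot (p + s *: m - w) n = 0 /\
    enorm (p + s *: m - w) <= 2 * enorm (hproj m (p - w)) / alpha.
Proof.
move=> /andP[a0 a1] n1 m1 tilt; have nm0 : dot n m != 0.
  by rewrite -normr_gt0; apply: lt_le_trans tilt.
pose h := hproj m (p - w); pose c := - (dot h n / dot n m).
exists (c - dot (p - w) m).
have -> : p + (c - dot (p - w) m) *: m - w = h + c *: m.
  by rewrite /h /hproj; apply/rowP => i; rewrite !mxE; ring.
split; first by rewrite dotDl dotZl (dotC m n) /c mulNr divfK ?subrr.
apply: (le_trans (enormD _ _)); rewrite enormZ m1 mulr1 /c normrN normrM normfV.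
rewrite ler_pdivlMr // mulrDl -/h.
have h0 := enorm_ge0 h.
have hn : `|dot h n| <= enorm h by apply: (le_trans (dot_le _ _)); rewrite n1 mulr1.
have : `|dot h n| / `|dot n m| * alpha <= enorm h.
  rewrite -mulrA; apply: (le_trans (ler_piMr _ _)) hn => //.
  by rewrite ler_pdivrMl ?mulr1 // normr_gt0.
nra.
Qed.

Variables (E : set V) (b K eta alpha : R) (X : nat -> set V) (par nu : nat -> V -> V).
Hypothesis T : net_tree E b K eta X par nu.
Hypotheses (alpha01 : 0 < alpha <= 1) (Ka : 8 < K * alpha) (ba : 1000 <= b * alpha)
  (etab : eta * b <= alpha).
Local Notation top := (top alpha par nu).
Local Notation scale := (scale b).
Local Notation desc := (desc X par).

Let a0 : 0 < alpha. Proof. by case/andP: alpha01. Qed.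
Let a1 : alpha <= 1. Proof. by case/andP: alpha01. Qed.
Let b1000 : 1000 <= b.
Proof.
apply: (le_trans ba); rewrite ler_piMr //.
by rewrite -(pmulr_lge0 _ a0) (le_trans (ler0n _ _) ba).
Qed.
Let b2 : 2 <= b. Proof. by apply: le_trans b1000; rewrite ler_nat. Qed.
Let b0 : 0 < b. Proof. exact: lt_le_trans b2. Qed.
Let s0 k : 0 < scale k. Proof. exact: scale_gt0. Qed.
Let sS k : b * scale k.+1 = scale k.
Proof. by rewrite scaleS // mulrC divfK // gt_eqF. Qed.
Let sb k : 1000 * scale k.+1 <= scale k. Proof. by rewrite -[leRHS]sS ler_pM2r. Qed.
Let sab k : 1000 * scale k.+1 <= alpha * scale k.
Proof. by rewrite -[X in _ <= _ * X]sS mulrA ler_pM2r // mulrC. Qed.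
Let etas k : eta * scale k <= alpha * scale k.+1.
Proof. by rewrite -[scale k]sS mulrA ler_pM2r. Qed.

Variables (N : nat) (xs : nat -> V) (rho : nat -> R) (y0 : V) (r0 : R).
Hypothesis rho0 : forall i, 0 < rho i.
Hypothesis cover : forall y, E y -> enorm (y - y0) < r0 ->
  exists2 i, (i < N)%N & enorm (y - xs i) < rho i.

(** The descent stops at a node that is not alive, where a covering ball of at least its size can be
    charged. The margin [4 * scale k] makes the aliveness of a node apply to the balls that kill its
    descendants. *)
Definition alive k v := forall i, (i < N)%N -> enorm (xs i - v) < rho i + 4 * scale k ->
  rho i < scale k.

Lemma scale_small (e : R) : 0 < e -> exists k, scale k <= e.
Proof.
move=> e0; exists (Num.truncn (e^-1)).+1.
rewrite -[leRHS]invrK lef_pV2 ?posrE ?invr_gt0 ?exprn_gt0 //.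
apply: (le_trans (ltW (truncnS_gt _))).
elim: (Num.truncn _).+1 => [|k IH]; first by rewrite expr0 ler01.
rewrite exprS -natr1; have := b2; have : 1 <= b ^+ k by rewrite exprn_ege1 //; have := b2; lra.
nra.
Qed.

Lemma scale_small_all : exists k, forall i, (i < N)%N -> scale k <= rho i.
Proof.
elim: N => [|M [k hk]]; first by exists 0%N.
have [l hl] := scale_small (rho0 M).
exists (maxn k l) => i; rewrite ltnS leq_eqVlt => /orP[/eqP ->|/hk h].
  by apply: le_trans hl; apply: scale_le => //; exact: leq_maxr.
by apply: le_trans h; apply: scale_le => //; exact: leq_maxl.
Qed.

Lemma desc_par k z j w : (k <= j)%N -> desc k z j.+1 w -> desc k z j (par j w).
Proof.
move=> kj h; inversion h as [e1 e2|i v Xv dv e1 e2]; subst => //.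
by rewrite ltnn in kj.
Qed.

(** The ancestor of [w] at level [k.+1] is within half a scale of [z], so [par_near] makes [z] its
    parent. *)
Lemma near_desc k z j w : X k z -> X j w -> (k < j)%N -> enorm (w - z) <= scale k / 10 ->
  desc k z j w.
Proof.
move=> Xz Xw kj wz; have [u Xu du] := ancestor T kj Xw.
apply: (desc_trans _ du).
suff e : par k u = z by apply: desc_step => //; rewrite e; exact: desc_refl.
apply: (par_near T) => //.
have := enorm_triangle w u z; rewrite (enormBC u w).
have := desc_dist_le T b2 du; have := sb k; have := s0 k; lra.
Qed.

Variables (k0 : nat) (z : V).
Hypotheses (Xz : X k0 z) (alz : alive k0 z) (zy : enorm (z - y0) < r0 - 4 * scale k0).
Local Notation t := (top k0 z).
Local Notation nt := (nu t.1 t.2).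

Let nt1 : enorm nt = 1.
Proof. by apply: (net_unit T); apply: (top_net _ T). Qed.

(** The radius of the ball fixes the level [j], and then [u] fixes the region: this is why only
    boundedly many regions charge one ball. *)
Definition ball_related i := exists j u, [/\ X j u, desc k0 z j u, top j u = t,
  scale j.+1 <= rho i < scale j & enorm (xs i - u) <= 7 * scale j].

Definition thin_near p j a := exists2 y, E y &
  enorm (y - a) <= 3 * scale j /\ enorm (hproj nt (p - y)) <= alpha * scale j.

Definition child_top j a := [/\ X j.+1 a, desc k0 z j.+1 a, top j (par j a) = t,
  top j.+1 a = (j.+1, a) & `|dot (nu j.+1 a) nt| < alpha /\ alive j.+1 a].

Definition captured p :=
  (exists i, [/\ (i < N)%N, ball_related i & enorm (hproj nt (p - xs i)) <= 9 * rho i]) \/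
  (exists j a, child_top j a /\ thin_near p j.+1 a).

(** A ball that kills [g] has radius at least the scale of [g] and, [z] being alive, less than that
    of [z]. It is charged to the ancestor of [g] at the level of its radius, still in the region of
    [z]. The 9 in [captured] is [4 + (1 + 4)]. *)
Lemma captured_dead p l g : X l.+1 g -> (k0 <= l)%N -> desc k0 z l.+1 g ->
  top l (par l g) = t -> ~ alive l.+1 g -> enorm (hproj nt (p - g)) <= 4 * scale l.+1 ->
  captured p.
Proof.
move=> Xg kl dg tg dead pg; left.
have [i [iN xig rhoi]] : exists i, [/\ (i < N)%N,
    enorm (xs i - g) < rho i + 4 * scale l.+1 & scale l.+1 <= rho i].
  apply: contrapT => no; apply: dead => i iN h; rewrite ltNge; apply/negP => h'.
  by apply: no; exists i.
have rk : rho i < scale k0.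
  apply: alz => //.
  have := enorm_triangle g (xs i) z; have := desc_dist T b2 dg.
  have : scale l.+1 <= scale k0 by apply: scale_le => //; exact: leqW.
  lra.
pose P j := (k0 <= j <= l)%N && (rho i < scale j).
have exP : exists j, P j by exists k0; rewrite /P leqnn kl.
have bP j : P j -> (j <= l)%N by case/andP => /andP[].
case: (ex_maxnP exP bP) => j /andP[/andP[kj jl] rj] jmax.
have rj1 : scale j.+1 <= rho i.
  have [->|jl'] := eqVneq j l; first by [].
  rewrite leNgt; apply/negP => h; have : P j.+1 by rewrite /P h (leqW kj) ltn_neqAle jl' jl.
  by move=> /jmax; rewrite ltnn.
have dpg := desc_par kl dg.
have [u du dug] : exists2 u, desc k0 z j u & desc j u l (par l g).
  by apply: desc_split => //; rewrite kj.
have Xu := desc_net Xz du.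
exists i; split => //.
  exists j, u; split => //; last 1 first.
  - have dgu : desc j u l.+1 g by apply: desc_step.
    have := enorm_triangle g (xs i) u; have := desc_dist_le T b2 dgu; lra.
  - by rewrite -tg; apply: (top_between dug); rewrite tg (leq_trans (top_le _ _ _ _ _)).
  - by rewrite rj1.
have := hproj_triangle nt p g (xs i); have := hproj_le (g - xs i) nt1.
rewrite (enormBC g); lra.
Qed.

(** [eta * b <= alpha] turns flatness at level [k] into the precision [alpha * scale k.+1], which is
    what a child region requires. *)
Lemma descent_step p q s k w (D : R) : X k w -> q = p + s *: nt ->
  dot (q - w) (nu k w) = 0 -> enorm (q - w) <= D -> D < K / 2 * scale k ->
  exists y v, [/\ E y, X k.+1 v, enorm (y - v) < scale k.+1,
    enorm (hproj nt (p - y)) <= alpha * scale k.+1 &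
    enorm (v - w) <= D + 2 * scale k.+1].
Proof.
move=> Xw qE qw qD DK; have [_ _ F2] := net_flat T Xw.
have [y Ey yq] := F2 q qw (le_lt_trans qD DK).
have [v Xv yv] := net_cover T k.+1 Ey.
have as1 : alpha * scale k.+1 <= scale k.+1 by rewrite ler_piMl // ltW.
exists y, v; split => //.
  have -> : p - y = (q - y) + (- s) *: nt by rewrite qE; apply/rowP => i; rewrite !mxE; ring.
  rewrite hprojD hproj_normal // addr0; apply: (le_trans (hproj_le _ nt1)).
  by rewrite enormBC; apply: (le_trans yq).
have := enorm_triangle y v w; have := enorm_triangle q y w.
rewrite (enormBC v y); have := etas k; lra.
Qed.

Lemma descent_continue p k y v : (k0 <= k)%N -> E y -> X k.+1 v ->
  enorm (y - v) < scale k.+1 -> enorm (hproj nt (p - y)) <= alpha * scale k.+1 ->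
  enorm (v - z) <= scale k0 / 10 ->
  captured p \/ [/\ top k.+1 v = t, alive k.+1 v, desc k0 z k.+1 v &
                    enorm (hproj nt (p - v)) <= 2 * scale k.+1].
Proof.
move=> kk Ey Xv yv py vz.
have dv : desc k0 z k.+1 v by apply: near_desc.
have as1 : alpha * scale k.+1 <= scale k.+1 by rewrite ler_piMl // ltW.
have pv : enorm (hproj nt (p - v)) <= 2 * scale k.+1.
  have := hproj_triangle nt p y v; have := hproj_le (y - v) nt1; lra.
have [tv|tv] := pselect (top k.+1 v = t).
  have [al|dead] := pselect (alive k.+1 v); first by right.
  left; apply: (captured_dead Xv) => //; last by have := s0 k.+1; lra.
  have dpv : desc k (par k v) k.+1 v by apply: desc_step => //; exact: desc_refl.
  rewrite -tv; apply: (top_between dpv).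
  by rewrite tv (leq_trans (top_le _ _ _ _ _)).
(* [v] has left the region: [p] is captured at the first node [a] that did so, as a child region if
   [a] is alive and by a covering ball otherwise. *)
have [i [a [Xa dav da ta [tta tilt]]]] := new_top Xz dv tv.
have ki : (k0 <= i)%N by exact: desc_le da.
have da' : desc k0 z i.+1 a by apply: desc_step.
have sik : scale k.+1 <= scale i.+1 by apply: scale_le => //; exact: desc_le dav.
have ya : enorm (y - a) <= 3 * scale i.+1.
  by have := enorm_triangle v y a; have := desc_dist_le T b2 dav; lra.
have py' : enorm (hproj nt (p - y)) <= alpha * scale i.+1.
  by apply: (le_trans py); rewrite ler_pM2l.
left; have [al|dead] := pselect (alive i.+1 a).
  by right; exists i, a; split => //; exists y.
apply: (captured_dead Xa) => //.
have := hproj_triangle nt p y a; have := hproj_le (y - a) nt1.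
have : alpha * scale i.+1 <= scale i.+1 by rewrite ler_piMl // ltW.
lra.
Qed.

(* Follow the line through [p] in the direction [nt] down the tree: it meets the plane of each
   node of the region at a bounded relative distance, and there is a point of [E] nearby. *)
Lemma disc_captured p : dot (p - z) nt = 0 ->
  (t = (k0, z) /\ enorm (p - z) <= scale k0 / 50) \/ enorm (p - z) <= alpha * scale k0 / 50 ->
  captured p.
Proof.
move=> pz hp.
have aS k : 12 * scale k.+1 / alpha <= scale k * (12 / 1000).
  by rewrite ler_pdivrMr //; have := sab k; lra.
have first : captured p \/ exists v, [/\ X k0.+1 v, top k0.+1 v = t, alive k0.+1 v,
    enorm (hproj nt (p - v)) <= 2 * scale k0.+1 &
    enorm (v - z) <= scale k0 / 10 - 12 * scale k0.+1 / alpha].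
  have [s [qz qD]] : exists s, dot (p + s *: nt - z) (nu k0 z) = 0 /\
      enorm (p + s *: nt - z) <= scale k0 / 25.
    case: hp => [[tz hp]|hp].
      exists 0; rewrite scale0r addr0; split; last by have := s0 k0; lra.
      by move: pz; rewrite tz.
    have [s [h1 h2]] := line_meets_plane p z alpha01 (net_unit T Xz) nt1 (top_tilt T a1 Xz).
    exists s; split => //; apply: (le_trans h2).
    by rewrite hproj_orth // ler_pdivrMr //; lra.
  have DK : scale k0 / 25 < K / 2 * scale k0.
    have K8 : 8 < K.
      apply: (lt_le_trans Ka); rewrite ler_piMr //.
      by rewrite -(pmulr_lge0 _ a0); apply: ltW; apply: lt_trans Ka.
    have : 8 * scale k0 < K * scale k0 by rewrite ltr_pM2r.
    by have := s0 k0; lra.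
  have [y [v [Ey Xv yv py vz]]] := descent_step Xz erefl qz qD DK.
  have := aS k0; have := sb k0; have := s0 k0 => h1 h2 h3.
  case: (@descent_continue p k0 y v) => //; first by lra.
    by left.
  move=> [tv al dv pv]; right; exists v; split => //.
  by apply: (le_trans vz); lra.
(* [12 * scale k / alpha] is a reserve for later steps: one step costs at most
   [4 * scale k / alpha + 2 * scale k.+1], and the next reserve is far smaller. The nodes thus stay
   within [scale k0 / 10] of [z], where [near_desc] applies. *)
have inv (m : nat) : captured p \/ exists v, [/\ X (k0 + m).+1 v, top (k0 + m).+1 v = t,
    alive (k0 + m).+1 v, enorm (hproj nt (p - v)) <= 2 * scale (k0 + m).+1 &
    enorm (v - z) <= scale k0 / 10 - 12 * scale (k0 + m).+1 / alpha].
  elim: m => [|m IH]; first by rewrite addn0.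
  case: IH => [|[w [Xw tw alw pw wz]]]; first by left.
  set k := (k0 + m).+1 in Xw tw alw pw wz *; rewrite addnS -/k.
  have tilt := top_tilt T a1 Xw; rewrite tw in tilt.
  have [s [qw qD]] := line_meets_plane p w alpha01 (net_unit T Xw) nt1 tilt.
  have qD' : enorm (p + s *: nt - w) <= 4 * scale k / alpha.
    by apply: (le_trans qD); rewrite ler_pM2r ?invr_gt0 //; lra.
  have DK : 4 * scale k / alpha < K / 2 * scale k.
    rewrite ltr_pdivrMr //; have : 8 * scale k < K * alpha * scale k by rewrite ltr_pM2r.
    lra.
  have [y [v [Ey Xv yv py vw]]] := descent_step Xw erefl qw qD' DK.
  have kk : (k0 <= k)%N by rewrite /k leqW // leq_addr.
  have sa : scale k <= scale k / alpha by rewrite ler_pdivlMr // ler_piMr // ltW.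
  have vz : enorm (v - z) <= scale k0 / 10 - 12 * scale k.+1 / alpha.
    have := enorm_triangle w v z; have := aS k; have := sb k; have := s0 k; lra.
  have pos : 0 < 12 * scale k.+1 / alpha by rewrite divr_gt0 // mulr_gt0.
  case: (@descent_continue p k y v) => //; first by lra.
    by left.
  by move=> [tv al dv pv]; right; exists v.
(* At a level finer than all radii the node [v] cannot be alive, because a covering ball contains
   it: by then [p] has been captured. *)
have [M hM] := scale_small_all.
have [//|[v [Xv tv alv _ vz]]] := inv M.
have Ev := net_sub T Xv.
have pos : 0 < 12 * scale (k0 + M).+1 / alpha by rewrite divr_gt0 // mulr_gt0.
have vy0 : enorm (v - y0) < r0.
  by have := enorm_triangle z v y0; have := zy; have := s0 k0; lra.
have [i iN xv] := cover Ev vy0.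
have : rho i < scale (k0 + M).+1.
  by apply: alv => //; rewrite enormBC; have := s0 (k0 + M).+1; lra.
have : scale (k0 + M).+1 <= scale M.
  by apply: scale_le => //; rewrite leqW // leq_addl.
have := hM i iN; lra.
Qed.

End Descent.

(** * Grid points of a hyperplane in place of volume *)

Section DiscContent.
Variables (R : realType) (d : nat).
Local Notation V := 'rV[R]_(d.+1).
Variables (n z : V) (i0 : 'I_d.+1).
Hypotheses (n1 : enorm n = 1) (ni0 : dominant i0 n) (d0 : (0 < d)%N).
Implicit Types (p m : V).

(** A basis of the hyperplane orthogonal to [n], viewed as a graph over the coordinates other than
    [i0]: coefficients are read off those coordinates, and dominance of [i0] bounds the vectors. *)
Definition frame (j : 'I_d) : V :=
  delta_mx ord0 (lift i0 j) - (n ord0 (lift i0 j) / n ord0 i0) *: delta_mx ord0 i0.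

Lemma dominant_neq0 : n ord0 i0 != 0.
Proof.
apply/eqP => n0; have : n = 0.
  apply/rowP => j; rewrite mxE; apply/eqP; rewrite -normr_le0.
  by apply: (le_trans (ni0 j)); rewrite n0 normr0.
by move=> ne; move: n1; rewrite ne enorm0 => /eqP; rewrite eq_sym oner_eq0.
Qed.

Lemma dot_delta i m : dot (delta_mx ord0 i) m = m ord0 i.
Proof.
rewrite /dot (bigD1 i) //= mxE !eqxx mul1r big1 ?addr0 // => j ji.
by rewrite mxE eqxx /= (negbTE ji) mul0r.
Qed.

Lemma dot_frame j m :
  dot (frame j) m = m ord0 (lift i0 j) - n ord0 (lift i0 j) / n ord0 i0 * m ord0 i0.
Proof. by rewrite /frame dotBl dotZl !dot_delta. Qed.

Lemma frame_orth j : dot (frame j) n = 0.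
Proof. by rewrite dot_frame divfK ?dominant_neq0 // subrr. Qed.

Lemma frame_norm j : enorm (frame j) <= 2.
Proof.
have delta1 i : enorm (delta_mx ord0 i : V) = 1.
  by rewrite enormE dot_delta mxE !eqxx sqrtr1.
apply: (le_trans (enormB _ _)); rewrite enormZ !delta1 mulr1.
have -> : (2 : R) = 1 + 1 by [].
by rewrite lerD2l normrM normfV ler_pdivrMr ?mul1r ?normr_gt0 ?dominant_neq0.
Qed.

Lemma frame_coord j k : frame j ord0 (lift i0 k) = (j == k)%:R.
Proof.
rewrite -[LHS]dot_delta dotC dot_frame !mxE !eqxx /= (inj_eq lift_inj).
by rewrite eq_sym (negbTE (neq_lift _ _)) mulr0 subr0 eq_sym.
Qed.

Lemma frame_decomp m : dot m n = 0 -> m = \sum_j m ord0 (lift i0 j) *: frame j.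
Proof.
move=> mn; apply/rowP => k; rewrite summxE.
have [j ->|->] := unliftP i0 k.
  rewrite (bigD1 j) //= mxE frame_coord eqxx mulr1 big1 ?addr0 // => l lj.
  by rewrite mxE frame_coord (negbTE lj) mulr0.
have e j : (m ord0 (lift i0 j) *: frame j) ord0 i0
    = - (m ord0 (lift i0 j) * n ord0 (lift i0 j)) / n ord0 i0.
  rewrite mxE -[frame j _ _]dot_delta dotC dot_frame !mxE !eqxx /=.
  by rewrite (eq_sym (lift i0 j)) (negbTE (neq_lift _ _)) sub0r mulr1 mulrN mulrA mulNr.
rewrite (eq_bigr _ (fun j _ => e j)) -mulr_suml sumrN.
move: mn; rewrite /dot (bigD1_ord i0) //= => /eqP; rewrite addr_eq0 => /eqP <-.
by rewrite mulfK ?dominant_neq0.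
Qed.

Definition grid_point (h : R) M (u : {ffun 'I_d -> 'I_M}) : V :=
  z + \sum_j (h * (u j)%:R) *: frame j.

Lemma grid_diff h M (u v : {ffun 'I_d -> 'I_M}) : grid_point h u - grid_point h v =
  \sum_j (h * ((u j)%:R - (v j)%:R)) *: frame j.
Proof.
rewrite /grid_point opprD addrACA subrr add0r -sumrB; apply: eq_bigr => j _.
by rewrite -scalerBl mulrBr.
Qed.

Lemma grid_coord h M (u v : {ffun 'I_d -> 'I_M}) j :
  (grid_point h u - grid_point h v) ord0 (lift i0 j) = h * ((u j)%:R - (v j)%:R).
Proof.
rewrite grid_diff summxE (bigD1 j) //= mxE frame_coord eqxx mulr1 big1 ?addr0 // => k kj.
by rewrite mxE frame_coord (negbTE kj) mulr0.
Qed.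

Lemma grid_orth h M (u : {ffun 'I_d -> 'I_M}) : dot (grid_point h u - z) n = 0.
Proof.
rewrite /grid_point addrC addKr.
by elim/big_rec: _ => [|j x _ IH]; rewrite ?dot0l // dotDl IH dotZl frame_orth mulr0 addr0.
Qed.

Lemma grid_norm h M (u : {ffun 'I_d -> 'I_M}) : 0 <= h ->
  enorm (grid_point h u - z) <= 2 * d%:R * (h * M%:R).
Proof.
move=> h0; rewrite /grid_point addrC addKr.
apply: (@le_trans _ _ (\sum_(j < d) 2 * (h * M%:R))).
  elim/big_ind2: _ => [|x1 x2 y1 y2 h1 h2|j _]; first by rewrite enorm0.
    by apply: (le_trans (enormD _ _)); exact: lerD.
  rewrite enormZ ger0_norm ?mulr_ge0 // mulrC ler_pM ?enorm_ge0 ?mulr_ge0 ?frame_norm //.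
  by rewrite ler_wpM2l // ler_nat ltnW.
by rewrite sumr_const card_ord -[_ *+ d]mulr_natl [leLHS]mulrCA mulrA.
Qed.

Lemma nat_diff_le (h D : R) (a c : nat) : 0 < h -> `|h * (a%:R - c%:R)| <= D ->
  (a <= c + Num.truncn (D / h))%N.
Proof.
move=> h0; rewrite normrM gtr0_norm // mulrC -ler_pdivlMr // => hD.
have D0 : 0 <= D / h by apply: le_trans hD.
have [ac|ca] := leqP a c; first by rewrite (leq_trans ac) // leq_addr.
rewrite -leq_subLR truncn_ge_nat // natrB ?(ltnW ca) //.
exact: le_trans (ler_norm _) hD.
Qed.

Lemma truncnS_le (x : R) : 1 <= x -> (Num.truncn x).+1%:R <= 2 * x.
Proof.
move=> x1; have x0 : 0 <= x by apply: le_trans x1.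
by have /andP[h _] := truncn_itv x0; rewrite -natr1; lra.
Qed.

Lemma card_grid_ball (h D : R) M (G : {set {ffun 'I_d -> 'I_M}}) : 0 < h -> h <= D ->
  (forall u v, u \in G -> v \in G -> enorm (grid_point h u - grid_point h v) <= D) ->
  #|G|%:R * h ^+ d <= (2 * D) ^+ d.
Proof.
move=> h0 hD GD; have Dh : 1 <= D / h by rewrite ler_pdivlMr // mul1r.
have : (#|G| <= (Num.truncn (D / h)).+1 ^ d)%N.
  apply: card_box => u v j uG vG; apply: nat_diff_le => //.
  by rewrite -grid_coord; apply: le_trans (coord_le_enorm _ _) _; exact: GD.
rewrite -(ler_nat R) natrX => hG.
have -> : 2 * D = (2 * (D / h)) * h by rewrite mulrA divfK // gt_eqF.
rewrite exprMn ler_wpM2r ?exprn_ge0 ?(ltW h0) //; apply: (le_trans hG).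
by rewrite lerXn2r ?nnegrE ?truncnS_le // mulr_ge0 // (le_trans _ Dh).
Qed.

(** The projection [m'] of [m] to the hyperplane satisfies [dot m' m = 1 - dot m n ^+ 2 >= 3 / 4].
    Its [d] frame coefficients are at most 1, so inner products all below [1 / (2 * d%:R)] would
    give at most [1 / 2]. *)
Lemma steep_frame m : enorm m = 1 -> `|dot m n| <= 1 / 2 ->
  exists j, 1 / (2 * d%:R) <= `|dot (frame j) m|.
Proof.
move=> m1 mn; apply: contrapT => no.
have dR : 0 < d%:R :> R by rewrite ltr0n.
have small j : `|dot (frame j) m| < 1 / (2 * d%:R).
  by rewrite ltNge; apply/negP => h; apply: no; exists j.
pose m' := hproj n m.
have m'n : dot m' n = 0.
  by rewrite /m' /hproj dotBl dotZl -(enorm_sqr n) n1 expr1n mulr1 subrr.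
have m'm : dot m' m = 1 - dot m n ^+ 2.
  by rewrite /m' /hproj dotBl dotZl -(enorm_sqr m) m1 expr1n (dotC n) expr2.
have sq : dot m n ^+ 2 <= 1 / 4.
  by rewrite -real_normK ?num_real //; have := normr_ge0 (dot m n); nra.
have : dot m' m <= 1 / 2.
  rewrite {1}(frame_decomp m'n).
  apply: (@le_trans _ _ (\sum_(j < d) 1 / (2 * d%:R))); last first.
    rewrite sumr_const card_ord -[_ *+ d]mulr_natl le_eqVlt; apply/orP; left; apply/eqP.
    by field; rewrite gt_eqF.
  elim/big_ind2: _ => [|x1 x2 y1 y2 h1 h2|j _]; first by rewrite dot0l.
    by rewrite dotDl lerD.
  rewrite dotZl; apply: (le_trans (ler_norm _)); rewrite normrM.
  apply: (@le_trans _ _ (1 * `|dot (frame j) m|)); last by rewrite mul1r ltW.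
  rewrite ler_wpM2r //; apply: (le_trans (coord_le_enorm _ _)).
  by rewrite -m1; exact: hproj_le.
rewrite m'm; lra.
Qed.

(** With the other coordinates fixed, the one along a steep frame vector varies over a length at
    most [2 * d%:R * w]: one factor [D] of the count becomes a multiple of [w]. *)
Lemma card_grid_thin (h D w : R) m M (G : {set {ffun 'I_d -> 'I_M}}) :
  0 < h -> h <= D -> h <= 2 * d%:R * w -> enorm m = 1 -> `|dot m n| <= 1 / 2 ->
  (forall u v, u \in G -> v \in G -> enorm (grid_point h u - grid_point h v) <= D /\
     `|dot (grid_point h u - grid_point h v) m| <= w) ->
  #|G|%:R * h ^+ d <= (2 * D) ^+ d.-1 * (4 * d%:R * w).
Proof.
move=> h0 hD hw m1 mn GD; have Dh : 1 <= D / h by rewrite ler_pdivlMr // mul1r.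
have dR : 0 < d%:R :> R by rewrite ltr0n.
have [j0 hj0] := steep_frame m1 mn.
have wh : 1 <= 2 * d%:R * w / h by rewrite ler_pdivlMr // mul1r.
have : (#|G| <= (Num.truncn (D / h)).+1 ^ d.-1 * (Num.truncn (2 * d%:R * w / h)).+1)%N.
  apply: (@card_thin_box _ _ _ _ j0) => u v.
    move=> j uG vG; apply: nat_diff_le => //; rewrite -grid_coord.
    by apply: le_trans (coord_le_enorm _ _) _; have [] := GD u v uG vG.
  move=> uG vG e; apply: nat_diff_le => //.
  have [_] := GD u v uG vG.
  rewrite grid_diff (bigD1 j0) //= big1; last first.
    by move=> j jj0; rewrite e // subrr mulr0 scale0r.
  rewrite addr0 dotZl normrM => hh.
  have : `|h * ((u j0)%:R - (v j0)%:R)| * (1 / (2 * d%:R)) <= w.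
    by apply: le_trans hh; rewrite ler_wpM2l.
  by rewrite mulrA mulr1 ler_pdivrMr ?mulr_gt0 // (mulrC w).
rewrite -(ler_nat R) natrM natrX => hG.
have -> : (2 * D) ^+ d.-1 * (4 * d%:R * w)
    = ((2 * (D / h)) ^+ d.-1 * (2 * (2 * d%:R * w / h))) * h ^+ d.
  rewrite -[in h ^+ d](prednK d0) exprSr.
  have -> : 2 * D = (2 * (D / h)) * h by rewrite mulrA divfK // gt_eqF.
  by rewrite exprMn; field; rewrite gt_eqF.
rewrite ler_wpM2r ?exprn_ge0 ?(ltW h0) //; apply: (le_trans hG).
rewrite ler_pM ?exprn_ge0 ?truncnS_le //.
by rewrite lerXn2r ?nnegrE ?truncnS_le // mulr_ge0 // (le_trans _ Dh).
Qed.

(** The disc contains [M ^ d] grid points of mesh [h], each in some [Q i], which holds at most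
    [c i / h ^+ d] of them. The divisor [2 * d%:R] is there because [d] frame vectors of length at
    most 2 are added. *)
Lemma disc_content (s : R) (I : finType) (Q : I -> set V) (c h1 : I -> R) : 0 < s ->
  (forall i, 0 < h1 i) ->
  (forall i h M (G : {set {ffun 'I_d -> 'I_M}}), 0 < h <= h1 i ->
     (forall u, u \in G -> Q i (grid_point h u)) -> #|G|%:R * h ^+ d <= c i) ->
  (forall p, dot (p - z) n = 0 -> enorm (p - z) <= s -> exists i, Q i p) ->
  (s / (2 * d%:R)) ^+ d <= \sum_i c i.
Proof.
move=> s0 h10 hc cov; have dR : 0 < d%:R :> R by rewrite ltr0n.
pose s' := s / (2 * d%:R); have s'0 : 0 < s' by rewrite divr_gt0 // mulr_gt0.
pose hm := \big[Num.min/1]_i h1 i.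
have hm0 : 0 < hm by apply/bigmin_gtP; split.
pose M := (Num.truncn (s' / hm)).+1.
have M0 : 0 < M%:R :> R by rewrite ltr0n.
pose h := s' / M%:R; have h0 : 0 < h by rewrite divr_gt0.
have hh i : h <= h1 i.
  apply: (@le_trans _ _ hm); last exact: bigmin_le_cond.
  rewrite ler_pdivrMr // mulrC -ler_pdivrMr //.
  by apply: ltW; rewrite /M; exact: truncnS_gt.
pose G i := [set u : {ffun 'I_d -> 'I_M} | `[< Q i (grid_point h u) >]]%SET.
have GQ i u : u \in G i -> Q i (grid_point h u) by rewrite inE => /asboolP.
have hsum : (M ^ d <= \sum_i #|G i|)%N.
  have -> : (M ^ d = #|{ffun 'I_d -> 'I_M}|)%N by rewrite card_ffun !card_ord.
  rewrite -sum1_card; under [leqRHS]eq_bigr do rewrite -sum1_card big_mkcond /=.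
  rewrite exchange_big /=; apply: leq_sum => u _.
  have [|i Qi] := cov (grid_point h u) (grid_orth _ _).
    apply: (le_trans (grid_norm _ (ltW h0))).
    have -> : 2 * d%:R * (h * M%:R) = s; last exact: lexx.
    by rewrite /h divfK ?gt_eqF // /s'; field; rewrite gt_eqF.
  by rewrite (bigD1 i) //= ifT ?leq_addr // inE; apply/asboolP.
have -> : s / (2 * d%:R) = M%:R * h by rewrite [RHS]mulrC /h divfK // gt_eqF.
rewrite exprMn -natrX.
apply: (@le_trans _ _ ((\sum_i #|G i|)%:R * h ^+ d)).
  by rewrite ler_wpM2r ?exprn_ge0 ?(ltW h0) // ler_nat.
rewrite natr_sum mulr_suml; apply: ler_sum => i _.
by apply: hc; [rewrite h0 hh|exact: GQ].
Qed.

End DiscContent.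

(** * The packing inequality at one node *)

Section Packing.
Variables (R : realType) (d : nat).
Local Notation V := 'rV[R]_(d.+1).
Implicit Types (p q u v w x y z : V).

Lemma bounded_enum (T : eqType) (P : T -> Prop) (M : nat) :
  (forall s : seq T, uniq s -> (forall x : T, x \in s -> P x) -> (size s <= M)%N) ->
  exists s : seq T, uniq s /\ forall x : T, x \in s <-> P x.
Proof.
move=> h.
pose Q k := `[< exists s : seq T, [/\ uniq s, (forall x : T, x \in s -> P x) & size s = k] >].
have exQ : exists k, Q k by exists 0%N; apply/asboolP; exists [::].
have bQ k : Q k -> (k <= M)%N by move=> /asboolP [s [us sP <-]]; exact: h.
case: (ex_maxnP exQ bQ) => k /asboolP [s [us sP sk]] kmax.
exists s; split => // x; split; first exact: sP.
move=> Px; apply: contrapT => /negP xs.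
have /kmax : Q k.+1.
  apply/asboolP; exists (x :: s); split; rewrite /= ?xs ?sk //.
  by move=> y; rewrite inE => /orP[/eqP ->|/sP].
by rewrite ltnn.
Qed.

Variables (E : set V) (b K eta alpha : R) (X : nat -> set V) (par nu : nat -> V -> V).
Hypothesis T : net_tree E b K eta X par nu.
Hypotheses (d0 : (0 < d)%N) (alpha01 : 0 < alpha <= 1 / 2) (Ka : 8 < K * alpha)
  (ba : 1000 <= b * alpha) (etab : eta * b <= alpha).
Local Notation top := (top alpha par nu).
Local Notation scale := (scale b).

Let a0 : 0 < alpha. Proof. by case/andP: alpha01. Qed.
Let alpha01' : 0 < alpha <= 1.
Proof. by have /andP[h h'] := alpha01; rewrite h /=; apply: (le_trans h'); lra. Qed.
Let a1 : alpha <= 1. Proof. by case/andP: alpha01'. Qed.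
Let b1000 : 1000 <= b.
Proof.
apply: (le_trans ba); rewrite ler_piMr //.
by rewrite -(pmulr_lge0 _ a0) (le_trans (ler0n _ _) ba).
Qed.
Let b2 : 2 <= b. Proof. by apply: le_trans b1000; rewrite ler_nat. Qed.
Let b0 : 0 < b. Proof. exact: lt_le_trans b2. Qed.
Let s0 k : 0 < scale k. Proof. exact: scale_gt0. Qed.
Let etaa : eta <= alpha.
Proof.
have [e0|e0] := leP eta 0; first by apply: (le_trans e0); exact: ltW.
apply: le_trans etab; rewrite ler_peMr ?(ltW e0) //; apply: le_trans b2; lra.
Qed.
Let K8 : 8 < K.
Proof.
apply: (lt_le_trans Ka); rewrite ler_piMr //.
by rewrite -(pmulr_lge0 _ a0); apply: ltW; apply: lt_trans Ka.
Qed.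

Variables (N : nat) (xs : nat -> V) (rho : nat -> R) (y0 : V) (r0 : R).
Hypothesis rho0 : forall i, 0 < rho i.
Hypothesis cover : forall y, E y -> enorm (y - y0) < r0 ->
  exists2 i, (i < N)%N & enorm (y - xs i) < rho i.

Definition live_top (a : nat * V) := [/\ X a.1 a.2, top a.1 a.2 = a,
  enorm (a.2 - y0) < r0 - 4 * scale a.1 & alive b N xs rho a.1 a.2].

(** The bound of [card_grid_thin] for diameter 8 and width [10 * alpha], in units of the scale of
    the child. *)
Definition thin_const : R := 16 ^+ d.-1 * (40 * d%:R * alpha).

Definition child_of k z (a : nat * V) :=
  exists2 j, a.1 = j.+1 & child_top b alpha X par nu N xs rho k z j a.2.

(* Near a child region [a] the captured points lie in a slab of width [alpha * scale a.1]:
   this is where the factor [alpha] of [thin_const] comes from. *)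
Lemma node_content (s : seq (nat * V)) k z (r : R) : (forall a, live_top a -> a \in s) ->
  X k z -> alive b N xs rho k z -> enorm (z - y0) < r0 - 4 * scale k -> 0 < r ->
  (top k z = (k, z) /\ r <= scale k / 50) \/ r <= alpha * scale k / 50 ->
  (r / (2 * d%:R)) ^+ d <=
    \sum_(i < N) (if `[< ball_related b alpha X par nu xs rho k z i >]
                  then (36 * rho i) ^+ d else 0)
  + \sum_(a <- s) (if `[< child_of k z a >] then thin_const * scale a.1 ^+ d else 0).
Proof.
move=> sP Xz alz zy r00 hr.
set t := top k z; set n := nu t.1 t.2.
have Xt : X t.1 t.2 by exact: (top_net _ T).
have n1 : enorm n = 1 by exact: (net_unit T).
have [i0 ni0] := exists_dominant n.
have dR : 0 < d%:R :> R by rewrite ltr0n.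
pose nd : nat * V := (0%N, 0).
pose a_ (j : 'I_(size s)) := nth nd s j.
pose Q (i : 'I_N + 'I_(size s)) : set V := match i with
  | inl i => [set p | [/\ dot (p - z) n = 0, ball_related b alpha X par nu xs rho k z i &
                         enorm (hproj n (p - xs i)) <= 9 * rho i]]
  | inr j => [set p | [/\ dot (p - z) n = 0, child_of k z (a_ j) &
                         thin_near E b alpha par nu k z p (a_ j).1 (a_ j).2]] end.
pose c (i : 'I_N + 'I_(size s)) : R := match i with
  | inl i => if `[< ball_related b alpha X par nu xs rho k z i >] then (36 * rho i) ^+ d else 0
  | inr j => if `[< child_of k z (a_ j) >] then thin_const * scale (a_ j).1 ^+ d else 0 end.
pose h1 (i : 'I_N + 'I_(size s)) : R := match i with
  | inl i => 18 * rho i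
  | inr j => Num.min (8 * scale (a_ j).1) (2 * d%:R * (10 * alpha * scale (a_ j).1)) end.
have flat_diff p p' : dot (p - z) n = 0 -> dot (p' - z) n = 0 -> dot (p - p') n = 0.
  move=> e e'; have -> : p - p' = (p - z) - (p' - z) by apply/rowP => l; rewrite !mxE; ring.
  by rewrite dotBl e e' subrr.
have := @disc_content R d n z i0 n1 ni0 d0 r _ Q c h1 r00.
rewrite big_sumType /= => H; apply: (le_trans (H _ _ _)).
- move=> [i|j] /=; first by rewrite mulr_gt0.
  by rewrite lt_min !mulr_gt0.
- move=> [i|j] h M G /= /andP[hp hle] GQ.
    case: asboolP => [rel|nrel]; last first.
      have -> : #|G| = 0%N.
        by apply: eq_card0 => u; apply/negbTE/negP => /GQ [].
      by rewrite mul0r.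
    have -> : 36 * rho i = 2 * (18 * rho i) by ring.
    apply: (@card_grid_ball R d n z i0) => // u v /GQ [pz _ pu] /GQ [pz' _ pv].
    have uv := flat_diff (grid_point n z i0 h u) (grid_point n z i0 h v) pz pz'.
    rewrite -[X in enorm X](hproj_orth uv).
    apply: (le_trans (hproj_triangle _ _ (xs i) _)).
    have -> : xs i - grid_point n z i0 h v = - (grid_point n z i0 h v - xs i) by rewrite opprB.
    rewrite -[- (grid_point n z i0 h v - xs i)]scaleN1r.
    have -> (w : V) : hproj n (-1 *: w) = - hproj n w.
      by apply/rowP => l; rewrite /hproj dotZl !mxE; ring.
    by rewrite enormN; lra.
  case: asboolP => [rel|nrel]; last first.
    have -> : #|G| = 0%N.
      by apply: eq_card0 => u; apply/negbTE/negP => /GQ [].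
    by rewrite mul0r.
  have [l al [Xa da ta tta [tilt ala]]] := rel.
  set sa := scale (a_ j).1 in hle *.
  have sa0 : 0 < sa by exact: s0.
  have -> : thin_const * sa ^+ d = (2 * (8 * sa)) ^+ d.-1 * (4 * d%:R * (10 * alpha * sa)).
    rewrite -[in sa ^+ d](prednK d0) exprSr /thin_const.
    have -> : 2 * (8 * sa) = 16 * sa by ring.
    by rewrite exprMn; ring.
  move: hle; rewrite le_min => /andP[hl1 hl2].
  have m1 := net_unit T Xa.
  apply: (@card_grid_thin R d n z i0 n1 ni0 d0 h (8 * sa) (10 * alpha * sa)
    (nu l.+1 (a_ j).2) M G) => //.
    by apply: ltW; apply: (lt_le_trans tilt); case/andP: alpha01.
  move=> u v /GQ [pz _ [y Ey [ya py]]] /GQ [pz' _ [y' Ey' [ya' py']]].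
  rewrite -/sa in ya py ya' py'.
  set P := grid_point n z i0 h u in pz py *; set P' := grid_point n z i0 h v in pz' py' *.
  have dec : P - P' = hproj n (P - y) + (hproj n (y - y') - hproj n (P' - y')).
    rewrite -[LHS](hproj_orth (flat_diff P P' pz pz')).
    by apply/rowP => q; rewrite /hproj !dotBl !mxE; ring.
  have yy : enorm (y - y') <= 6 * sa.
    by have := enorm_triangle (a_ j).2 y y'; rewrite (enormBC (a_ j).2 y'); lra.
  have asa : alpha * sa <= sa by rewrite ler_piMl // ltW.
  split.
    rewrite dec; apply: (le_trans (enormD _ _)).
    have := enormB (hproj n (y - y')) (hproj n (P' - y')); have := hproj_le (y - y') n1.
    have : alpha * sa <= sa / 2.
      by rewrite mulrC ler_wpM2l ?(ltW sa0) //; have /andP[_] := alpha01; lra.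
    lra.
  have [_ F1 _] := net_flat T Xa; rewrite -al -/sa in F1.
  have near (x : V) : enorm (x - (a_ j).2) <= 3 * sa -> enorm (x - (a_ j).2) < K * sa.
    move=> h3; apply: (le_lt_trans h3); rewrite ltr_pM2r //; apply: lt_trans K8; lra.
  have f1 := F1 y Ey (near _ ya); have f2 := F1 y' Ey' (near _ ya').
  rewrite -al in m1 tilt f1 f2; rewrite -al.
  set m := nu (a_ j).1 (a_ j).2 in m1 tilt f1 f2 *.
  have esa : eta * sa <= alpha * sa by rewrite ler_pM2r.
  have hm x : `|dot x m| <= enorm x by apply: le_trans (dot_le _ _) _; rewrite m1 mulr1.
  have hn x : `|dot x n| <= enorm x by apply: le_trans (dot_le _ _) _; rewrite n1 mulr1.
  rewrite dec dotDl dotBl.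
  (* [2 * eta <= 2 * alpha] from the slab at the child and [6 * alpha] from the component along [n],
     nearly orthogonal to [m]. The distances from [P] and [P'] to the projected points of [E] then
     raise 8 to 10. *)
  have mid : `|dot (hproj n (y - y')) m| <= 8 * alpha * sa.
    rewrite {1}/hproj (dotBl (y - y')) dotZl.
    have -> : dot (y - y') m = dot (y - (a_ j).2) m - dot (y' - (a_ j).2) m.
      by rewrite -dotBl; congr dot; apply/rowP => q; rewrite !mxE; ring.
    apply: (le_trans (ler_normB _ _)).
    have := ler_normB (dot (y - (a_ j).2) m) (dot (y' - (a_ j).2) m).
    have : `|dot (y - y') n * dot n m| <= 6 * sa * alpha.
      rewrite normrM ler_pM //; first exact: le_trans (hn _) yy.
      by rewrite dotC ltW.
    lra.
  apply: (le_trans (ler_normD _ _)).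
  have := ler_normB (dot (hproj n (y - y')) m) (dot (hproj n (P' - y')) m).
  have := hm (hproj n (P - y)); have := hm (hproj n (P' - y')); lra.
- move=> p pz pr.
  have hp : top k z = (k, z) /\ enorm (p - z) <= scale k / 50 \/
            enorm (p - z) <= alpha * scale k / 50.
    by case: hr => [[tz hr]|hr]; [left; split => //|right]; exact: le_trans pr hr.
  case: (disc_captured T alpha01' Ka ba etab rho0 cover Xz alz zy pz hp).
    by move=> [i [iN rel h]]; exists (inl (Ordinal iN)).
  move=> [j [a [ca th]]]; have [Xa da ta tta [tilt ala]] := ca.
  have ls : (j.+1, a) \in s.
    apply: sP; split => //=.
    have := enorm_triangle z a y0; have := desc_dist T b2 da.
    have := scale_le b2 (desc_le da); have := zy; lra.
  have js : (index (j.+1, a) s < size s)%N by rewrite index_mem.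
  have aE : a_ (Ordinal js) = (j.+1, a) by rewrite /a_ /= nth_index.
  by exists (inr (Ordinal js)); rewrite /= aE; split => //; exists j.
rewrite lerD2l le_eqVlt; apply/orP; left; apply/eqP.
by rewrite (big_nth nd) big_mkord.
Qed.

End Packing.

(** * Absorption and summation over the regions *)

Section PackingSum.
Variables (R : realType) (d : nat).
Local Notation V := 'rV[R]_(d.+1).
Implicit Types (p q u v w x y z : V) (a c : nat * V).
Variables (E : set V) (b K eta alpha : R) (X : nat -> set V) (par nu : nat -> V -> V).
Hypothesis T : net_tree E b K eta X par nu.
Hypotheses (d0 : (0 < d)%N) (alpha01 : 0 < alpha <= 1 / 2) (Ka : 8 < K * alpha)
  (ba : 1000 <= b * alpha) (etab : eta * b <= alpha)
  (thin_small : thin_const d alpha * (100 * d%:R) ^+ d <= 1 / 2).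
Local Notation top := (top alpha par nu).
Local Notation scale := (scale b).

Let a0 : 0 < alpha. Proof. by case/andP: alpha01. Qed.
Let alpha01' : 0 < alpha <= 1.
Proof. by have /andP[h h'] := alpha01; rewrite h /=; apply: (le_trans h'); lra. Qed.
Let b2 : 2 <= b.
Proof.
apply: (@le_trans _ _ 1000); first by rewrite ler_nat.
apply: (le_trans ba); rewrite ler_piMr //; last by case/andP: alpha01'.
by rewrite -(pmulr_lge0 _ a0) (le_trans (ler0n _ _) ba).
Qed.
Let b0 : 0 < b. Proof. exact: lt_le_trans b2. Qed.
Let s0 k : 0 < scale k. Proof. exact: scale_gt0. Qed.
Let dR : 0 < d%:R :> R. Proof. by rewrite ltr0n. Qed.

Variables (N : nat) (xs : nat -> V) (rho : nat -> R) (y0 : V) (r0 : R).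
Hypothesis rho0 : forall i, 0 < rho i.
Hypothesis cover : forall y, E y -> enorm (y - y0) < r0 ->
  exists2 i, (i < N)%N & enorm (y - xs i) < rho i.
Local Notation live_top := (live_top b alpha X par nu N xs rho y0 r0).
Local Notation ball_related a i := (ball_related b alpha X par nu xs rho a.1 a.2 i).
Local Notation child_of c a := (child_of b alpha X par nu N xs rho c.1 c.2 a).
Local Notation P := (packing_number d.+1 (7 : R)).

(** Nodes in the covered ball at levels finer than all radii are dead, and each net has finitely
    many points in that ball. *)
Lemma live_tops_enum : exists s : seq (nat * V), uniq s /\ forall a, a \in s <-> live_top a.
Proof.
have [M hM] := scale_small_all alpha01' ba N rho0.
have lvl a : live_top a -> (a.1 < M)%N.
  move=> [Xa _ ay al]; rewrite ltnNge; apply/negP => Ma.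
  have ay0 : enorm (a.2 - y0) < r0 by have := s0 a.1; lra.
  have [i iN xi] := cover (net_sub T Xa) ay0.
  have : rho i < scale a.1 by apply: al => //; rewrite enormBC; have := s0 a.1; lra.
  by rewrite ltNge (le_trans (scale_le b2 Ma)) // hM.
have ex k : exists s : seq V, uniq s /\ forall x, x \in s <-> (X k x /\ enorm (x - y0) < r0).
  apply: (@bounded_enum _ _ (packing_number d.+1 (r0 / scale k))) => s us sP.
  apply: (card_separated (s0 k) us (y := y0)) => [x xs'|x x' /sP [Xx _] /sP [Xx' _]].
    by rewrite divfK ?gt_eqF //; apply: ltW; have [] := sP x xs'.
  exact: (net_sep T).
have [s_ sP] := choice ex.
exists (undup [seq a <- [seq (k, x) | k <- iota 0 M, x <- s_ k] | `[< live_top a >]]).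
split; first exact: undup_uniq.
move=> a; rewrite mem_undup mem_filter; split; first by case/andP => /asboolP.
move=> la; apply/andP; split; first exact/asboolP.
have [Xa _ ay _] := la.
apply/allpairsPdep; exists a.1, a.2; rewrite mem_iota (lvl a la) -surjective_pairing.
split => //; have [_ h] := sP a.1; apply/h; split => //.
by have := s0 a.1; lra.
Qed.

(** All regions related to the ball are seen at one level [j], through net points within
    [7 * scale j] of its centre, and distinct regions give distinct points. *)
Lemma count_related (s : seq (nat * V)) i : uniq s -> (forall a, a \in s -> live_top a) ->
  (size [seq a <- s | `[< ball_related a i >]] <= P)%N.
Proof.
move=> us sP; set l := seq.filter _ _.
have ul : uniq l by exact: filter_uniq.
have lP a : a \in l -> live_top a /\ ball_related a i.
  by rewrite mem_filter => /andP[/asboolP h /sP].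
case le : l => [|a1 l'] //; rewrite -le.
have a1l : a1 \in l by rewrite le mem_head.
have [_ [j [u1 [_ _ _ /andP[j1 j2] _]]]] := lP a1 a1l.
have ex a : a \in l -> exists u, [/\ X j u, top j u = a & enorm (u - xs i) <= 7 * scale j].
  move=> /lP [[Xa ta _ _] [j' [u [Xu du tu /andP[h1 h2] hu]]]].
  have jj : j' = j.
    apply/eqP; rewrite eqn_leq; apply/andP; split; rewrite leqNgt; apply/negP => h.
      by have := le_lt_trans (le_trans (scale_le b2 h) j1) h2; rewrite ltxx.
    by have := le_lt_trans (le_trans (scale_le b2 h) h1) j2; rewrite ltxx.
  by exists u; rewrite -jj enormBC; split => //; rewrite tu.
pose f a := xget 0 [set u | [/\ X j u, top j u = a & enorm (u - xs i) <= 7 * scale j]].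
have fP a : a \in l -> [/\ X j (f a), top j (f a) = a & enorm (f a - xs i) <= 7 * scale j].
  by move=> /ex h; apply: (xgetPex 0 h).
rewrite -(size_map f); apply: (card_separated (s0 j) (y := xs i)).
- rewrite map_inj_in_uniq // => a c /fP [_ ta _] /fP [_ tc _] e.
  by rewrite -ta -tc e.
- by move=> x /mapP [a /fP [_ _ h] ->].
- move=> x x' /mapP [a /fP [Xa _ _] ->] /mapP [c /fP [Xc _ _] ->].
  exact: (net_sep T).
Qed.

(** The parent region has root [top j (par j a.2)], a function of [a]. *)
Lemma count_parents (s : seq (nat * V)) a : uniq s -> (forall c, c \in s -> live_top c) ->
  (size [seq c <- s | `[< child_of c a >]] <= 1)%N.
Proof.
move=> us sP; set l := seq.filter _ _.
have ul : uniq l by exact: filter_uniq.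
have lP c : c \in l -> exists2 j, a.1 = j.+1 & top j (par j a.2) = c.
  rewrite mem_filter => /andP[/asboolP [j aj [_ _ tj _ _]] /sP [_ tc _ _]].
  by exists j => //; rewrite tj.
case: l ul lP => [|c1 [|c2 l]] //= /andP[]; rewrite inE negb_or => /andP[c12 _] _ lP.
have [j aj e1] := lP c1 (mem_head _ _).
have [j' aj' e2] := lP c2 ltac:(by rewrite !inE eqxx orbT).
have jj : j = j' by move: aj'; rewrite aj => -[].
by move: c12; rewrite -e1 -e2 jj eqxx.
Qed.

Lemma sum_if_count (I : eqType) (s : seq I) (Q : pred I) (x : R) :
  \sum_(a <- s) (if Q a then x else 0) = x * (size [seq a <- s | Q a])%:R.
Proof.
rewrite -big_mkcond -big_filter big_const_seq count_predT iter_addr addr0.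
by rewrite mulr_natr.
Qed.

Definition packing_const : R := 2 * (100 * d%:R) ^+ d * (36 ^+ d * P%:R).

Lemma thin_const_ge0 : 0 <= thin_const d alpha.
Proof. by rewrite /thin_const mulr_ge0 ?exprn_ge0 // !mulr_ge0 // ltW. Qed.

Lemma packing_sum_all (s : seq (nat * V)) : uniq s -> (forall a, a \in s <-> live_top a) ->
  \sum_(a <- s) scale a.1 ^+ d <= packing_const * \sum_(i < N) rho i ^+ d.
Proof.
move=> us sP; set A := \sum_(a <- s) _; set B := \sum_(i < N) _.
have D0 : 0 < (100 * d%:R) ^+ d :> R by rewrite exprn_gt0 // mulr_gt0.
have A0 : 0 <= A by apply: sumr_ge0 => a _; rewrite exprn_ge0 // ltW.
have h : A / (100 * d%:R) ^+ d <= 36 ^+ d * P%:R * B + thin_const d alpha * A.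
  apply: (@le_trans _ _ (\sum_(c <- s)
    (\sum_(i < N) (if `[< ball_related c i >] then (36 * rho i) ^+ d else 0)
    + \sum_(a <- s) (if `[< child_of c a >] then thin_const d alpha * scale a.1 ^+ d else 0)))).
    rewrite mulr_suml big_seq [leRHS]big_seq; apply: ler_sum => c cs.
    have lc := (sP c).1 cs; have [Xc tc cy al] := lc.
    have r00 : 0 < scale c.1 / 50 by rewrite divr_gt0.
    have tc' : top c.1 c.2 = (c.1, c.2) by rewrite tc -surjective_pairing.
    apply: le_trans (node_content T d0 alpha01 Ka ba etab rho0 cover
      (fun a => (sP a).2) Xc al cy r00 (or_introl (conj tc' (lexx _)))).
    rewrite le_eqVlt; apply/orP; left; apply/eqP.
    by rewrite -expr_div_n; congr (_ ^+ _); field; rewrite gt_eqF.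
  rewrite big_split /= lerD //.
    rewrite exchange_big /= mulr_sumr; apply: ler_sum => i _.
    rewrite sum_if_count exprMn [leLHS]mulrAC.
    rewrite ler_wpM2r ?exprn_ge0 ?(ltW (rho0 i)) // ler_wpM2l ?exprn_ge0 // ler_nat.
    by apply: count_related => // a /sP.
  rewrite exchange_big /= mulr_sumr; apply: ler_sum => a _.
  rewrite sum_if_count ler_piMr //.
    by rewrite mulr_ge0 ?thin_const_ge0 // exprn_ge0 // ltW.
  rewrite (_ : 1 = 1%:R) // ler_nat; by apply: count_parents => // c /sP.
(* The children cost at most half of [A], a finite sum, which can therefore be subtracted. *)
have tA : thin_const d alpha * (100 * d%:R) ^+ d * A <= 1 / 2 * A by rewrite ler_wpM2r.
move: h; rewrite ler_pdivrMr // => h.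
rewrite /packing_const; lra.
Qed.

(** Absorption needs parents and children summed over the same list, that of all live roots; a
    sublist inherits the bound. *)
Lemma packing_sum (s : seq (nat * V)) : uniq s -> (forall a, a \in s -> live_top a) ->
  \sum_(a <- s) scale a.1 ^+ d <= packing_const * \sum_(i < N) rho i ^+ d.
Proof.
move=> us sP; have [s' [us' s'P]] := live_tops_enum.
apply: le_trans (packing_sum_all us' s'P).
have /(perm_big _) -> : perm_eq s [seq a <- s' | a \in s].
  apply: uniq_perm => //; first exact: filter_uniq.
  move=> a; rewrite mem_filter; case: (boolP (a \in s)) => //= h.
  by symmetry; apply/s'P/sP.
rewrite big_filter [leRHS](bigID (fun a => a \in s)) /= lerDl.
by apply: sumr_ge0 => a _; rewrite exprn_ge0 // ltW.
Qed.

Definition node_const : R := (100 * d%:R / alpha) ^+ d * (36 ^+ d + thin_const d alpha * packing_const).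

(** Lower regularity at a node that need not be a root: the disc shrinks by [alpha], and the
    children are paid for by [packing_sum]. *)
Lemma node_sum k z : X k z -> alive b N xs rho k z -> enorm (z - y0) < r0 - 4 * scale k ->
  scale k ^+ d <= node_const * \sum_(i < N) rho i ^+ d.
Proof.
move=> Xz al zy; have [s [us sP]] := live_tops_enum.
have r00 : 0 < alpha * scale k / 50 by rewrite divr_gt0 // mulr_gt0.
have := node_content T d0 alpha01 Ka ba etab rho0 cover
      (fun a => (sP a).2) Xz al zy r00 (or_intror (lexx _)).
have -> : alpha * scale k / 50 / (2 * d%:R) = scale k / (100 * d%:R / alpha).
  by field; rewrite !gt_eqF.
have D0 : 0 < 100 * d%:R / alpha by rewrite divr_gt0 // mulr_gt0.
rewrite expr_div_n ler_pdivrMr ?exprn_gt0 // => h; apply: (le_trans h).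
rewrite [leLHS]mulrC /node_const -[leRHS]mulrA ler_wpM2l ?exprn_ge0 ?(ltW D0) // [leRHS]mulrDl lerD //.
  rewrite mulr_sumr; apply: ler_sum => i _; case: ifP => _; first by rewrite exprMn.
  by rewrite mulr_ge0 // exprn_ge0 // ltW.
apply: (@le_trans _ _ (thin_const d alpha * \sum_(a <- s) scale a.1 ^+ d)).
  rewrite mulr_sumr; apply: ler_sum => a _; case: ifP => // _.
  by rewrite mulr_ge0 ?thin_const_ge0 // exprn_ge0 // ltW.
by rewrite -mulrA ler_wpM2l ?thin_const_ge0 // packing_sum // => a /sP.
Qed.

End PackingSum.

(** * Counting nodes of comparable scale *)

Section NodeCounting.
Variables (R : realType) (d : nat).
Local Notation V := 'rV[R]_(d.+1).
Implicit Types (p q u v w x y z : V).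

Lemma size_fibres (T : eqType) (f : T -> nat) (k0 L M : nat) (s : seq T) : uniq s ->
  (forall a : T, a \in s -> (k0 <= f a < k0 + L)%N) ->
  (forall k (s' : seq T), uniq s' -> (forall a : T, a \in s' -> a \in s /\ f a = k) ->
    (size s' <= M)%N) ->
  (size s <= L * M)%N.
Proof.
elim: L s => [|L IH] s us sf sM.
  case: s us sf {sM} => [//|a s] _ /(_ a (mem_head _ _)).
  by rewrite addn0 => /andP[h1 h2]; have := leq_trans h2 h1; rewrite ltnn.
rewrite -(count_predC (fun a => f a == (k0 + L)%N)) -!size_filter mulSn leq_add //.
  apply: (sM (k0 + L)%N); first exact: filter_uniq.
  by move=> a; rewrite mem_filter => /andP[/eqP].
apply: IH; first exact: filter_uniq.
  move=> a; rewrite mem_filter /= => /andP[fa /sf /andP[h1 h2]].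
  by rewrite h1 ltn_neqAle fa /= -ltnS -addnS.
move=> k s' us' s'P; apply: (sM k) => // a /s'P [].
by rewrite mem_filter => /andP[].
Qed.

Variables (E : set V) (b K eta alpha : R) (X : nat -> set V) (par nu : nat -> V -> V).
Hypothesis T : net_tree E b K eta X par nu.
Hypothesis b2 : 2 <= b.
Local Notation top := (top alpha par nu).
Local Notation scale := (scale b).

Let b0 : 0 < b. Proof. exact: lt_le_trans b2. Qed.
Let s0 k : 0 < scale k. Proof. exact: scale_gt0. Qed.

(** Levels, times the two sides of a region, times net points per level. The number of levels is
    bounded linearly in [c2 / c1] through [scale_gap], in place of a logarithm. *)
Definition node_bound (c1 c2 c3 : R) : nat :=
  ((Num.truncn (c2 / c1)).+1 * (2 * packing_number d.+1 (c3 / c1)))%N.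

Lemma scale_gap k j : (k <= j)%N -> (j - k)%:R * scale j <= scale k.
Proof.
move=> /subnK <-; rewrite addnK; elim: (j - k)%N => [|i IH]; first by rewrite mul0r ltW.
have h := scale_half b2 (i + k); have h0 := scale_le b2 (leq_addl i k).
have h1 : i%:R * scale (i + k).+1 <= i%:R * (scale (i + k) / 2) by rewrite ler_wpM2l.
rewrite addSn -natr1 mulrDl mul1r; lra.
Qed.

Lemma count_nodes (c1 c2 c3 r : R) y (s : seq ((nat * V) * bool)) : 0 < c1 -> 0 < r ->
  uniq s ->
  (forall a, a \in s -> exists k w, [/\ X k w, top k w = a.1,
     c1 * r <= scale k <= c2 * r & enorm (w - y) <= c3 * r]) ->
  (size s <= node_bound c1 c2 c3)%N.
Proof.
move=> c10 r0 us sP.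
have cr : 0 < c1 * r by rewrite mulr_gt0.
pose good a (kw : nat * V) := [/\ X kw.1 kw.2, top kw.1 kw.2 = a,
  c1 * r <= scale kw.1 <= c2 * r & enorm (kw.2 - y) <= c3 * r].
pose f (a : (nat * V) * bool) : nat * V := xget (0%N, 0) [set kw | good a.1 kw].
have fP a : a \in s -> good a.1 (f a).
  move=> /sP [k [w [Xw tw hs hw]]].
  by apply: (@xgetPex _ (0%N, 0) [set kw | good a.1 kw]); exists (k, w).
case sE : s => [|a1 s1] //; rewrite -sE.
have a1s : a1 \in s by rewrite sE mem_head.
have ex : exists k, `[< exists2 a, a \in s & (f a).1 = k >].
  by exists (f a1).1; apply/asboolP; exists a1.
case: (ex_minnP ex) => k0 /asboolP [am ams amk] kmin.
apply: (@size_fibres _ (fun a => (f a).1) k0) => //.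
  move=> a as_; have ka : (k0 <= (f a).1)%N by apply: kmin; apply/asboolP; exists a.
  rewrite ka /= addnS ltnS -leq_subLR.
  have [_ _ /andP[h1 _] _] := fP a as_; have [_ _ /andP[h3 h2] _] := fP am ams.
  rewrite amk in h2 h3.
  have c21 : 0 <= c2 / c1.
    rewrite divr_ge0 ?(ltW c10) // -(pmulr_lge0 _ r0).
    by apply: le_trans h2; exact: ltW.
  rewrite truncn_ge_nat // ler_pdivlMr // -(ler_pM2r r0) -mulrA.
  apply: le_trans h2; apply: le_trans (scale_gap ka).
  by rewrite ler_wpM2l.
move=> k s' us' s'P.
apply: (@size_fibres _ (fun a => nat_of_bool a.2) 0 2) => //.
  by move=> a _; case: a.2.
move=> j s2 us2 s2P.
have fP2 a : a \in s2 -> [/\ good a.1 (f a), (f a).1 = k & nat_of_bool a.2 = j].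
  by move=> /s2P [/s'P [as_ fk] aj]; split => //; exact: fP.
rewrite -(size_map (fun a => (f a).2)); apply: (card_separated (s0 k) (y := y)).
- rewrite map_inj_in_uniq // => a c /fP2 [[_ ta _ _] ka ja] /fP2 [[_ tc _ _] kc jc] e.
  apply/eqP; rewrite -pair_eqE /pair_eq /= -ta -tc ka kc e eqxx /=.
  by move: ja jc => <-; case: a.2; case: c.2.
- move=> x /mapP [a /fP2 [[_ _ /andP[h1 _] hw] ka _] ->]; apply: (le_trans hw).
  rewrite ka in h1; have c30 : 0 <= c3.
    by rewrite -(pmulr_lge0 _ r0); apply: le_trans hw; exact: enorm_ge0.
  rewrite mulrAC ler_pdivlMr // -mulrA ler_wpM2l //.
  by rewrite mulrC.
- move=> x x' /mapP [a /fP2 [[Xa _ _ _] ka _] ->] /mapP [c /fP2 [[Xc _ _ _] kc _] ->].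
  by apply: (net_sep T); rewrite -?ka // ka -kc.
Qed.

Lemma net_countable k : countable (X k).
Proof.
have -> : X k = \bigcup_(M in [set: nat]) [set x | X k x /\ enorm (x - 0) < M%:R].
  apply/seteqP; split => [x Xx|x [M _ []] //].
  exists (Num.truncn (enorm x)).+1 => //; split => //; rewrite subr0; exact: truncnS_gt.
apply: bigcup_countable => // M _; apply: finite_set_countable.
have [s [us sP]] : exists s : seq V, uniq s /\
    forall x, x \in s <-> (X k x /\ enorm (x - 0) < M%:R).
  apply: (@bounded_enum _ _ (packing_number d.+1 (M%:R / scale k))) => s us sP.
  apply: (card_separated (s0 k) us (y := 0)) => [x xs|x x' /sP [Xx _] /sP [Xx' _]].
    by rewrite divfK ?gt_eqF //; apply: ltW; have [] := sP x xs.
  exact: (net_sep T).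
by apply/finite_seqP; exists s; apply/seteqP; split => x /= /sP.
Qed.

End NodeCounting.

(** * From finite covers to the Hausdorff measure *)

Section HausdorffPacking.
Variables (R : realType) (d : nat).
Local Notation V := 'rV[R]_(d.+1).
Variables (E : set V) (b K eta alpha : R) (X : nat -> set V) (par nu : nat -> V -> V).
Hypothesis T : net_tree E b K eta X par nu.
Hypotheses (d0 : (0 < d)%N) (alpha01 : 0 < alpha <= 1 / 2) (Ka : 8 < K * alpha)
  (ba : 1000 <= b * alpha) (etab : eta * b <= alpha)
  (thin_small : thin_const d alpha * (100 * d%:R) ^+ d <= 1 / 2) (cE : closed E) (b2 : 2 <= b).
Local Notation top := (top alpha par nu).
Local Notation scale := (scale b).
Let b0 : 0 < b. Proof. exact: lt_le_trans b2. Qed.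
Let s0 k : 0 < scale k. Proof. exact: scale_gt0. Qed.
Let dR : 0 < d%:R :> R. Proof. by rewrite ltr0n. Qed.

Lemma compact_setI_ball (y : V) (r : R) : compact (E `&` [set x | enorm (x - y) <= r]).
Proof.
apply: bounded_closed_compact.
  exists (r + enorm y); split; first exact: num_real.
  move=> M rM x [_ /= xy]; apply: (le_trans (mx_norm_le_enorm x)).
  by have := enormD (x - y) y; rewrite subrK; lra.
move=> x /closure_eballP cx; split.
  by apply: (closed_eballP cE) => e e0; have [z [Ez _] zx] := cx e e0; exists z.
apply/ler_addgt0Pr => e e0; have [z [_ /= zy] zx] := cx e e0.
by have := enorm_triangle z x y; rewrite (enormBC x z); lra.
Qed.

Lemma packing_const_gt0 : 0 < packing_const R d.
Proof.
by rewrite /packing_const !mulr_gt0 ?exprn_gt0 // ?mulr_gt0 // ltr0n expn_gt0.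
Qed.

Lemma node_const_gt0 : 0 < node_const d alpha.
Proof.
have /andP[a0 _] := alpha01.
rewrite /node_const mulr_gt0 ?exprn_gt0 //; first by rewrite divr_gt0 // mulr_gt0.
rewrite ltr_pwDl ?exprn_gt0 // mulr_ge0 ?(ltW packing_const_gt0) //.
by apply: thin_const_ge0.
Qed.

Lemma hausdorff_lower (c C r0 delta : R) y0 : 0 < C -> 0 < delta -> 0 < r0 ->
  (forall (N : nat) (x : nat -> V) (rho : nat -> R), (forall k, 0 < rho k) ->
     (forall k, rho k < delta) ->
     (forall z, E z -> enorm (z - y0) < r0 ->
        exists2 k, (k < N)%N & enorm (z - x k) < rho k) ->
     c <= C * \sum_(k < N) rho k ^+ d) ->
  (c%:E <= (2 ^+ d * C)%:E * hausdorff d (E `&` eball y0 (2 * r0)))%E.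
Proof.
move=> C0 del0 r00 H.
have sub : E `&` [set x | enorm (x - y0) <= r0] `<=` E `&` eball y0 (2 * r0).
  by move=> x [Ex /= xy]; split => //; rewrite /eball /=; lra.
have := hausdorff_ge (c := c / C) d0 (@compact_setI_ball y0 r0) sub del0.
have -> : c / C / 2 ^+ d = (2 ^+ d * C)^-1 * c by rewrite invfM mulrC mulrA mulrAC.
rewrite EFinM lee_pdivrMl ?mulr_gt0 ?exprn_gt0 //; apply => N x rho rho0 cov.
rewrite ler_pdivrMr // mulrC; apply: (H N x rho).
- by move=> k; case/andP: (rho0 k).
- by move=> k; case/andP: (rho0 k).
- by move=> z Ez zy; apply: cov; split => //=; exact: ltW.
Qed.

Lemma packing_hausdorff (s : seq (nat * V)) y0 (r0 : R) : 0 < r0 -> uniq s ->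
  (forall a, a \in s -> [/\ X a.1 a.2, top a.1 a.2 = a &
     enorm (a.2 - y0) < r0 - 4 * scale a.1]) ->
  ((\sum_(a <- s) scale a.1 ^+ d)%:E <=
     (2 ^+ d * packing_const R d)%:E * hausdorff d (E `&` eball y0 (2 * r0)))%E.
Proof.
move=> r00 us sP.
(* The covering balls are smaller than the smallest scale in [s], so that every root in [s] is
   alive. *)
apply: (hausdorff_lower packing_const_gt0 (s0 (\max_(a <- s) a.1)) r00).
move=> N x rho rho0 rhod cov.
apply: (packing_sum T d0 alpha01 Ka ba etab thin_small rho0 cov us) => a as_.
have [Xa ta ay] := sP a as_; split => // i _ _; apply: (lt_le_trans (rhod i)).
by apply: (scale_le b2); apply: (@leq_bigmax_seq _ _ xpredT (fun a => a.1)).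
Qed.

Lemma node_hausdorff k z y0 (r0 : R) : 0 < r0 -> X k z -> enorm (z - y0) < r0 - 4 * scale k ->
  ((scale k ^+ d)%:E <=
     (2 ^+ d * node_const d alpha)%:E * hausdorff d (E `&` eball y0 (2 * r0)))%E.
Proof.
move=> r00 Xz zy; apply: (hausdorff_lower node_const_gt0 (s0 k) r00).
move=> N x rho rho0 rhod cov.
by apply: (node_sum T d0 alpha01 Ka ba etab thin_small rho0 cov Xz).
Qed.

End HausdorffPacking.

(** * The family of domains *)

Section RegionFamily.
Variables (R : realType) (d : nat).
Local Notation V := 'rV[R]_(d.+1).
Variables (Omega : set V) (b H eta : R) (X : nat -> set V) (par nu : nat -> V -> V).
Local Notation E := (bdry Omega).
Local Notation alpha := (12 / H).
Local Notation K := (10 * H).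
Hypothesis T : net_tree E b K eta X par nu.
Hypotheses (d0 : (0 < d)%N) (H24 : 24 <= H) (ba : 1000 <= b * alpha) (b2 : 2 <= b)
  (etab : eta * b <= alpha) (eta_le : eta <= (8 * b)^-1)
  (thin_small : thin_const d alpha * (100 * d%:R) ^+ d <= 1 / 2) (oO : open Omega).
Local Notation top := (top alpha par nu).
Local Notation scale := (scale b).
Local Notation index := ((nat * V) * bool)%type.
Implicit Types (a c : index) (x y z w : V) (l : seq index).

Let H12 : 12 <= H. Proof. by apply: le_trans H24; rewrite ler_nat. Qed.
Let H0 : 0 < H. Proof. exact: lt_le_trans H12. Qed.
Let b0 : 0 < b. Proof. exact: lt_le_trans b2. Qed.
Let s0 k : 0 < scale k. Proof. exact: scale_gt0. Qed.
Let alpha01 : 0 < alpha <= 1 / 2.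
Proof. by rewrite divr_gt0 //= ler_pdivrMr //; have := H24; lra. Qed.
Let alpha1 : 0 < alpha <= 1.
Proof. by have /andP[h h'] := alpha01; rewrite h /=; apply: (le_trans h'); lra. Qed.
Let Ka : 8 < K * alpha.
Proof.
have -> : K * alpha = 120%:R by field; rewrite gt_eqF.
by rewrite ltr_nat.
Qed.

Lemma bdry_closed (A : set V) : closed (bdry A).
Proof. by apply: closedI; [exact: closed_closure|exact/open_closedC/open_interior]. Qed.

Lemma bdry_open_notin (A : set V) x : open A -> A x -> ~ bdry A x.
Proof. by rewrite openE => oA Ax [_]; apply; exact: oA. Qed.

Definition side a : V := if a.2 then nu a.1.1 a.1.2 else - nu a.1.1 a.1.2.

Definition piece a : set V := region b H X par nu a.1 (side a).

Definition indices : set index :=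
  [set a | [/\ X a.1.1 a.1.2, top a.1.1 a.1.2 = a.1 & Omega `&` piece a !=set0]].

Lemma side_axis a : axis nu a.1 (side a).
Proof. by rewrite /side; case: a.2; [left|right]. Qed.

Lemma indices_countable : countable indices.
Proof.
apply: (@sub_countable _ _ _ (([set: nat] `*`` X) `*` [set: bool])).
  by apply: subset_card_le => a [Xa _ _]; split => //; split.
apply: countableX; last exact: countableP.
by apply: countableXR => // k _; exact: (net_countable T b2).
Qed.

Lemma apexes_nonempty a : indices a -> apexes b H X par nu a.1 (side a) !=set0.
Proof. by move=> [_ _ [z [_ [x [_ [Ax _ _]]]]]]; exists x. Qed.

Lemma piece_lipschitz a : indices a -> lipschitz_graph_domain (2 * H) (piece a).
Proof.
move=> Ia; have [Xa _ _] := Ia.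
by apply: (region_lipschitz T b2 H12 Xa (side_axis a)); exact: apexes_nonempty.
Qed.

Lemma piece_sub a : indices a -> piece a `<=` Omega.
Proof.
move=> Ia; have [_ _ [z [Oz pz]]] := Ia.
have [[_ cp] _] := piece_lipschitz Ia.
apply: (connected_avoiding_bdry oO cp); last by exists z.
exact: (region_avoids T b2 H12 eta_le (side_axis a)).
Qed.

Lemma pieces_cover z : E 0 -> Omega z -> enorm z < 1 -> exists2 a, indices a & piece a z.
Proof.
move=> E0 Oz z1.
have [e e0 he] : exists2 e, 0 < e & forall y, E y -> e <= enorm (z - y).
  apply: contrapT => no; apply: (bdry_open_notin oO Oz).
  apply: (closed_eballP (@bdry_closed Omega)) => e e0.
  apply: contrapT => no'; apply: no; exists e => // y Ey.
  by rewrite leNgt; apply/negP => zy; apply: no'; exists y; rewrite // enormBC.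
(* The last such level is the scale of the distance from [z] to [E]. Level 0 qualifies because 0 is
   in [E] and [enorm z < 1]. *)
pose Q k := `[< exists2 x, E x & enorm (z - x) < scale k >].
have exQ : exists k, Q k.
  exists 0%N; apply/asboolP; exists 0 => //.
  by rewrite subr0 /scale expr0 invr1.
have [M hM] := scale_small alpha1 ba e0.
have bQ k : Q k -> (k <= M)%N.
  move=> /asboolP [x Ex zx]; rewrite leqNgt; apply/negP => /ltnW Mk.
  have := le_lt_trans (he x Ex) (lt_le_trans zx (le_trans (scale_le b2 Mk) hM)).
  by rewrite ltxx.
case: (ex_maxnP exQ bQ) => k /asboolP [x Ex zx] kmax.
have far y : E y -> scale k.+1 <= enorm (z - y).
  move=> Ey; rewrite leNgt; apply/negP => zy.
  have /kmax : Q k.+1 by apply/asboolP; exists y.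
  by rewrite ltnn.
have [t [m [Xt tt mt pz]]] := region_cover T b2 H12 eta_le Ex zx far.
have [s ms] : exists s : bool, side (t, s) = m.
  by case: mt => ->; [exists true|exists false].
by exists (t, s); rewrite /piece ?ms //; split => //=; exists z; split; rewrite /piece ?ms.
Qed.

Definition overlap_bound : nat :=
  node_bound d (6 * b * K)^-1 (6 * b * K) (3 / 4 * K * (6 * b * K + 1)).

Let bK0 : 0 < 6 * b * K.
Proof. by rewrite !mulr_gt0. Qed.

(** Each piece containing [x] has a node whose scale is comparable to the distance of [x] from [E].
    Nodes lie in [E], so two of them can be compared, with ratio at most
    [8 * b * (3 / 4 * K) = 6 * b * K]. *)
Lemma pieces_overlap x l : uniq l -> (forall a, a \in l -> piece a x) ->
  (size l <= overlap_bound)%N.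
Proof.
move=> ul lP.
have ex a : a \in l -> exists k w, [/\ X k w, top k w = a.1,
    enorm (x - w) <= 3 / 4 * K * scale k &
    forall y, E y -> scale k / (8 * b) <= enorm (x - y)].
  move=> /lP pa.
  have [k [w [Xw tw xw hd]]] := region_node T b2 H12 eta_le (side_axis a) pa.
  exists k, w; split => // y; exact: (node_dist T b2 H12 eta_le Xw xw hd).
case lE : l => [|a1 l1] //; rewrite -lE.
have [k1 [w1 [Xw1 _ xw1 far1]]] := ex a1 ltac:(by rewrite lE mem_head).
have V0 : 0 < (6 * b * K)^-1 by rewrite invr_gt0.
apply: (count_nodes (alpha := alpha) (y := w1) T b2 V0 (s0 k1) ul) => a /ex [k [w [Xw tw xw far]]].
have h1 := far1 w (net_sub T Xw); have h2 := far w1 (net_sub T Xw1).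
have h3 : scale k <= 6 * b * K * scale k1.
  move: (le_trans h2 xw1); rewrite ler_pdivrMr ?mulr_gt0 //.
  by move=> hh; apply: (le_trans hh); rewrite le_eqVlt; apply/orP; left; apply/eqP; field.
have h4 : scale k1 <= 6 * b * K * scale k.
  move: (le_trans h1 xw); rewrite ler_pdivrMr ?mulr_gt0 //.
  by move=> hh; apply: (le_trans hh); rewrite le_eqVlt; apply/orP; left; apply/eqP; field.
exists k, w; split => //; first by rewrite h3 andbT ler_pdivrMl.
have := enorm_triangle x w w1; rewrite (enormBC w x) => h5.
apply: (le_trans h5); apply: (@le_trans _ _ (3 / 4 * K * scale k + 3 / 4 * K * scale k1)).
  exact: lerD.
have -> : 3 / 4 * K * (6 * b * K + 1) * scale k1
    = 3 / 4 * K * (6 * b * K * scale k1) + 3 / 4 * K * scale k1 by ring.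
by rewrite lerD2r ler_wpM2l // mulr_ge0 // mulr_ge0 // ltW.
Qed.

Definition large_bound : nat :=
  node_bound d K^-1 (8 * b * (2 * H + 1)) (3 / 4 * K * (8 * b * (2 * H + 1)) + (2 * H + 1)).

(** [region_inner] moves a contact point to one at distance at least [r] from [E] and within
    [(2 * H + 1) * r] of [y]; the node found there has scale comparable to [r]. *)
Lemma large_pieces y (r : R) l : E y -> 0 < r -> uniq l ->
  (forall a, a \in l -> [/\ indices a, r <= scale a.1.1 &
     bdry (piece a) `&` eball y r !=set0]) -> (size l <= large_bound)%N.
Proof.
move=> Ey r0 ul lP.
have K0 : 0 < K by rewrite mulr_gt0.
have V0 : 0 < K^-1 by rewrite invr_gt0.
apply: (count_nodes (alpha := alpha) (y := y) T b2 V0 r0 ul) => a /lP [[Xa _ _] ra [z [[cz _] zy]]].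
have [|z' [pz' zz' far]] := @region_inner _ _ _ _ _ _ _ _ _ T b2 H12 eta_le _ _ _ r Xa (side_axis a) cz.
  by rewrite r0.
have [k [w [Xw tw zw hd]]] := region_node T b2 H12 eta_le (side_axis a) pz'.
have z'y : enorm (z' - y) <= (2 * H + 1) * r.
  by have := enorm_triangle z z' y; move: zy; rewrite /eball /=; lra.
have h1 := far w (net_sub T Xw).
have h2 : scale k <= 8 * b * (2 * H + 1) * r.
  have := le_trans (node_dist T b2 H12 eta_le Xw zw hd Ey) z'y.
  rewrite ler_pdivrMr ?mulr_gt0 // => h; apply: (le_trans h).
  by rewrite le_eqVlt; apply/orP; left; apply/eqP; ring.
exists k, w; split => //.
  rewrite h2 andbT ler_pdivrMl //; apply: (le_trans h1); apply: (le_trans zw).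
  by rewrite ler_pM2r // ler_piMl ?(ltW K0) //; lra.
have := enorm_triangle z' w y; rewrite (enormBC w z') => h3.
apply: (le_trans h3); rewrite [leRHS]mulrDl; apply: lerD => //; apply: (le_trans zw).
by rewrite -[leRHS]mulrA ler_wpM2l // mulr_ge0 // ltW.
Qed.

Lemma hausdorff_ge0 (F : set V) : (0 <= hausdorff d F)%E.
Proof.
apply: le_ereal_sup_tmp; exists (hausdorff_content d 1 F); first by exists 1 => //; exact: ltr01.
apply: le_ereal_inf_tmp => _ [U _ <-]; apply: nneseries_ge0 => k _ _.
by rewrite expe_ge0 // ediam_ge0.
Qed.

Lemma hausdorff_set0 : (hausdorff d (@set0 V) <= 0)%E.
Proof.
apply: hausdorff_le => // delta delta0; exists void, (fun=> set0), 0.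
by split => //; [rewrite lexx ltW|rewrite expr0n gtn_eqF // mulr0].
Qed.

Definition piece_const : R := star_bdry_const d (2 * H) * 2 ^+ d.

Lemma piece_const_ge0 : 0 <= piece_const.
Proof.
by rewrite /piece_const mulr_ge0 ?exprn_ge0 // star_bdry_const_ge0 // mulr_ge0 // ltW.
Qed.

Lemma piece_measure a y (r : R) : indices a -> 0 < r ->
  (hausdorff d (bdry (piece a) `&` eball y r)
    <= (piece_const * Num.min (2 * H * scale a.1.1) r ^+ d)%:E)%E.
Proof.
move=> Ia r0; have [Xa _ _] := Ia.
apply: (@region_bdry_measure _ _ _ _ _ _ _ _ _ T b2 H12 _ _ y r d0 Xa (side_axis a)) => //.
exact: apexes_nonempty.
Qed.

Lemma piece_near a y (r : R) : indices a -> bdry (piece a) `&` eball y r !=set0 ->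
  enorm (a.1.2 - y) < 3 * H * scale a.1.1 + r.
Proof.
move=> Ia [z [bz zy]]; have [Xa _ _] := Ia.
have m1 := axis_unit T Xa (side_axis a).
have le1 : scale a.1.1 <= 2 * H * scale a.1.1.
  by apply: ler_peMl; [exact: ltW|have := H12; lra].
have /andP[_ zc] := bdry_star_body_norm le1 (apexes_nonempty Ia)
  (fun x => apex_center T b2 H12 Xa (side_axis a)) bz.
have ct : enorm (center b H a.1 (side a) - a.1.2) <= H * scale a.1.1.
  by rewrite /center addrC addKr enormZ m1 mulr1 gtr0_norm // mulr_gt0.
have := enorm_triangle (center b H a.1 (side a)) a.1.2 z.
have := enorm_triangle z a.1.2 y.
rewrite (enormBC a.1.2 (center _ _ _ _)) (enormBC (center _ _ _ _) z).
by move: zy; rewrite /eball /=; lra.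
Qed.

(** Pieces with roots of scale at most [r] are paid for by packing, with a factor 2 for the two
    sides. The larger ones are bounded in number and contribute a multiple of [r ^+ d] each, which
    [ball_lower] compares with the measure of [E]. *)
Definition measure_const : R :=
  piece_const * (2 * H) ^+ d * (2 * (2 ^+ d * packing_const R d))
  + piece_const * large_bound%:R * b ^+ d * (2 ^+ d * node_const d alpha).

Lemma measure_const_ge0 : 0 <= measure_const.
Proof.
have P0 := packing_const_gt0 R d0.
have N0 := node_const_gt0 d0 alpha01.
have C0 := piece_const_ge0.
rewrite /measure_const addr_ge0 //.
  rewrite mulr_ge0 //; last by rewrite mulr_ge0 // mulr_ge0 ?exprn_ge0 // ltW.
  by rewrite mulr_ge0 // exprn_ge0 // mulr_ge0 // ltW.
rewrite mulr_ge0 //; last by rewrite mulr_ge0 ?exprn_ge0 // ltW.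
by rewrite mulr_ge0 ?exprn_ge0 ?(ltW b0) // mulr_ge0.
Qed.

Lemma small_pieces_packing y (r : R) l (Q : pred index) : 0 < r -> uniq l ->
  (forall a, a \in l -> Q a -> [/\ indices a, scale a.1.1 <= r &
     bdry (piece a) `&` eball y r !=set0]) ->
  ((\sum_(a <- l | Q a) scale a.1.1 ^+ d)%:E <= (2 * (2 ^+ d * packing_const R d))%:E *
    hausdorff d (E `&` eball y (2 * ((3 * H + 6) * r))))%E.
Proof.
move=> r0 ul lP.
(* The roots are within [(3 * H + 1) * r] of [y], and packing asks for a further margin of four
   scales. The two sides are summed separately because the list of roots must have no repetition. *)
have r1 : 0 < (3 * H + 6) * r by rewrite mulr_gt0 // addr_gt0 // mulr_gt0.
have half (B : bool) :
    ((\sum_(a <- l | Q a && (a.2 == B)) scale a.1.1 ^+ d)%:E <= (2 ^+ d * packing_const R d)%:E *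
    hausdorff d (E `&` eball y (2 * ((3 * H + 6) * r))))%E.
  have -> : \sum_(a <- l | Q a && (a.2 == B)) scale a.1.1 ^+ d =
      \sum_(t <- [seq a.1 | a <- l & Q a && (a.2 == B)]) scale t.1 ^+ d.
    by rewrite big_map big_filter.
  apply: (packing_hausdorff T d0 alpha01 Ka ba etab thin_small (@bdry_closed Omega) b2 r1).
    rewrite map_inj_in_uniq ?filter_uniq // => -[a1 a2] [c1 c2].
    by rewrite !mem_filter /= => /andP[/andP[_ /eqP ->] _] /andP[/andP[_ /eqP ->] _] ->.
  move=> t /mapP [a]; rewrite mem_filter => /andP[/andP[Qa _] al] ->.
  have [Ia ar tch] := lP a al Qa; have [Xa ta _] := Ia; split => //.
  apply: (lt_le_trans (piece_near Ia tch)).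
  have : H * scale a.1.1 <= H * r by rewrite ler_pM2l.
  by have := s0 a.1.1; lra.
have -> : \sum_(a <- l | Q a) scale a.1.1 ^+ d =
    \sum_(a <- l | Q a && (a.2 == true)) scale a.1.1 ^+ d
    + \sum_(a <- l | Q a && (a.2 == false)) scale a.1.1 ^+ d.
  rewrite (bigID (fun a => a.2)) /=; congr (_ + _); apply: eq_bigl => a.
    by rewrite eqb_id.
  by rewrite eqbF_neg.
rewrite EFinD mulr_natl mulr2n EFinD ge0_muleDl ?lee_fin; first exact: leeD.
  by rewrite mulr_ge0 ?exprn_ge0 // ltW // packing_const_gt0.
by rewrite mulr_ge0 ?exprn_ge0 // ltW // packing_const_gt0.
Qed.

Lemma ball_lower y (r : R) : E y -> 0 < r <= 1 ->
  ((r ^+ d)%:E <= (b ^+ d * (2 ^+ d * node_const d alpha))%:E *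
    hausdorff d (E `&` eball y (2 * ((3 * H + 6) * r))))%E.
Proof.
move=> Ey /andP[r0 r1].
have ex : exists k, scale k <= r by exact: (scale_small alpha1 ba r0).
case: (ex_minnP ex) => k kr kmin.
(* The preceding level has scale larger than [r]; at level 0 the assumption [r <= 1] takes its
   place. *)
have rk : r <= b * scale k.
  case: k kr kmin => [|k] kr kmin.
    by rewrite /scale expr0 invr1 mulr1; apply: (le_trans r1); apply: le_trans b2; lra.
  rewrite scaleS // mulrC divfK ?gt_eqF // leNgt; apply/negP => /ltW /kmin.
  by rewrite ltnn.
have r2 : 0 < (3 * H + 6) * r by rewrite mulr_gt0 // addr_gt0 // mulr_gt0.
have [x Xx yx] := net_cover T k Ey.
have xy : enorm (x - y) < (3 * H + 6) * r - 4 * scale k.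
  rewrite enormBC; have : 0 < H * r by rewrite mulr_gt0.
  lra.
have h := node_hausdorff T d0 alpha01 Ka ba etab thin_small (@bdry_closed Omega) b2 r2 Xx xy.
rewrite EFinM -muleA; apply: (@le_trans _ _ ((b ^+ d)%:E * (scale k ^+ d)%:E)%E).
  by rewrite -EFinM lee_fin -exprMn lerXn2r ?nnegrE ?mulr_ge0 // ltW.
by apply: lee_wpmul2l => //; rewrite lee_fin exprn_ge0 // ltW.
Qed.

Lemma pieces_measure y (r : R) l : E y -> 0 < r <= 1 -> uniq l ->
  (forall a, a \in l -> indices a) ->
  (\sum_(a <- l) hausdorff d (bdry (piece a) `&` eball y r) <=
    measure_const%:E * hausdorff d (E `&` eball y (2 * ((3 * H + 6) * r))))%E.
Proof.
move=> Ey r01 ul lP; have /andP[r0 r1] := r01.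
have C0 := piece_const_ge0.
pose touch a := `[< bdry (piece a) `&` eball y r !=set0 >].
pose small a := touch a && (scale a.1.1 <= r).
pose large a := touch a && ~~ (scale a.1.1 <= r).
pose x1 := piece_const * (2 * H) ^+ d.
have x10 : 0 <= x1 by rewrite mulr_ge0 // exprn_ge0 // mulr_ge0 // ltW.
apply: (@le_trans _ _ (\sum_(a <- l)
    ((if small a then x1 * scale a.1.1 ^+ d else 0) +
     (if large a then piece_const * r ^+ d else 0))%:E)%E).
  rewrite big_seq [leRHS]big_seq; apply: lee_sum => a al.
  rewrite /small /large; have [tch|ntch] := boolP (touch a); last first.
    rewrite addr0; apply: le_trans hausdorff_set0; apply: le_hausdorff => z hz.
    by exfalso; move/negP: ntch; apply; apply/asboolP; exists z.
  apply: (le_trans (piece_measure y (lP a al) r0)); rewrite lee_fin /=.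
  have m0 : 0 <= Num.min (2 * H * scale a.1.1) r.
    by rewrite le_min (ltW r0) !mulr_ge0 // ltW.
  case: (leP (scale a.1.1) r) => _ /=.
    rewrite addr0 /x1 -[leRHS]mulrA -exprMn ler_wpM2l // lerXn2r ?nnegrE ?ge_min ?lexx //.
    by rewrite !mulr_ge0 // ltW.
  by rewrite add0r ler_wpM2l // lerXn2r ?nnegrE ?ge_min ?lexx ?orbT // ltW.
rewrite sumEFin big_split /= EFinD /measure_const [in leRHS]EFinD ge0_muleDl ?lee_fin; last 2 first.
- by rewrite mulr_ge0 // mulr_ge0 // mulr_ge0 ?exprn_ge0 // ltW // packing_const_gt0.
- rewrite mulr_ge0 //; last by rewrite mulr_ge0 ?exprn_ge0 // ltW // node_const_gt0.
  by rewrite mulr_ge0 ?exprn_ge0 ?(ltW b0) // mulr_ge0.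
apply: leeD.
  rewrite -big_mkcond -mulr_sumr -/x1 EFinM [(x1 * _)%:E]EFinM -muleA.
  apply: lee_wpmul2l; first by rewrite lee_fin.
  apply: small_pieces_packing => // a al /andP[/asboolP tch ar].
  by split => //; exact: lP.
rewrite sum_if_count.
have cnt : (size [seq a <- l | large a] <= large_bound)%N.
  apply: (large_pieces Ey r0); first exact: filter_uniq.
  move=> a; rewrite mem_filter => /andP[/andP[/asboolP tch ar] al]; split => //.
    exact: lP.
  by rewrite ltW // ltNge.
apply: (@le_trans _ _ ((piece_const * large_bound%:R)%:E * (r ^+ d)%:E)%E).
  have pr0 : 0 <= piece_const * r ^+ d by rewrite mulr_ge0 // exprn_ge0 // ltW.
  by rewrite -EFinM lee_fin [leRHS]mulrAC ler_wpM2l // ler_nat.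
rewrite -(mulrA (piece_const * _)) (EFinM (piece_const * _)) -muleA.
by apply: lee_wpmul2l; [rewrite lee_fin mulr_ge0|exact: ball_lower].
Qed.

End RegionFamily.

Unset Implicit Arguments.

Theorem theoremB (R : realType) (d : nat) : (2 <= d)%N ->
  exists (A L eps : R) (C : nat) (C' : R),
    [/\ 0 < A, 0 < L, 0 < eps & 0 < C'] /\
    forall Omega : set 'rV[R]_(d.+1),
      domain Omega -> bdry Omega 0 ->
      reifenberg_flat eps d (bdry Omega) ->
      exists (J : set nat) (Om : nat -> set 'rV[R]_(d.+1)),
        [/\ (forall j, J j -> lipschitz_graph_domain L (Om j)),
            (forall j, J j -> Om j `<=` Omega),
            Omega `&` eball 0 1 `<=` \bigcup_(j in J) Om j,
            (forall x (s : seq nat), Omega x -> uniq s ->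
                (forall j, j \in s -> J j /\ Om j x) -> (size s <= C)%N) &
            (forall y r, bdry Omega y -> eball 0 1 y -> 0 < r -> r <= 1 ->
               (\esum_(j in J) hausdorff d (bdry (Om j) `&` eball y r)
                 <= C'%:E * hausdorff d (bdry Omega `&` eball y (A * r)))%E)].
Proof.
move=> d2; have d0 : (0 < d)%N by apply: ltn_trans d2.
have [Cd CdE] : {Cd : R | Cd = 16 ^+ d.-1 * (40 * d%:R) * (100 * d%:R) ^+ d} by eexists.
have Cd0 : 0 <= Cd by rewrite CdE mulr_ge0 ?exprn_ge0 // mulr_ge0 ?exprn_ge0.
(* Chosen so that [Cd * (12 / H) <= 1 / 2], the smallness required for absorption; the [+ 1] ensures
   [24 <= H], hence [alpha <= 1 / 2]. *)
have [H HE] : {H : R | H = 24 * (Cd + 1)} by eexists.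
have H24 : 24 <= H by rewrite HE; lra.
have H0 : 0 < H by lra.
have [b bE] : {b : R | b = 1000 * H} by eexists.
have b2 : 2 <= b by lra.
have b0 : 0 < b by lra.
have bH0 : 0 < 8 * b * H by rewrite mulr_gt0 // mulr_gt0.
have [eta etaE] : {eta : R | eta = (8 * b * H)^-1} by eexists.
have eta0 : 0 < eta by rewrite etaE invr_gt0.
(* With [K = 10 * H] this gives [4 * e * K = eta / 2], within what [flat_normal] allows. *)
have [e eE] : {e : R | e = eta / (80 * H)} by eexists.
have H80 : 0 < 80 * H by rewrite mulr_gt0.
have e0 : 0 < e by rewrite eE divr_gt0.
have ba : 1000 <= b * (12 / H).
  have -> : b * (12 / H) = 12 * 1000 by rewrite bE; field; rewrite gt_eqF.
  lra.
have etab : eta * b <= 12 / H.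
  have -> : eta * b = 8^-1 / H by rewrite etaE; field; rewrite !gt_eqF.
  by rewrite ler_pM2r ?invr_gt0 //; lra.
have eta_le : eta <= (8 * b)^-1.
  have b8 : 0 < 8 * b by rewrite mulr_gt0.
  by rewrite etaE lef_pV2 ?posrE // ler_peMr ?(ltW b8) //; lra.
have thin : thin_const d (12 / H) * (100 * d%:R) ^+ d <= 1 / 2.
  have -> : thin_const d (12 / H) * (100 * d%:R) ^+ d = Cd * (12 / H).
    by rewrite /thin_const CdE; ring.
  by rewrite mulrA ler_pdivrMr //; lra.
have eta1 : eta <= 1.
  apply: (le_trans eta_le); rewrite invf_le1 ?mulr_gt0 //; lra.
have e1 : 0 < e < 4^-1.
  rewrite e0 /= eE ltr_pdivrMr //; lra.
have eK : 4 * e * (10 * H) <= eta.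
  have -> : 4 * e * (10 * H) = eta / 2 by rewrite eE; field; rewrite gt_eqF.
  lra.
have K0 : 0 < 10 * H by rewrite mulr_gt0.
have m0 : 0 <= measure_const d b H by exact: (measure_const_ge0 d0 H24 b2).
(* The outer 2 in [A] is the enlargement made in [hausdorff_lower]; the final [+ 1] makes [C']
   positive. *)
exists (2 * (3 * H + 6)), (2 * H), (e / 2), (overlap_bound d b H), (measure_const d b H + 1).
split; first by split; lra.
move=> Omega [oO _] E0 flat.
have b1 : 1 <= b by lra.
have [X [par [nu T]]] := net_tree_exists b1 e1 K0 eK flat.
pose S := indices Omega b H X par nu.
(* The family is reindexed by natural numbers: [J] is the image of the injection [f], inverted there
   by [g]. *)
have /countable_injP [f finj] : countable S by apply: indices_countable T b2.
pose g (j : nat) := xget ((0%N, 0), true) [set a | S a /\ f a = j].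
have gP j : (f @` S) j -> S (g j) /\ f (g j) = j.
  move=> [a Sa <-]; apply: (@xgetPex _ _ [set c | S c /\ f c = f a]).
  by exists a.
pose Om j := piece b H X par nu (g j).
have gf a : S a -> g (f a) = a.
  move=> Sa; have [Sg fg] : S (g (f a)) /\ f (g (f a)) = f a by apply: gP; exists a.
  by apply: finj => //; rewrite inE.
have lmap (s : seq nat) : uniq s -> (forall j, j \in s -> (f @` S) j) -> uniq (map g s).
  move=> us sJ; rewrite map_inj_in_uniq // => i j /sJ /gP [_ fi] /sJ /gP [_ fj] ee.
  by rewrite -fi -fj ee.
exists (f @` S), Om; split.
- by move=> j /gP [Sj _]; apply: (piece_lipschitz T H24 b2 Sj).
- by move=> j /gP [Sj _]; apply: (piece_sub T H24 b2 eta_le oO Sj).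
- move=> z [Oz]; rewrite /eball /= subr0 => z1.
  have [a Sa pz] := pieces_cover T H24 ba b2 eta_le oO E0 Oz z1.
  by exists (f a); [exists a|rewrite /Om gf].
- move=> x s Ox us sP; rewrite -(size_map g).
  apply: (pieces_overlap T H24 b2 eta_le (x := x)).
    by apply: lmap => // j /sP [].
  by move=> a /mapP [j /sP [_ h] ->].
(* The sum over [J] is a supremum over finite subsets, so a bound for finite lists suffices. *)
- move=> y r Ey _ r0 r1; apply: ge_ereal_sup => _ [F [finF FJ] <-].
  rewrite fsbig_finite //.
  set s := finmap.enum_fset _.
  have us : uniq s by exact: finmap.fset_uniq.
  have sJ j : j \in s -> (f @` S) j.
    by rewrite (in_fset_set finF) inE; exact: FJ.
  have r01 : 0 < r <= 1 by rewrite r0.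
  have := pieces_measure T d0 H24 ba b2 etab eta_le thin (y := y) Ey r01 (lmap s us sJ).
  rewrite big_map => h; apply: (le_trans (h _)).
    by move=> a /mapP [j /sJ /gP [Sj _] ->].
  rewrite mulrA; apply: lee_wpmul2r; first exact: hausdorff_ge0.
  by rewrite lee_fin lerDl.
Qed.
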